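(* There is a polynomial-time $14$-approximation algorithm for Lottery Priority $\mathcal{F}$-Center on a point set $X$ when $\mathcal{F}=\{S\subseteq X: w(S)\le B\}$ for a poly-bounded weight function $w:X\to\mathbb{R}_{\ge0}$ and a parameter $B>0$.
   Context: Here $w(S)=\sum_{u\in S}w(u)$, and poly-bounded means the weights are bounded by a polynomial in the input size. Lottery Priority $\mathcal{F}$-Center: the input is a finite metric space $(X,d)$ in which each point $v$ has a distance demand $r(v)>0$ and a probability demand $\mathrm{prob}(v)\in[0,1]$, together with a family $\mathcal{F}\subseteq 2^X$ of allowed center sets. A probability distribution over $\mathcal{F}$ is $\alpha$-approximate if for every $v\in X$, $\Pr_{S}[d(v,S)\le\alpha\cdot r(v)]\ge\mathrm{prob}(v)$, where $d(v,S)=\min_{s\in S}d(v,s)$. An $\alpha$-approximation algorithm either correctly asserts that no $1$-approximate distribution exists, or returns an $\alpha$-approximate distribution.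
   Formalization: All numerical inputs are rational, and poly-bounded means that the weights are integer multiples, with polynomially bounded multipliers, of a common positive unit; merely bounding real weights is void, since w and B can be rescaled together, and would make the problem NP-hard. *)

(* Defs.v *)
From HB Require Import structures.
From mathcomp Require Import all_boot all_order all_algebra.
From mathcomp Require Import reals constructive_ereal.

Set Implicit Arguments.
Unset Strict Implicit.
Unset Printing Implicit Defensive.
Import Order.TTheory GRing.Theory Num.Theory.
Local Open Scope ring_scope.

(* Numerical inputs are rational so that they have a finite encoding.         *)
Record demand_metric (X : finType) := DemandMetric {
  dist : X -> X -> rat;
  radius : X -> rat;
  prob_demand : X -> rat;
  dist_eq0 : forall u v, dist u v = 0 <-> u = v;
  dist_sym : forall u v, dist u v = dist v u;
  dist_triangle : forall u v z, dist u z <= dist u v + dist v z;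
  radius_gt0 : forall v, 0 < radius v;
  prob_demand_itv : forall v, 0 <= prob_demand v <= 1
}.

(* Extended values: the distance to the empty set is +oo.                     *)
Definition dist_to (X : finType) (M : demand_metric X) (v : X) (S : {set X}) :
    \bar rat :=
  \big[Order.min/+oo%E]_(s in S) (dist M v s)%:E.

Definition distribution_over (K : realFieldType) (X : finType)
    (F : {set {set X}}) (mu : {set X} -> K) : Prop :=
  [/\ forall S, 0 <= mu S,
      forall S, S \notin F -> mu S = 0
    & \sum_(S : {set X}) mu S = 1].

Definition approximate (K : realFieldType) (X : finType) (M : demand_metric X)
    (F : {set {set X}}) (alpha : rat) (mu : {set X} -> K) : Prop :=
  distribution_over F mu /\
  forall v : X,
    ratr (prob_demand M v)
      <= \sum_(S : {set X} | (dist_to M v S <= (alpha * radius M v)%:E)%E) mu S.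

(* An answer is either None, the assertion of infeasibility, or an explicit   *)
(* list of center sets with their probabilities.                              *)
Definition answer (X : finType) := option (seq ({set X} * rat)).

Definition mass (X : finType) (l : seq ({set X} * rat)) (S : {set X}) : rat :=
  \sum_(p <- l | p.1 == S) p.2.

(* Infeasibility is asserted for real-valued distributions (K is the field    *)
(* of reals below), whereas a returned distribution has rational values.      *)
Definition correct_answer (K : realFieldType) (X : finType)
    (M : demand_metric X) (F : {set {set X}}) (alpha : rat) (a : answer X) :
    Prop :=
  match a with
  | None => ~ exists mu : {set X} -> K, approximate M F 1 mu
  | Some l => approximate M F alpha (mass l)
  end.

Record instance := Instance {
  npts : nat;
  space : demand_metric 'I_npts;
  weight : 'I_npts -> rat;
  budget : rat;
  weight_ge0 : forall v, 0 <= weight v;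
  budget_gt0 : 0 < budget
}.
Arguments weight : clear implicits.

Definition knapsack_family (I : instance) : {set {set 'I_(npts I)}} :=
  [set S : {set 'I_(npts I)} | \sum_(u in S) weight I u <= budget I].

(* Model of computation: a first-order call-by-value functional language on   *)
(* binary trees (S-expressions).  A program is a list of bodies of unary,     *)
(* mutually recursive functions, the first of which is the entry point;       *)
(* variables are de Bruijn indices.  Each evaluation step is charged the full *)
(* size of the tree it yields, with no benefit from sharing, so that running  *)
(* times agree with those of Turing machines up to a polynomial.              *)
Inductive data := DNil | DCons of data & data.

Fixpoint dsize (v : data) : nat :=
  match v with DNil => 1%N | DCons a b => (dsize a + dsize b).+1 end.

Definition dhead (v : data) := if v is DCons a _ then a else DNil.
Definition dtail (v : data) := if v is DCons _ b then b else DNil.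

Inductive exp :=
  | EVar of nat
  | ENil
  | ECons of exp & exp
  | EHead of exp
  | ETail of exp
  | EIf of exp & exp & exp
  | ELet of exp & exp
  | ECall of nat & exp.

Definition program := seq exp.
Definition body (P : program) (f : nat) : exp := nth ENil P f.

(* [eval P env e v t]: in the environment env, e evaluates to v at cost t.    *)
Inductive eval (P : program) : seq data -> exp -> data -> nat -> Prop :=
  | EvalVar env i :
      eval P env (EVar i) (nth DNil env i) (dsize (nth DNil env i))
  | EvalNil env : eval P env ENil DNil (dsize DNil)
  | EvalCons env e1 e2 v1 v2 t1 t2 :
      eval P env e1 v1 t1 -> eval P env e2 v2 t2 ->
      eval P env (ECons e1 e2) (DCons v1 v2) (t1 + t2 + dsize (DCons v1 v2))%N
  | EvalHead env e v t :
      eval P env e v t -> eval P env (EHead e) (dhead v) (t + dsize (dhead v))%N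
  | EvalTail env e v t :
      eval P env e v t -> eval P env (ETail e) (dtail v) (t + dsize (dtail v))%N
  | EvalIfCons env e e1 e2 a b v t t1 :
      eval P env e (DCons a b) t -> eval P env e1 v t1 ->
      eval P env (EIf e e1 e2) v (t + t1 + dsize v)%N
  | EvalIfNil env e e1 e2 v t t2 :
      eval P env e DNil t -> eval P env e2 v t2 ->
      eval P env (EIf e e1 e2) v (t + t2 + dsize v)%N
  | EvalLet env e1 e2 v1 v t1 t2 :
      eval P env e1 v1 t1 -> eval P (v1 :: env) e2 v t2 ->
      eval P env (ELet e1 e2) v (t1 + t2 + dsize v)%N
  | EvalCall env f e u v t1 t2 :
      eval P env e u t1 -> eval P [:: u] (body P f) v t2 ->
      eval P env (ECall f e) v (t1 + t2 + dsize v)%N.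

Definition runs (P : program) (input output : data) (t : nat) : Prop :=
  eval P [:: input] (body P 0) output t.

Definition enc_bool (b : bool) : data := if b then DCons DNil DNil else DNil.

Definition enc_seq (T : Type) (enc : T -> data) (s : seq T) : data :=
  foldr (fun x => DCons (enc x)) DNil s.

(* Numbers are written in binary, least significant bit first, with the       *)
(* leading 1 replaced by the end of the list.                                 *)
Fixpoint enc_pos (p : BinNums.positive) : data :=
  match p with
  | BinNums.xH => DNil
  | BinNums.xO p' => DCons (enc_bool false) (enc_pos p')
  | BinNums.xI p' => DCons (enc_bool true) (enc_pos p')
  end.

Definition enc_nat (n : nat) : data :=
  if bin_of_nat n is BinNums.Npos p then DCons DNil (enc_pos p) else DNil.

Definition enc_int (z : int) : data :=
  DCons (enc_bool (z < 0)) (enc_nat `|z|%N).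

Definition enc_rat (x : rat) : data :=
  DCons (enc_int (numq x)) (enc_nat `|denq x|%N).

Definition enc_fun (n : nat) (T : Type) (enc : T -> data) (f : 'I_n -> T) :
    data :=
  enc_seq (fun i => enc (f i)) (enum 'I_n).

Definition enc_set (n : nat) (S : {set 'I_n}) : data :=
  enc_fun enc_bool (fun i => i \in S).

Definition enc_instance (I : instance) : data :=
  DCons (enc_fun (enc_fun enc_rat) (dist (space I)))
    (DCons (enc_fun enc_rat (radius (space I)))
      (DCons (enc_fun enc_rat (prob_demand (space I)))
        (DCons (enc_fun enc_rat (weight I)) (enc_rat (budget I))))).

Definition enc_answer (n : nat) (a : answer 'I_n) : data :=
  match a with
  | None => DNil
  | Some l =>
      DCons DNil (enc_seq (fun p => DCons (enc_set p.1) (enc_rat p.2)) l)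
  end.

Definition input_size (I : instance) : nat := dsize (enc_instance I).

(* As usual for knapsack-type constraints, poly-boundedness refers to         *)
(* integral weights; here up to scaling, i.e. to the multiples of some common *)
(* unit.  Bounding the values of arbitrary rational weights would be void,    *)
(* since scaling w and B together leaves the center sets unchanged.           *)
Definition poly_bounded (q : {poly nat}) (I : instance) : Prop :=
  exists2 unit : rat, 0 < unit &
    forall v, exists2 k : nat,
      weight I v = k%:R * unit :> rat & (k <= q.[input_size I])%N.

(* A deterministic algorithm for the instances in the class C whose running   *)
(* time is polynomial in the input size.                                      *)
Definition polytime_approximation (K : realFieldType) (alpha : rat)
    (C : instance -> Prop) : Prop :=
  exists (P : program) (p : {poly nat}),
    forall I : instance, C I ->
    exists (a : answer 'I_(npts I)) (t : nat),
      [/\ runs P (enc_instance I) (enc_answer a) t,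
          (t <= p.[input_size I])%N
        & correct_answer K (space I) (knapsack_family I) alpha a].

(* Main.v *)
(* Call u and v near if d(u,v) <= r(u) + 2 r(v) and d(u,v) <= r(v) + 2 r(u).  Scanning the
   points by decreasing probability demand, drop v when an earlier representative u is near
   v with r(u) <= 4 r(v); near representatives then have radii that differ by a factor
   more than 4, and v is served within 14 r(v) as soon as u is served within 2 r(u).
   Near representatives form a forest ordered by radius: attach to each representative t
   the chain of the larger ones near to t, and list the chains such that each
   representative u occurs in consecutive chains.  Opening the cheapest point within
   r(t) of t serves within 2 r(u) every u of the chain of t.
   A feasible center set S charges each s in S to the smallest representative whose ball
   contains s, hence yields a subset of chains of total cost at most w(S) that meets the
   chains of each u whose ball is hit.  Subsets of chains of cost at most B are the paths of
   an acyclic graph with nodes (last chain, money spent), of polynomial size as the weights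
   are poly-bounded, and the probability that u is served is the flow entering the block
   of chains of u, a linear function of the flow.  So a distribution exists only if a
   homogeneous linear system has a nonnegative solution, and conversely a rational solution
   decomposes into weighted paths, which form the returned distribution.
   The linear system is solved exactly by a perceptron with rescaling on the orthogonal
   projection onto its kernel.  Polynomial time is obtained compositionally: [pt D f] says
   that some program computes f on D in time polynomial in the size of its input, and loops
   preserve it when all intermediate values are polynomially bounded. *)

Require Import Defs.
From mathcomp Require Import all_boot all_order all_algebra.
From mathcomp Require Import perm reals constructive_ereal zify ring lra.
From Stdlib Require List.

Set Implicit Arguments.
Unset Strict Implicit.
Unset Printing Implicit Defensive.

(** * Polynomial-time functions *)

Definition poly_growth (b : nat -> nat) := exists k, forall n, b n <= (n + 2) ^ k.

Lemma expn_add2_le n j k : j <= k -> (n + 2) ^ j <= (n + 2) ^ k.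
Proof. by move=> jk; rewrite leq_pexp2l // addn2. Qed.

(** The base [n + 2] is at least 2, so constants and sums are absorbed by a larger exponent. *)
Lemma growth_const c : poly_growth (fun _ => c).
Proof.
exists c => n; apply: leq_trans (ltnW (ltn_expl c (isT : 1 < 2))) _.
by case: c => // c; rewrite leq_exp2r // addn2.
Qed.

Lemma growth_id : poly_growth id.
Proof. by exists 1 => n; rewrite expn1 leq_addr. Qed.

Lemma growth_add b c : poly_growth b -> poly_growth c -> poly_growth (fun n => b n + c n).
Proof.
move=> [j hj] [k hk]; exists (maxn j k).+1 => n.
rewrite expnS (leq_trans (leq_add (hj n) (hk n))) //.
have := expn_add2_le n (leq_maxl j k); have := expn_add2_le n (leq_maxr j k).
set u := (_ ^ maxn _ _); rewrite mulnDl => h1 h2.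
by rewrite mul2n -addnn; apply: leq_trans (leq_add h2 h1) (leq_addl _ _).
Qed.

Lemma growth_mul b c : poly_growth b -> poly_growth c -> poly_growth (fun n => b n * c n).
Proof.
by move=> [j hj] [k hk]; exists (j + k) => n; rewrite expnD leq_mul.
Qed.

Lemma growth_exp b k : poly_growth b -> poly_growth (fun n => b n ^ k).
Proof.
move=> [j hj]; exists (j * k) => n; rewrite expnM.
by case: k => // k; rewrite leq_exp2r.
Qed.

Lemma growth_succ b : poly_growth b -> poly_growth (fun n => (b n).+1).
Proof.
move=> /growth_add /(_ (growth_const 1)) [k hk].
by exists k => n; rewrite -addn1.
Qed.

Lemma growth_le b c : poly_growth c -> (forall n, b n <= c n) -> poly_growth b.
Proof. by move=> [k hk] le; exists k => n; apply: leq_trans (le n) (hk n). Qed.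

Lemma growth_poly (q : {poly nat}) : poly_growth (fun n => q.[n])%R.
Proof.
elim/poly_ind: q => [|p c IH].
  by apply: growth_le (growth_const 0) _ => n; rewrite horner0.
apply: growth_le (growth_add (growth_mul IH growth_id) (growth_const c)) _.
by move=> n; rewrite hornerMXaddC.
Qed.

Ltac growth := repeat first [ apply: growth_const | apply: growth_id | apply: growth_succ
  | apply: growth_add | apply: growth_mul | apply: growth_exp | assumption].

(** * Relocation of programs *)

Fixpoint calls_below (n : nat) (e : exp) : bool :=
  match e with
  | EVar _ | ENil => true
  | ECons a b | ELet a b => calls_below n a && calls_below n b
  | EHead a | ETail a => calls_below n a
  | EIf a b c => [&& calls_below n a, calls_below n b & calls_below n c]
  | ECall f a => (f < n) && calls_below n a
  end.

Definition closed_program (P : program) := all (calls_below (size P)) P.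

Fixpoint shift_calls (k : nat) (e : exp) : exp :=
  match e with
  | EVar i => EVar i
  | ENil => ENil
  | ECons a b => ECons (shift_calls k a) (shift_calls k b)
  | ELet a b => ELet (shift_calls k a) (shift_calls k b)
  | EHead a => EHead (shift_calls k a)
  | ETail a => ETail (shift_calls k a)
  | EIf a b c => EIf (shift_calls k a) (shift_calls k b) (shift_calls k c)
  | ECall f a => ECall (k + f) (shift_calls k a)
  end.

Lemma shift_calls0 e : shift_calls 0 e = e.
Proof. by elim: e => //= *; rewrite ?add0n; congruence. Qed.

Lemma calls_below_le m n e : m <= n -> calls_below m e -> calls_below n e.
Proof.
move=> mn; elim: e => //= [a IHa b IHb|a IHa b IHb c IHc|a IHa b IHb|f a IHa].
- by case/andP=> /IHa-> /IHb->.
- by case/and3P=> /IHa-> /IHb-> /IHc->.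
- by case/andP=> /IHa-> /IHb->.
by case/andP=> fm /IHa->; rewrite (leq_trans fm mn).
Qed.

Lemma calls_below_shift k n e : calls_below n e -> calls_below (k + n) (shift_calls k e).
Proof.
elim: e => //= [a IHa b IHb|a IHa b IHb c IHc|a IHa b IHb|f a IHa].
- by case/andP=> /IHa-> /IHb->.
- by case/and3P=> /IHa-> /IHb-> /IHc->.
- by case/andP=> /IHa-> /IHb->.
by case/andP=> fm /IHa->; rewrite ltn_add2l fm.
Qed.

(** Function indices are absolute, so embedding [P] after [Q] shifts every call by [size Q].
    Closedness keeps all calls inside the block: a call past the end of [P] means [ENil], and after
    embedding it would reach a body of [Q']. *)
Lemma eval_link (P Q Q' : program) env e v t :
  closed_program P -> calls_below (size P) e -> eval P env e v t ->
  eval (Q ++ map (shift_calls (size Q)) P ++ Q') env (shift_calls (size Q) e) v t.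
Proof.
move=> cP + ev; elim: ev => {env e v t} /=; try by [constructor|move=> *; econstructor; eauto].
- move=> env e1 e2 v1 v2 t1 t2 _ IH1 _ IH2 /andP[/IH1 ? /IH2 ?].
  exact: EvalCons.
- move=> env e e1 e2 a b v t t1 _ IH _ IH1 /and3P[/IH ? /IH1 ? _].
  by apply: EvalIfCons; eauto.
- move=> env e e1 e2 v t t1 _ IH _ IH1 /and3P[/IH ? _ /IH1 ?].
  by apply: EvalIfNil; eauto.
- move=> env e1 e2 v1 v t1 t2 _ IH1 _ IH2 /andP[/IH1 ? /IH2 ?].
  by apply: EvalLet; eauto.
move=> env f e u v t1 t2 _ IH1 _ IH2 /andP[fP /IH1 h1].
apply: EvalCall h1 _.
have -> : body (Q ++ map (shift_calls (size Q)) P ++ Q') (size Q + f) = shift_calls (size Q) (body P f).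
  by rewrite /body nth_cat ltnNge leq_addr /= addKn nth_cat size_map fP (nth_map ENil).
by apply: IH2; move/all_nthP: cP; apply.
Qed.

Lemma dsize_gt0 v : 0 < dsize v.
Proof. by case: v. Qed.

(** Every step is charged for its result, so any time bound is at the same time a bound on the size
    of the output. *)
Lemma eval_dsize P env e v t : eval P env e v t -> dsize v <= t.
Proof. by elim=> *; rewrite ?leq_addl. Qed.

Definition runs_within P env e v b := exists2 t, eval P env e v t & t <= b.

Lemma dsize_dhead v : dsize (dhead v) <= dsize v.
Proof. by case: v => //= a b; lia. Qed.

Lemma dsize_dtail v : dsize (dtail v) <= dsize v.
Proof. by case: v => //= a b; lia. Qed.

Lemma within_le P env e v b b' : runs_within P env e v b -> b <= b' -> runs_within P env e v b'.
Proof. by move=> [t ev tb] bb; exists t => //; apply: leq_trans bb. Qed.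

Lemma within_var P env i v : nth DNil env i = v -> runs_within P env (EVar i) v (dsize v).
Proof. by move<-; eexists; [apply: EvalVar|]. Qed.

Lemma within_nil P env : runs_within P env ENil DNil 1.
Proof. by eexists; [apply: EvalNil|]. Qed.

Lemma within_cons P env e1 e2 v1 v2 b1 b2 :
  runs_within P env e1 v1 b1 -> runs_within P env e2 v2 b2 ->
  runs_within P env (ECons e1 e2) (DCons v1 v2) (b1 + b2 + (dsize v1 + dsize v2).+1).
Proof.
move=> [t1 h1 l1] [t2 h2 l2]; eexists; first exact: EvalCons h1 h2.
by rewrite leq_add // leq_add.
Qed.

Lemma within_head P env e v b : runs_within P env e v b ->
  runs_within P env (EHead e) (dhead v) (b + dsize v).
Proof.
move=> [t h l]; eexists; first exact: EvalHead h.
by rewrite leq_add // dsize_dhead.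
Qed.

Lemma within_tail P env e v b : runs_within P env e v b ->
  runs_within P env (ETail e) (dtail v) (b + dsize v).
Proof.
move=> [t h l]; eexists; first exact: EvalTail h.
by rewrite leq_add // dsize_dtail.
Qed.

Lemma within_if_cons P env e e1 e2 a c v b b1 :
  runs_within P env e (DCons a c) b -> runs_within P env e1 v b1 ->
  runs_within P env (EIf e e1 e2) v (b + b1 + dsize v).
Proof.
move=> [t1 h1 l1] [t2 h2 l2]; eexists; first exact: EvalIfCons h1 h2.
by rewrite leq_add2r leq_add.
Qed.

Lemma within_if_nil P env e e1 e2 v b b2 :
  runs_within P env e DNil b -> runs_within P env e2 v b2 ->
  runs_within P env (EIf e e1 e2) v (b + b2 + dsize v).
Proof.
move=> [t1 h1 l1] [t2 h2 l2]; eexists; first exact: EvalIfNil h1 h2.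
by rewrite leq_add2r leq_add.
Qed.

Lemma within_call P env f e u v b1 b2 :
  runs_within P env e u b1 -> runs_within P [:: u] (body P f) v b2 ->
  runs_within P env (ECall f e) v (b1 + b2 + dsize v).
Proof.
move=> [t1 h1 l1] [t2 h2 l2]; eexists; first exact: EvalCall h1 h2.
by rewrite leq_add2r leq_add.
Qed.

Lemma within_dsize P env e v b : runs_within P env e v b -> dsize v <= b.
Proof. by case=> t /eval_dsize h /(leq_trans h). Qed.

(** * Polynomial-time computability on a domain *)

Class enc T := Enc { encode : T -> data }.
Definition esize {T} {E : enc T} (x : T) : nat := dsize (encode x).

Definition computes {X A} {EX : enc X} {EA : enc A} (P : program) (i k : nat)
    (D : X -> Prop) (f : X -> A) :=
  i < size P /\
  forall x, D x -> runs_within P [:: encode x] (body P i) (encode (f x)) ((esize x + 2) ^ k).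

(** Value and time are claimed on [D] only. Promises enter through the domain: nonzero divisors,
    nonnegative flows, the states that a loop can reach, and finally poly-bounded weights. *)
Definition pt {X A} {EX : enc X} {EA : enc A} (D : X -> Prop) (f : X -> A) :=
  exists P i k, closed_program P /\ computes P i k D f.

Lemma computes_exp {X A} {EX : enc X} {EA : enc A} P i k k' (D : X -> Prop) (f : X -> A) :
  k <= k' -> computes P i k D f -> computes P i k' D f.
Proof.
move=> kk [ip h]; split=> // x /h hx; apply: within_le hx _.
exact: expn_add2_le.
Qed.

Lemma computes_link {X A} {EX : enc X} {EA : enc A} P Q Q' i k (D : X -> Prop) (f : X -> A) :
  closed_program P -> computes P i k D f ->
  computes (Q ++ map (shift_calls (size Q)) P ++ Q') (size Q + i) k D f.
Proof.
move=> cP [ip h]; split; first by rewrite !size_cat size_map ltn_add2l ltn_addr.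
move=> x /h [t ev tb]; exists t => //.
have -> : body (Q ++ map (shift_calls (size Q)) P ++ Q') (size Q + i) = shift_calls (size Q) (body P i).
  by rewrite /body nth_cat ltnNge leq_addr /= addKn nth_cat size_map ip (nth_map ENil).
by apply: eval_link => //; move/all_nthP: cP; apply.
Qed.

Lemma computes_ext {X A} {EX : enc X} {EA : enc A} P Q i k (D : X -> Prop) (f : X -> A) :
  closed_program P -> computes P i k D f -> computes (P ++ Q) i k D f.
Proof.
move=> cP /(computes_link [::] Q cP).
rewrite add0n cat0s.
by have -> : map (shift_calls (size (@nil exp))) P = P by rewrite -[RHS]map_id; apply: eq_map => e; rewrite /= shift_calls0.
Qed.

(** Two programs found independently are put side by side, with a common exponent, so that a new
    body can call both. *)
Lemma pt_join {X A Y B} {EX : enc X} {EA : enc A} {EY : enc Y} {EB : enc B}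
    (D : X -> Prop) (f : X -> A) (D' : Y -> Prop) (g : Y -> B) :
  pt D f -> pt D' g ->
  exists P i j k, [/\ closed_program P, computes P i k D f & computes P j k D' g].
Proof.
move=> [P [i [k [cP cf]]]] [Q [j [l [cQ cg]]]].
exists (P ++ map (shift_calls (size P)) Q), i, (size P + j), (maxn k l); split.
- rewrite /closed_program all_cat size_cat size_map; apply/andP; split.
    by apply: sub_all cP => e; apply: calls_below_le; rewrite leq_addr.
  rewrite all_map; apply: sub_all cQ => e /=; exact: calls_below_shift.
- by apply: computes_exp (leq_maxl _ _) _; apply: computes_ext.
- apply: computes_exp (leq_maxr _ _) _.
  by have := computes_link P [::] cQ cg; rewrite cats0.
Qed.

(* A new function body may call itself, at index [size P]. *)
Lemma pt_new {X A} {EX : enc X} {EA : enc A} (D : X -> Prop) (f : X -> A) P e c :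
  closed_program P -> calls_below (size P).+1 e -> poly_growth c ->
  (forall x, D x -> runs_within (rcons P e) [:: encode x] e (encode (f x)) (c (esize x))) ->
  pt D f.
Proof.
move=> cP ce [k hk] h; exists (rcons P e), (size P), k; split.
  rewrite /closed_program all_rcons size_rcons ce /=.
  by apply: sub_all cP => e'; apply: calls_below_le.
split; first by rewrite size_rcons.
move=> x /h hx; rewrite /body nth_rcons ltnn eqxx.
exact: within_le hx (hk _).
Qed.

(** The factor 2 pays for the run of the callee and for the charge of the call itself, which is the
    size of the result and hence at most that run. *)
Lemma computes_call {X A} {EX : enc X} {EA : enc A} P i k (D : X -> Prop) (f : X -> A) env e x b :
  computes P i k D f -> D x -> runs_within P env e (encode x) b ->
  runs_within P env (ECall i e) (encode (f x)) (b + 2 * (esize x + 2) ^ k).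
Proof.
move=> [_ h] /h hx /within_call hc; apply: within_le (hc _ _ _ hx) _.
by rewrite -addnA leq_add2l mul2n -addnn leq_add2l (within_dsize hx).
Qed.

Lemma pt_size {X A} {EX : enc X} {EA : enc A} (D : X -> Prop) (f : X -> A) :
  pt D f -> exists k, forall x, D x -> esize (f x) <= (esize x + 2) ^ k.
Proof. by move=> [P [i [k [_ [_ h]]]]]; exists k => x /h /within_dsize. Qed.

Section Basic.
Context {X : Type} {EX : enc X}.
Implicit Type D : X -> Prop.

Lemma pt_sub {A} {EA : enc A} D D' (f : X -> A) : (forall x, D x -> D' x) -> pt D' f -> pt D f.
Proof.
move=> sub [P [i [k [cP [ip h]]]]]; exists P, i, k; do 2?split=> //.
by move=> x /sub/h.
Qed.

(** Programs see encodings only. Constructors and projections of all data types are reduced to tree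
    operations through this lemma. *)
Lemma pt_enc {A B} {EA : enc A} {EB : enc B} D (f : X -> A) (g : X -> B) :
  (forall x, D x -> encode (g x) = encode (f x)) -> pt D f -> pt D g.
Proof.
move=> sub [P [i [k [cP [ip h]]]]]; exists P, i, k; do 2?split=> //.
by move=> x Dx; rewrite sub //; apply: h.
Qed.

Lemma pt_eq {A} {EA : enc A} D (f g : X -> A) :
  (forall x, D x -> g x = f x) -> pt D f -> pt D g.
Proof. by move=> e; apply: pt_enc => x /e->. Qed.

Lemma pt_id D : pt D (fun x : X => x).
Proof.
apply: (@pt_new _ _ _ _ _ _ [::] (EVar 0) id) => //; first exact: growth_id.
by move=> x _; apply: within_var.
Qed.

Fixpoint quote (d : data) : exp :=
  if d is DCons a b then ECons (quote a) (quote b) else ENil.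

Lemma calls_below_quote n d : calls_below n (quote d).
Proof. by elim: d => //= a -> b ->. Qed.

Lemma quote_cost d : exists b, forall P env, runs_within P env (quote d) d b.
Proof.
elim: d => [|a [b hb] c [b' hb']]; first by exists 1 => *; apply: within_nil.
by eexists => P env; apply: within_cons.
Qed.

Lemma pt_const {A} {EA : enc A} D (a : A) : pt D (fun _ : X => a).
Proof.
have [b hb] := quote_cost (encode a).
apply: (@pt_new _ _ _ _ _ _ [::] (quote (encode a)) (fun _ => b)) => //.
- exact: calls_below_quote.
- exact: growth_const.
Qed.

(* The intermediate value is only known through its encoding, which covers case
   analysis without a default value. *)
Lemma pt_via {Z Y A} {EZ : enc Z} {EY : enc Y} {EA : enc A} D (D' : Y -> Prop)
    (f : Y -> A) (g : X -> Z) (h : X -> A) :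
  pt D' f -> pt D g ->
  (forall x, D x -> exists y, [/\ D' y, encode y = encode (g x) & f y = h x]) -> pt D h.
Proof.
move=> pf pg sub; have [P [i [j [k [cP cf cg]]]]] := pt_join pf pg.
have [sz hsz] : exists l, forall x, D x -> esize (g x) <= (esize x + 2) ^ l.
  by apply: pt_size; exists P, j, k.
pose e := ECall i (ECall j (EVar 0)).
apply: (@pt_new _ _ _ _ _ _ P e (fun n => n + 2 * (n + 2) ^ k + 2 * ((n + 2) ^ sz + 2) ^ k)) => //.
- by case: cf => ip _; case: cg => jp _ /=; rewrite (leqW ip) (leqW jp).
- by growth.
move=> x Dx; rewrite -cats1; have [y [Dy ey <-]] := sub x Dx.
have cf' := computes_ext [:: e] cP cf; have cg' := computes_ext [:: e] cP cg.
have h0 : runs_within (P ++ [:: e]) [:: encode x] (EVar 0) (encode x) (esize x) by apply: within_var.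
have h1 := computes_call cg' Dx h0; rewrite -ey in h1.
have h2 := computes_call cf' Dy h1.
apply: within_le h2 _; rewrite leq_add2l leq_mul2l /= /esize ey.
case: (k) => // k'; rewrite leq_exp2r // leq_add2r; exact: hsz.
Qed.

Lemma pt_comp {Y A} {EY : enc Y} {EA : enc A} D (D' : Y -> Prop) (f : Y -> A) (g : X -> Y) :
  pt D' f -> pt D g -> (forall x, D x -> D' (g x)) -> pt D (fun x => f (g x)).
Proof. by move=> pf pg sub; apply: pt_via pf pg _ => x /sub; exists (g x). Qed.

End Basic.

#[export] Instance enc_data : enc data := {| encode := id |}.

Section DataOps.
Context {X : Type} {EX : enc X} (D : X -> Prop).

Lemma pt_encode {A} {EA : enc A} (f : X -> A) : pt D f -> pt D (fun x => encode (f x)).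
Proof. exact: pt_enc. Qed.

Lemma pt_dcons (f g : X -> data) : pt D f -> pt D g -> pt D (fun x => DCons (f x) (g x)).
Proof.
move=> pf pg; have [P [i [j [k [cP cf cg]]]]] := pt_join pf pg.
pose e := ECons (ECall i (EVar 0)) (ECall j (EVar 0)).
apply: (@pt_new _ _ _ _ _ _ P e (fun n => (n + 2 * (n + 2) ^ k) + (n + 2 * (n + 2) ^ k)
   + ((n + 2) ^ k + (n + 2) ^ k).+1)) => //.
- by case: cf => ip _; case: cg => jp _ /=; rewrite (leqW ip) (leqW jp).
- by growth.
move=> x Dx; rewrite -cats1.
have cf' := computes_ext [:: e] cP cf; have cg' := computes_ext [:: e] cP cg.
have h0 : runs_within (P ++ [:: e]) [:: encode x] (EVar 0) (encode x) (esize x) by apply: within_var.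
have h1 := computes_call cg' Dx h0.
have h2 := computes_call cf' Dx h0.
apply: within_le (within_cons h2 h1) _; rewrite leq_add2l ltnS.
case: cf => _ /(_ _ Dx) /within_dsize hf; case: cg => _ /(_ _ Dx) /within_dsize hg.
exact: leq_add.
Qed.

Lemma pt_dhead (f : X -> data) : pt D f -> pt D (fun x => dhead (f x)).
Proof.
move=> pf; apply: (@pt_comp _ _ _ _ _ _ _ (fun _ => True)) pf _ => //.
apply: (@pt_new _ _ _ _ _ _ [::] (EHead (EVar 0)) (fun n => n + n)) => //; first by growth.
by move=> d _; apply: within_head; apply: within_var.
Qed.

Lemma pt_dtail (f : X -> data) : pt D f -> pt D (fun x => dtail (f x)).
Proof.
move=> pf; apply: (@pt_comp _ _ _ _ _ _ _ (fun _ => True)) pf _ => //.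
apply: (@pt_new _ _ _ _ _ _ [::] (ETail (EVar 0)) (fun n => n + n)) => //; first by growth.
by move=> d _; apply: within_tail; apply: within_var.
Qed.

Definition is_cons (d : data) := if d is DCons _ _ then true else false.

(** Each branch has to be polynomial only where the test selects it, so a test can establish the
    precondition of its branch. *)
Lemma pt_dif {A} {EA : enc A} (d : X -> data) (f g : X -> A) :
  pt D d -> pt (fun x => D x /\ is_cons (d x)) f -> pt (fun x => D x /\ ~~ is_cons (d x)) g ->
  pt D (fun x => if is_cons (d x) then f x else g x).
Proof.
move=> pd pf pg.
have pdg : exists P i j l k, [/\ closed_program P, computes P i k D d,
    computes P j k (fun x => D x /\ is_cons (d x)) f
    & computes P l k (fun x => D x /\ ~~ is_cons (d x)) g].
  have [P [i [j [k [cP cd cf]]]]] := pt_join pd pf.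
  have [Q [m [k' [cQ cg]]]] := pg.
  exists (P ++ map (shift_calls (size P)) Q), i, j, (size P + m), (maxn k k'); split.
  - rewrite /closed_program all_cat size_cat size_map; apply/andP; split.
      by apply: sub_all cP => e; apply: calls_below_le; rewrite leq_addr.
    rewrite all_map; apply: sub_all cQ => e /=; exact: calls_below_shift.
  - by apply: computes_exp (leq_maxl _ _) _; apply: computes_ext.
  - by apply: computes_exp (leq_maxl _ _) _; apply: computes_ext.
  - apply: computes_exp (leq_maxr _ _) _.
    by have := computes_link P [::] cQ cg; rewrite cats0.
have [P [i [j [l [k [cP cd cf cg]]]]]] := pdg.
pose e := EIf (ECall i (EVar 0)) (ECall j (EVar 0)) (ECall l (EVar 0)).
apply: (@pt_new _ _ _ _ _ _ P e (fun n => (n + 2 * (n + 2) ^ k) + (n + 2 * (n + 2) ^ k)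
   + (n + 2) ^ k)) => //.
- by case: cf => ip _; case: cg => jp _ ; case: cd => kp _ /=; rewrite (leqW ip) (leqW jp) (leqW kp).
- by growth.
move=> x Dx; rewrite -cats1.
have h0 : runs_within (P ++ [:: e]) [:: encode x] (EVar 0) (encode x) (esize x) by apply: within_var.
have cd' := computes_ext [:: e] cP cd.
have h1 := computes_call cd' Dx h0.
have := h1; case E : (encode (d x)) => [|a b]; rewrite /encode /enc_data in E.
  have Dg : D x /\ ~~ is_cons (d x) by rewrite E.
  have h2 := computes_call (computes_ext [:: e] cP cg) Dg h0.
  move=> h1'; have h3 := within_if_nil (ECall j (EVar 0)) h1' h2; rewrite E /=.
  apply: within_le h3 _; rewrite leq_add2l.
  by case: cg => _ /(_ _ Dg) /within_dsize.
have Df : D x /\ is_cons (d x) by rewrite E.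
have h2 := computes_call (computes_ext [:: e] cP cf) Df h0.
move=> h1'; have h3 := within_if_cons (ECall l (EVar 0)) h1' h2; rewrite E /=.
apply: within_le h3 _; rewrite leq_add2l.
by case: cf => _ /(_ _ Df) /within_dsize.
Qed.

End DataOps.

(** * Pairs, lists and loops *)

#[export] Instance enc_pair {A B} {EA : enc A} {EB : enc B} : enc (A * B) :=
  {| encode := fun p => DCons (encode p.1) (encode p.2) |}.
#[export] Instance enc_list {A} {EA : enc A} : enc (seq A) := {| encode := enc_seq encode |}.
#[export] Instance enc_boolean : enc bool := {| encode := enc_bool |}.

Section Pairs.
Context {X : Type} {EX : enc X} (D : X -> Prop).

Lemma pt_pair {A B} {EA : enc A} {EB : enc B} (f : X -> A) (g : X -> B) :
  pt D f -> pt D g -> pt D (fun x => (f x, g x)).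
Proof.
move=> pf pg; apply: (@pt_enc _ _ _ _ _ _ _ (fun x => DCons (encode (f x)) (encode (g x)))) => //.
by apply: pt_dcons; apply: pt_encode.
Qed.

Lemma pt_fst {A B} {EA : enc A} {EB : enc B} (f : X -> A * B) :
  pt D f -> pt D (fun x => (f x).1).
Proof.
move=> pf; apply: (@pt_enc _ _ _ _ _ _ _ (fun x => dhead (encode (f x)))) => //.
by apply: pt_dhead; apply: pt_encode.
Qed.

Lemma pt_snd {A B} {EA : enc A} {EB : enc B} (f : X -> A * B) :
  pt D f -> pt D (fun x => (f x).2).
Proof.
move=> pf; apply: (@pt_enc _ _ _ _ _ _ _ (fun x => dtail (encode (f x)))) => //.
by apply: pt_dtail; apply: pt_encode.
Qed.

Lemma pt_app1 {A C} {EA : enc A} {EC : enc C} (f : A -> C) (a : X -> A) :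
  pt (fun _ => True) f -> pt D a -> pt D (fun x => f (a x)).
Proof. by move=> pf pa; apply: pt_comp pf pa _. Qed.

Lemma pt_app2 {A B C} {EA : enc A} {EB : enc B} {EC : enc C} (f : A -> B -> C) (a : X -> A) (b : X -> B) :
  pt (fun _ => True) (fun p : A * B => f p.1 p.2) -> pt D a -> pt D b -> pt D (fun x => f (a x) (b x)).
Proof. by move=> pf pa pb; apply: (pt_comp pf (pt_pair pa pb)). Qed.

Lemma pt_app3 {A A' B C} {EA : enc A} {EA' : enc A'} {EB : enc B} {EC : enc C}
    (f : A -> A' -> B -> C) (a : X -> A) (a' : X -> A') (b : X -> B) :
  pt (fun _ => True) (fun p : A * A' * B => f p.1.1 p.1.2 p.2) -> pt D a -> pt D a' -> pt D b ->
  pt D (fun x => f (a x) (a' x) (b x)).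
Proof. by move=> pf pa pa' pb; apply: (pt_comp pf (pt_pair (pt_pair pa pa') pb)). Qed.

Lemma pt_app4 {A A' A'' B C} {EA : enc A} {EA' : enc A'} {EA'' : enc A''} {EB : enc B} {EC : enc C}
    (f : A -> A' -> A'' -> B -> C) (a : X -> A) (a' : X -> A') (a'' : X -> A'') (b : X -> B) :
  pt (fun _ => True) (fun p : A * A' * A'' * B => f p.1.1.1 p.1.1.2 p.1.2 p.2) ->
  pt D a -> pt D a' -> pt D a'' -> pt D b ->
  pt D (fun x => f (a x) (a' x) (a'' x) (b x)).
Proof. by move=> pf pa pa' pa'' pb; apply: (pt_comp pf (pt_pair (pt_pair (pt_pair pa pa') pa'') pb)). Qed.

Lemma pt_cons {A} {EA : enc A} (f : X -> A) (g : X -> seq A) :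
  pt D f -> pt D g -> pt D (fun x => f x :: g x).
Proof.
move=> pf pg; apply: (@pt_enc _ _ _ _ _ _ _ (fun x => DCons (encode (f x)) (encode (g x)))) => //.
by apply: pt_dcons; apply: pt_encode.
Qed.

Lemma pt_if {A} {EA : enc A} (b : X -> bool) (f g : X -> A) :
  pt D b -> pt (fun x => D x /\ b x) f -> pt (fun x => D x /\ ~~ b x) g ->
  pt D (fun x => if b x then f x else g x).
Proof.
move=> pb pf pg; apply: (@pt_eq _ _ _ _ _ (fun x => if is_cons (encode (b x)) then f x else g x)).
  by move=> x _; case: (b x).
apply: pt_dif; first exact: pt_encode.
- by apply: pt_sub pf => x []; case: (b x).
- by apply: pt_sub pg => x []; case: (b x).
Qed.

Lemma pt_ite {A} {EA : enc A} (b : X -> bool) (f g : X -> A) :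
  pt D b -> pt D f -> pt D g -> pt D (fun x => if b x then f x else g x).
Proof. by move=> pb pf pg; apply: pt_if => //; [apply: pt_sub pf|apply: pt_sub pg] => x []. Qed.

End Pairs.

Lemma esize_nil {A} {EA : enc A} : esize (@nil A) = 1. Proof. by []. Qed.
Lemma esize_cons {A} {EA : enc A} (a : A) s : esize (a :: s) = (esize a + esize s).+1.
Proof. by []. Qed.
Lemma esize_pair {A B} {EA : enc A} {EB : enc B} (a : A) (b : B) :
  esize (a, b) = (esize a + esize b).+1.
Proof. by []. Qed.
Lemma esize_gt0 {A} {EA : enc A} (a : A) : 0 < esize a.
Proof. exact: dsize_gt0. Qed.
Lemma size_le_esize {A} {EA : enc A} (s : seq A) : size s < esize s.
Proof. by elim: s => //= a s IH; rewrite esize_cons; have := esize_gt0 a; lia. Qed.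
Lemma esize_cat {A} {EA : enc A} (s t : seq A) : (esize (s ++ t)).+1 = esize s + esize t.
Proof. elim: s => [|a s IH] /=; rewrite ?esize_nil ?esize_cons; lia. Qed.

Section Loop.
Context {X B A : Type} {EX : enc X} {EB : enc B} {EA : enc A}.
Variables (D : X -> Prop) (f : X -> B -> A -> B) (b : X -> B) (s : X -> seq A).

(** The states actually visited: the accumulator is the fold of a prefix of the list. The loop body
    may rely on what holds for these. *)
Definition loop_reach (y : X * B * A) :=
  D y.1.1 /\ exists s1 s2, s y.1.1 = s1 ++ y.2 :: s2 /\ y.1.2 = foldl (f y.1.1) (b y.1.1) s1.

Let loop_dom (y : X * (B * seq A)) :=
  D y.1 /\ exists s1, s y.1 = s1 ++ y.2.2 /\ y.2.1 = foldl (f y.1) (b y.1) s1.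

(** Polynomial steps alone do not make a loop polynomial, as repeated doubling of the accumulator
    shows. The bound [c] on the accumulator, in terms of the initial input, is what excludes
    this. *)
Lemma pt_foldl c :
  pt D b -> pt D s -> pt loop_reach (fun y => f y.1.1 y.1.2 y.2) ->
  poly_growth c ->
  (forall x, D x -> forall s1 s2, s x = s1 ++ s2 -> esize (foldl (f x) (b x) s1) <= c (esize x)) ->
  pt D (fun x => foldl (f x) (b x) (s x)).
Proof.
move=> pb ps [P [i [k [cP cf]]]] [kc hc] bound.
have pF : pt loop_dom (fun y => foldl (f y.1) y.2.1 y.2.2); last first.
  refine (pt_comp pF (pt_pair (pt_id D) (pt_pair pb ps)) _) => x Dx /=.
  by split=> //; exists [::].
pose S := ETail (ETail (EVar 0)); pose ACC := EHead (ETail (EVar 0)).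
pose e := EIf S (ECall (size P) (ECons (EHead (EVar 0)) (ECons
  (ECall i (ECons (ECons (EHead (EVar 0)) ACC) (EHead S))) (ETail S)))) ACC.
(* [sg] bounds the triple handed to the loop body. [it] bounds one round: [100 * sg] covers the
   projections and the construction of the next argument, the power covers the call. *)
pose sg n := 3 * n + (n + 2) ^ kc + 10.
pose it n := 100 * sg n + 2 * (sg n) ^ k.
apply: (@pt_new _ _ _ _ _ _ P e (fun n => n * it n)) => //.
- by case: cf => ip _ /=; rewrite (leqW ip) leqnn.
- by rewrite /it /sg; growth.
move=> [x [acc l]] [/= Dx [s1 [es eacc]]].
rewrite -cats1; set P' := P ++ _.
have cf' := computes_ext [:: e] cP cf; rewrite -/P' in cf'.
have eF : body P' (size P) = e by rewrite /body nth_cat ltnn subnn.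
pose (n := esize (x, (acc, l))).
have nx : esize x < n by rewrite /n !esize_pair; lia.
have nl : esize l < n by rewrite /n !esize_pair; lia.
(* The price of a round is fixed by the size [n] of the initial argument and not by the current one,
   whose accumulator may have grown. *)
have H : forall l s1 acc, s x = s1 ++ l -> acc = foldl (f x) (b x) s1 -> esize l < n ->
    runs_within P' [:: encode (x, (acc, l))] e (encode (foldl (f x) acc l)) ((size l).+1 * it n); last first.
  apply: within_le (H l s1 acc es eacc nl) _; rewrite leq_mul2r; apply/orP; right.
  exact: leq_trans (size_le_esize l) (ltnW nl).
clear es eacc nl; clearbody n; move: nx => {s1 acc l}nx l; move: nx.
have bd : forall s1 s2, s x = s1 ++ s2 -> esize x < n -> esize (foldl (f x) (b x) s1) <= (n + 2) ^ kc.
  move=> s1 s2 es nx; apply: leq_trans (bound x Dx _ _ es) _.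
  by apply: leq_trans (hc _) _; case: (kc) => // kc'; rewrite leq_exp2r //; lia.
elim: l => [|a l IH] nx s1 acc es eacc nl.
  have hacc := bd _ _ es nx; rewrite -eacc in hacc.
  have hV : runs_within P' [:: encode (x, (acc, @nil A))] (EVar 0) (encode (x, (acc, @nil A))) (esize (x, (acc, @nil A))).
    exact: within_var.
  have hT := within_tail hV; have hS := within_tail hT; have hA := within_head hT.
  apply: within_le (within_if_nil _ hS hA) _.
  rewrite -[dsize (encode _)]/(esize (x, (acc, @nil A))) -[dsize (dtail _)]/(esize (acc, @nil A)).
  rewrite -[dsize (dhead _)]/(esize acc).
  rewrite !esize_pair esize_nil /= mul1n /it /sg; move: nx hacc; set q := (_ ^ kc); set r := (_ ^ k); clear; lia.
have hacc := bd _ _ es nx; rewrite -eacc in hacc.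
have es' : s x = rcons s1 a ++ l by rewrite cat_rcons.
have eacc' : f x acc a = foldl (f x) (b x) (rcons s1 a) by rewrite foldl_rcons eacc.
have hacc' := bd _ _ es' nx; rewrite -eacc' in hacc'.
have hres := bd (s1 ++ a :: l) [::]; rewrite cats0 foldl_cat -eacc in hres.
have {}hres := hres es nx.
have hl' : esize l < n by move: nl; rewrite esize_cons; lia.
have ha : esize a < n by move: nl; rewrite esize_cons; lia.
have IHl := IH nx (rcons s1 a) _ es' eacc' hl'.
set u := encode (x, (acc, a :: l)).
have hV : runs_within P' [:: u] (EVar 0) u (esize (x, (acc, a :: l))) by exact: within_var.
have hX := within_head hV.
have hT := within_tail hV; have hS := within_tail hT; have hA := within_head hT.
have hHS := within_head hS; have hTS := within_tail hS.
have rc : loop_reach (x, acc, a) by split=> //; exists s1, l.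
have hC := computes_call (x := (x, acc, a)) cf' rc (within_cons (within_cons hX hA) hHS).
rewrite -[f _ _ _]/(f x acc a) in hC.
have hB : runs_within P' [:: DCons (dhead u) (DCons (encode (f x acc a)) (dtail (dtail (dtail u))))]
    (body P' (size P)) (encode (foldl (f x) (f x acc a) l)) ((size l).+1 * it n).
  by rewrite eF; apply: IHl.
have hR := within_call (within_cons hX (within_cons hC hTS)) hB.
have hI := within_if_cons ACC hS hR; apply: within_le hI _.
have -> : dsize u = esize (x, (acc, a :: l)) by [].
have -> : dsize (dtail u) = esize (acc, a :: l) by [].
have -> : dsize (dtail (dtail u)) = esize (a :: l) by [].
have -> : dsize (dhead u) = esize x by [].
have -> : dsize (dhead (dtail u)) = esize acc by [].
have -> : dsize (dhead (dtail (dtail u))) = esize a by [].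
have -> : dsize (dtail (dtail (dtail u))) = esize l by [].
have -> : dsize (encode (f x acc a)) = esize (f x acc a) by [].
have -> /= : dsize (encode (foldl (f x) (f x acc a) l)) = esize (foldl (f x) acc (a :: l)) by [].
have hk : 2 * (esize (x, acc, a) + 2) ^ k <= 2 * (sg n) ^ k.
  rewrite leq_mul2l /=; case: (k) => // k'; rewrite leq_exp2r // /sg !esize_pair.
  lia.
rewrite [leqRHS]mulSn; set W := (_ * it n)%N; move: hk; rewrite /it.
set q := (sg n) ^ k; set q' := (_ + 2) ^ k => hk.
rewrite -[dsize (encode x)]/(esize x) -[dsize (encode acc)]/(esize acc).
rewrite -[dsize (encode (f x acc a))]/(esize (f x acc a)).
have -> : dsize (enc_seq encode l) = esize l by [].
rewrite !esize_pair !esize_cons; move: hacc hacc' hres nl; rewrite esize_cons /sg /=.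
move: nx ha hl' hk; clear; lia.
Qed.

End Loop.

(** * Options, lists and unary numbers *)

#[export] Instance enc_opt {A} {EA : enc A} : enc (option A) :=
  {| encode := fun o => if o is Some a then DCons DNil (encode a) else DNil |}.
#[export] Instance enc_unit : enc unit := {| encode := fun _ => DNil |}.
(* Unary, so that loops over a natural number stay polynomial; see [bin] for binary. *)
#[export] Instance enc_unary : enc nat := {| encode := fun n => enc_seq encode (nseq n tt) |}.

Lemma esize_nat (n : nat) : esize n = n.*2.+1.
Proof. by elim: n => // n; rewrite /esize /=; lia. Qed.

(** A nonempty list and the pair of its head and tail have the same encoding, so the branch runs on
    the list as it stands. *)
Lemma pt_match {X} {EX : enc X} (D : X -> Prop) {A B} {EA : enc A} {EB : enc B} (s : X -> seq A) (f : X -> A -> seq A -> B) (g : X -> B) :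
  pt D s -> pt (fun y : X * (A * seq A) => D y.1 /\ s y.1 = y.2.1 :: y.2.2) (fun y => f y.1 y.2.1 y.2.2) -> pt D g ->
  pt D (fun x => match s x with a :: l => f x a l | [::] => g x end).
Proof.
move=> ps pf pg.
apply: (@pt_eq _ _ _ _ _ (fun x => if is_cons (encode (s x)) then
   (match s x with a :: l => f x a l | [::] => g x end) else g x)).
  by move=> x _; case: (s x).
apply: pt_dif; first exact: pt_encode.
  apply: pt_via pf (pt_pair (pt_id _) (@pt_sub _ _ _ _ _ D s _ ps)) _; first by move=> x [].
  move=> x []; case E : (s x) => [|a l] //= Dx _.
  by exists (x, (a, l)).
by apply: pt_sub pg => x [].
Qed.

Lemma pt_omatch {X} {EX : enc X} (D : X -> Prop) {A B} {EA : enc A} {EB : enc B} (s : X -> option A) (f : X -> A -> B) (g : X -> B) :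
  pt D s -> pt (fun y : X * A => D y.1 /\ s y.1 = Some y.2) (fun y => f y.1 y.2) -> pt D g ->
  pt D (fun x => match s x with Some a => f x a | None => g x end).
Proof.
move=> ps pf pg.
apply: (@pt_eq _ _ _ _ _ (fun x => if is_cons (encode (s x)) then
   (match s x with Some a => f x a | None => g x end) else g x)).
  by move=> x _; case: (s x).
apply: pt_dif; first exact: pt_encode.
  have ps' : pt (fun x => D x /\ is_cons (encode (s x))) (fun x => dtail (encode (s x))).
    by apply: pt_dtail; apply: pt_encode; apply: pt_sub ps => x [].
  apply: pt_via pf (pt_pair (pt_id _) ps') _.
  move=> x []; case E : (s x) => [a|] //= Dx _.
  by exists (x, a).
by apply: pt_sub pg => x [].
Qed.

Lemma pt_some {X} {EX : enc X} (D : X -> Prop) {A} {EA : enc A} (f : X -> A) : pt D f -> pt D (fun x => Some (f x)).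
Proof.
move=> pf; apply: (@pt_enc _ _ _ _ _ _ _ (fun x => DCons DNil (encode (f x)))) => //.
by apply: pt_dcons; [apply: pt_const|apply: pt_encode].
Qed.

Lemma pt_negb {X} {EX : enc X} (D : X -> Prop) (b : X -> bool) : pt D b -> pt D (fun x => ~~ b x).
Proof.
move=> pb; apply: (@pt_eq _ _ _ _ _ (fun x => if b x then false else true)).
  by move=> x _; case: (b x).
by apply: pt_ite pb _ _; apply: pt_const.
Qed.

Lemma pt_andb {X} {EX : enc X} (D : X -> Prop) (b c : X -> bool) : pt D b -> pt D c -> pt D (fun x => b x && c x).
Proof. by move=> pb pc; apply: (pt_ite pb pc (pt_const _ false)). Qed.

Lemma pt_orb {X} {EX : enc X} (D : X -> Prop) (b c : X -> bool) : pt D b -> pt D c -> pt D (fun x => b x || c x).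
Proof. by move=> pb pc; apply: (pt_ite pb (pt_const _ true) pc). Qed.

Lemma pt_foldl_free {X} {EX : enc X} (D : X -> Prop) {A B} {EA : enc A} {EB : enc B} (f : X -> B -> A -> B) (b : X -> B) (s : X -> seq A) c :
  pt D b -> pt D s -> pt (fun y : X * B * A => D y.1.1) (fun y => f y.1.1 y.1.2 y.2) ->
  poly_growth c ->
  (forall x, D x -> forall s1 s2, s x = s1 ++ s2 -> esize (foldl (f x) (b x) s1) <= c (esize x)) ->
  pt D (fun x => foldl (f x) (b x) (s x)).
Proof. by move=> pb ps pf; apply: pt_foldl => //; apply: pt_sub pf => y []. Qed.

Lemma pt_catrev {X} {EX : enc X} (D : X -> Prop) {A} {EA : enc A} (s t : X -> seq A) :
  pt D s -> pt D t -> pt D (fun x => catrev (s x) (t x)).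
Proof.
move=> ps pt'; apply: (pt_app2 (f := catrev)) ps pt'.
apply: (@pt_eq _ _ _ _ _ (fun p => foldl (fun acc a => a :: acc) p.2 p.1)).
  by case=> l l' _ /=; elim: l l' => //= a l IH l'; rewrite IH.
apply: (@pt_foldl_free _ _ _ _ _ _ _ (fun p acc a => a :: acc) snd fst id).
- exact/pt_snd/pt_id.
- exact/pt_fst/pt_id.
- by apply: pt_cons; [apply/pt_snd/pt_id|apply/pt_snd/pt_fst/pt_id].
- exact: growth_id.
move=> [l l'] _ s1 s2 /= ->; rewrite esize_pair; elim: s1 l' => [|a l1 IH] l' /=.
  by lia.
by have := IH (a :: l'); rewrite !esize_cons; lia.
Qed.

Lemma esize_catrev {A} {EA : enc A} (s t : seq A) : (esize (catrev s t)).+1 = esize s + esize t.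
Proof.
by elim: s t => [|a s IH] t; rewrite ?esize_nil //= IH !esize_cons; lia.
Qed.

Lemma esize_rev {A} {EA : enc A} (s : seq A) : esize (rev s) = esize s.
Proof. generalize (esize_catrev s [::]); rewrite esize_nil -[catrev s [::]]/(rev s); lia. Qed.

Lemma pt_rev {X} {EX : enc X} (D : X -> Prop) {A} {EA : enc A} (s : X -> seq A) : pt D s -> pt D (fun x => rev (s x)).
Proof. by move=> ps; apply: pt_catrev ps (pt_const _ _). Qed.

Lemma pt_cat {X} {EX : enc X} (D : X -> Prop) {A} {EA : enc A} (s t : X -> seq A) :
  pt D s -> pt D t -> pt D (fun x => s x ++ t x).
Proof.
move=> ps pt'; apply: (@pt_eq _ _ _ _ _ (fun x => catrev (rev (s x)) (t x))).
  by move=> x _; rewrite catrevE revK.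
by apply: pt_catrev => //; apply: pt_rev.
Qed.

Lemma foldl_cons {A B} (f : A -> B) s acc :
  foldl (fun acc a => f a :: acc) acc s = catrev (map f s) acc.
Proof. by elim: s acc => //= a s IH acc; rewrite IH. Qed.

(** No size hypothesis is needed here, unlike for a general fold: the output is a list of
    [size (s x)] pieces, each bounded by the running time of [f] on a pair from the input. *)
Lemma pt_map {X} {EX : enc X} (D : X -> Prop) {A B} {EA : enc A} {EB : enc B} (s : X -> seq A) (f : X -> A -> B) :
  pt D s -> pt (fun y : X * A => D y.1 /\ exists s1 s2, s y.1 = s1 ++ y.2 :: s2) (fun y => f y.1 y.2) ->
  pt D (fun x => [seq f x a | a <- s x]).
Proof.
move=> ps pf; apply: (@pt_eq _ _ _ _ _ (fun x => rev (foldl (fun acc a => f x a :: acc) [::] (s x)))).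
  by move=> x _; rewrite foldl_cons -[catrev _ _]/(rev _) revK.
apply: pt_rev; have [k hk] := pt_size pf; have [l hl] := pt_size ps.
apply: (@pt_foldl _ _ _ _ _ _ _ (fun x acc a => f x a :: acc) (fun _ => [::]) s
  (fun n => (n + 2) ^ l * (((n + (n + 2) ^ l).+1 + 2) ^ k).+1 + 1)).
- exact: pt_const.
- exact: ps.
- apply: pt_cons; last exact/pt_snd/pt_fst/pt_id.
  apply: (@pt_comp _ _ _ _ _ _ _ _ (fun y : X * A => f y.1 y.2) (fun y => (y.1.1, y.2))); first exact: pf.
    by apply: pt_pair; [apply/pt_fst/pt_fst/pt_id|apply/pt_snd/pt_id].
  by move=> [[x acc] a] [] /= Dx [s1 [s2 [e _]]]; split=> //; exists s1, s2.
- by growth.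
move=> x Dx s1 s2 es; rewrite foldl_cons.
generalize (esize_catrev (map (f x) s1) [::]); rewrite esize_nil => h.
have h2 : esize (map (f x) s1) <= size s1 * (((esize x + (esize x + 2) ^ l).+1 + 2) ^ k).+1 + 1.
  have H : forall a, (exists l1 l2, s x = l1 ++ a :: l2) -> esize (f x a) <= ((esize x + (esize x + 2) ^ l).+1 + 2) ^ k.
    move=> a [l1 [l2 e]]; have Da : D x /\ exists s1 s2, s x = s1 ++ a :: s2 by split=> //; exists l1, l2.
    have h1 : esize (f x a) <= (esize (x, a) + 2) ^ k := hk (x, a) Da.
    apply: leq_trans h1 _.
    case: (k) => // k'; rewrite leq_exp2r // esize_pair leq_add2r ltnS leq_add2l.
    have := hl x Dx; rewrite e => h'; apply: leq_trans _ h'.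
    by generalize (esize_cat l1 (a :: l2)); rewrite esize_cons; generalize (esize_gt0 l1); generalize (esize_gt0 l2); lia.
  have H' : forall a, List.In a s1 -> exists l1 l2, s x = l1 ++ a :: l2.
    move=> a ain; have [l1 [l2 e]] := List.in_split a s1 ain; exists l1, (l2 ++ s2).
    by rewrite es e -catA.
  elim: (s1) H' => [|a l1 IH] H'; first by rewrite esize_nil.
  rewrite [map _ _]/= [size _]/= esize_cons mulSn; have := H a (H' a (or_introl erefl)).
  by have := IH (fun b hb => H' b (or_intror hb)); lia.
have h3 : size s1 <= (esize x + 2) ^ l.
  apply: leq_trans (hl x Dx); apply: leq_trans (ltnW (size_le_esize _)).
  by rewrite es size_cat leq_addr.
apply: leq_trans (_ : esize (map (f x) s1) <= _); first by lia.
by apply: leq_trans h2 _; rewrite leq_add2r leq_mul2r h3 orbT.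
Qed.

Lemma pt_map_free {X} {EX : enc X} (D : X -> Prop) {A B} {EA : enc A} {EB : enc B} (s : X -> seq A) (f : X -> A -> B) :
  pt D s -> pt (fun y : X * A => D y.1) (fun y => f y.1 y.2) -> pt D (fun x => [seq f x a | a <- s x]).
Proof. by move=> ps pf; apply: pt_map => //; apply: pt_sub pf => y []. Qed.

Lemma pt_filter {X} {EX : enc X} (D : X -> Prop) {A} {EA : enc A} (s : X -> seq A) (p : X -> A -> bool) :
  pt D s -> pt (fun y : X * A => D y.1) (fun y => p y.1 y.2) -> pt D (fun x => [seq a <- s x | p x a]).
Proof.
move=> ps pf; have fE x l acc : foldl (fun acc a => if p x a then a :: acc else acc) acc l = catrev (filter (p x) l) acc.
  by elim: l acc => //= a l IH acc; rewrite IH; case: (p x a).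
apply: (@pt_eq _ _ _ _ _ (fun x => rev (foldl (fun acc a => if p x a then a :: acc else acc) [::] (s x)))).
  by move=> x _; rewrite fE -[catrev _ _]/(rev _) revK.
apply: pt_rev; have [l hl] := pt_size ps.
apply: (@pt_foldl_free _ _ _ _ _ _ _ (fun x acc a => if p x a then a :: acc else acc) (fun _ => [::]) s
  (fun n => (n + 2) ^ l)) => //.
- exact: pt_const.
- apply: pt_ite.
  + apply: (@pt_comp _ _ _ _ _ _ _ _ (fun y : X * A => p y.1 y.2) (fun y => (y.1.1, y.2)) pf) => //.
    by apply: pt_pair; [apply/pt_fst/pt_fst/pt_id|apply/pt_snd/pt_id].
  + by apply: pt_cons; [apply/pt_snd/pt_id|apply/pt_snd/pt_fst/pt_id].
  + exact/pt_snd/pt_fst/pt_id.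
- by growth.
move=> x Dx s1 s2 es; apply: leq_trans (hl x Dx); rewrite fE.
generalize (esize_catrev (filter (p x) s1) [::]); rewrite esize_nil es.
generalize (esize_cat s1 s2); generalize (esize_gt0 s2).
have : esize (filter (p x) s1) <= esize s1.
  by elim: (s1) => //= a l1 IH; case: (p x a); rewrite !esize_cons; lia.
lia.
Qed.

Lemma pt_flatten {X} {EX : enc X} (D : X -> Prop) {A} {EA : enc A} (s : X -> seq (seq A)) :
  pt D s -> pt D (fun x => flatten (s x)).
Proof.
move=> ps; have fE (l : seq (seq A)) acc : foldl (fun acc a => catrev a acc) acc l = catrev (flatten l) acc.
  by elim: l acc => //= a l IH acc; rewrite IH !catrevE rev_cat catA.
apply: (@pt_eq _ _ _ _ _ (fun x => rev (foldl (fun acc a => catrev a acc) [::] (s x)))).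
  by move=> x _; rewrite fE -[catrev _ _]/(rev _) revK.
apply: pt_rev; have [l hl] := pt_size ps.
apply: (@pt_foldl_free _ _ _ _ _ _ _ (fun x acc a => catrev a acc) (fun _ => [::]) s
  (fun n => (n + 2) ^ l)) => //.
- exact: pt_const.
- by apply: pt_catrev; [apply/pt_snd/pt_id|apply/pt_snd/pt_fst/pt_id].
- by growth.
move=> x Dx s1 s2 es; apply: leq_trans (hl x Dx); rewrite fE.
generalize (esize_catrev (flatten s1) [::]); rewrite esize_nil es.
generalize (esize_cat s1 s2); generalize (esize_gt0 s2).
have : esize (flatten s1) <= esize s1.
  elim: (s1) => //= a l1 IH; rewrite esize_cons; generalize (esize_cat a (flatten l1)); lia.
lia.
Qed.

Lemma pt_has {X} {EX : enc X} (D : X -> Prop) {A} {EA : enc A} (s : X -> seq A) (p : X -> A -> bool) :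
  pt D s -> pt (fun y : X * A => D y.1) (fun y => p y.1 y.2) -> pt D (fun x => has (p x) (s x)).
Proof.
move=> ps pf; apply: (@pt_eq _ _ _ _ _ (fun x => match [seq a <- s x | p x a] with _ :: _ => true | [::] => false end)).
  by move=> x _ /=; elim: (s x) => //= a l ->; case: (p x a).
by apply: (@pt_match _ _ _ _ _ _ _ (fun x => [seq a <- s x | p x a]) (fun _ _ _ => true));
  [apply: pt_filter|apply: pt_const|apply: pt_const].
Qed.

Lemma pt_all {X} {EX : enc X} (D : X -> Prop) {A} {EA : enc A} (s : X -> seq A) (p : X -> A -> bool) :
  pt D s -> pt (fun y : X * A => D y.1) (fun y => p y.1 y.2) -> pt D (fun x => all (p x) (s x)).
Proof.
move=> ps pf; apply: (@pt_eq _ _ _ _ _ (fun x => ~~ has (fun a => ~~ p x a) (s x))).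
  by move=> x _ /=; rewrite (has_predC (p x)) negbK.
by apply/pt_negb/pt_has => //; apply: pt_negb.
Qed.

Lemma pt_nseq {X} {EX : enc X} (D : X -> Prop) (n : X -> nat) : pt D n -> pt D (fun x => nseq (n x) tt).
Proof. exact: pt_enc. Qed.

Lemma pt_size_seq {X} {EX : enc X} (D : X -> Prop) {A} {EA : enc A} (s : X -> seq A) : pt D s -> pt D (fun x => size (s x)).
Proof.
move=> ps; apply: (@pt_enc _ _ _ _ _ _ _ (fun x => [seq tt | _ <- s x])).
  by move=> x _ /=; elim: (s x) => //= a l ->.
by apply: pt_map_free => //; apply: pt_const.
Qed.

Lemma pt_iter {X} {EX : enc X} (D : X -> Prop) {B} {EB : enc B} (n : X -> nat) (f : X -> B -> B) (b : X -> B) c :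
  pt D n -> pt D b ->
  pt (fun y : X * B => D y.1 /\ exists2 i, i < n y.1 & y.2 = iter i (f y.1) (b y.1)) (fun y => f y.1 y.2) ->
  poly_growth c ->
  (forall x, D x -> forall i, i <= n x -> esize (iter i (f x) (b x)) <= c (esize x)) ->
  pt D (fun x => iter (n x) (f x) (b x)).
Proof.
move=> pn pb pf gc bound.
have E x (l : seq unit) : foldl (fun acc _ => f x acc) (b x) l = iter (size l) (f x) (b x).
  by elim/last_ind: l => //= l a IH; rewrite foldl_rcons size_rcons /= IH.
apply: (@pt_eq _ _ _ _ _ (fun x => foldl (fun acc _ => f x acc) (b x) (nseq (n x) tt))).
  by move=> x _; rewrite E size_nseq.
apply: (@pt_foldl _ _ _ _ _ enc_unit _ (fun x acc _ => f x acc) _ _ c) => //.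
  apply: (@pt_comp _ _ _ _ _ _ _ _ (fun y : X * B => f y.1 y.2) (fun y => (y.1.1, y.1.2)) pf).
    by apply: pt_pair; [apply/pt_fst/pt_fst/pt_id|apply/pt_snd/pt_fst/pt_id].
  move=> [[x acc] a] [] /= Dx [s1 [s2 [es ->]]]; split=> //; exists (size s1); last by rewrite E.
  by have := congr1 size es; rewrite size_nseq size_cat /=; lia.
move=> x Dx s1 s2 es; rewrite E; apply: bound => //.
by have := congr1 size es; rewrite size_nseq size_cat /=; lia.
Qed.

Lemma pt_succ {X} {EX : enc X} (D : X -> Prop) (n : X -> nat) : pt D n -> pt D (fun x => (n x).+1).
Proof.
move=> pn; apply: (@pt_enc _ _ _ _ _ _ _ (fun x => tt :: nseq (n x) tt)) => //.
by apply: pt_cons; [apply: pt_const|apply: pt_nseq].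
Qed.

Lemma pt_of_seq {X} {EX : enc X} (D : X -> Prop) (n : X -> nat) (s : X -> seq unit) : (forall x, D x -> n x = size (s x)) -> pt D s -> pt D n.
Proof. by move=> e ps; apply: pt_eq e _; apply: pt_size_seq. Qed.

Lemma pt_addn {X} {EX : enc X} (D : X -> Prop) (m n : X -> nat) : pt D m -> pt D n -> pt D (fun x => m x + n x).
Proof.
move=> pm pn; apply: (@pt_of_seq _ _ _ _ (fun x => nseq (m x) tt ++ nseq (n x) tt)).
  by move=> x _; rewrite size_cat !size_nseq.
by apply: pt_cat; apply: pt_nseq.
Qed.

Lemma pt_sumn {X} {EX : enc X} (D : X -> Prop) (s : X -> seq nat) : pt D s -> pt D (fun x => sumn (s x)).
Proof.
move=> ps; apply: (@pt_of_seq _ _ _ _ (fun x => flatten [seq nseq n tt | n <- s x])).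
  by move=> x _; rewrite size_flatten /shape -map_comp; elim: (s x) => //= a l ->; rewrite size_nseq.
by apply/pt_flatten/pt_map_free => //; apply/pt_nseq/pt_snd/pt_id.
Qed.

Lemma pt_muln {X} {EX : enc X} (D : X -> Prop) (m n : X -> nat) : pt D m -> pt D n -> pt D (fun x => m x * n x).
Proof.
move=> pm pn; apply: (@pt_eq _ _ _ _ _ (fun x => sumn [seq n x | _ <- nseq (m x) tt])).
  by move=> x _; rewrite map_nseq sumn_nseq mulnC.
apply/pt_sumn/pt_map_free; first exact: pt_nseq.
by apply: (@pt_comp _ _ _ _ _ _ _ _ n fst pn) => //; apply/pt_fst/pt_id.
Qed.

Lemma pt_behead {X} {EX : enc X} (D : X -> Prop) {A} {EA : enc A} (s : X -> seq A) : pt D s -> pt D (fun x => behead (s x)).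
Proof.
move=> ps; apply: (@pt_enc _ _ _ _ _ _ _ (fun x => dtail (encode (s x)))).
  by move=> x _; case: (s x).
exact/pt_dtail/pt_encode.
Qed.

Lemma pt_head {X} {EX : enc X} (D : X -> Prop) {A} {EA : enc A} a0 (s : X -> seq A) : pt D s -> pt D (fun x => head a0 (s x)).
Proof.
move=> ps; apply: (@pt_match _ _ _ _ _ _ _ s (fun _ a _ => a) (fun _ => a0)) => //.
  exact/pt_fst/pt_snd/pt_id.
exact: pt_const.
Qed.

Lemma pt_nth {X} {EX : enc X} (D : X -> Prop) {A} {EA : enc A} a0 (s : X -> seq A) (i : X -> nat) :
  pt D s -> pt D i -> pt D (fun x => nth a0 (s x) (i x)).
Proof.
move=> ps pi; have E (l : seq A) n : iter n behead l = drop n l.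
  by elim: n => [|n IH]; rewrite ?drop0 //= IH -drop1 drop_drop add1n.
apply: (@pt_eq _ _ _ _ _ (fun x => head a0 (iter (i x) behead (s x)))).
  by move=> x _; rewrite E -nth0 nth_drop addn0.
have [l hl] := pt_size ps.
apply/pt_head/(@pt_iter _ _ _ _ _ i (fun x => behead) s (fun n => (n + 2) ^ l)) => //.
- exact/pt_behead/pt_snd/pt_id.
- by growth.
move=> x Dx n _; apply: leq_trans (hl x Dx); rewrite E.
rewrite -{2}(cat_take_drop n (s x)).
by generalize (esize_cat (take n (s x)) (drop n (s x))); generalize (esize_gt0 (take n (s x))); lia.
Qed.

Lemma esize_iota m n : esize (iota m n) <= n * (m + n).*2.+2 + 1.
Proof.
elim: n m => [|n IH] m; first by rewrite esize_nil.
by rewrite [iota _ _]/= esize_cons esize_nat; have := IH m.+1; rewrite mulSn addSnnS; lia.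
Qed.

Lemma pt_iota0 {X} {EX : enc X} (D : X -> Prop) (n : X -> nat) : pt D n -> pt D (fun x => iota 0 (n x)).
Proof.
move=> pn; apply: (pt_app1 (f := iota 0)) pn.
have E n' : iter n' (fun l => 0 :: map S l) [::] = iota 0 n'.
  by elim: n' => //= n' ->; rewrite (iotaDl 1 0).
apply: (@pt_eq _ _ _ _ _ (fun n' => iter n' (fun l => 0 :: map S l) [::])) => [m _|]; first by rewrite E.
apply: (@pt_iter _ _ _ _ _ id (fun _ l => 0 :: map S l) (fun _ => [::]) (fun m => m * m.*2.+2 + 1)).
- exact: pt_id.
- exact: pt_const.
- apply: pt_cons; first exact: pt_const.
  by apply: pt_map_free; [apply/pt_snd/pt_id|apply/pt_succ/pt_snd/pt_id].
- by apply: growth_add; [apply: growth_mul; [|do 2 apply: growth_succ; apply: (@growth_le _ (fun n => n + n))]|];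
   growth => // k; rewrite addnn.
move=> m _ i im; rewrite E; apply: leq_trans (esize_iota _ _) _.
by rewrite esize_nat; nia.
Qed.

(** * Binary arithmetic *)

Fixpoint data_eqb (u v : data) : bool :=
  match u, v with
  | DNil, DNil => true
  | DCons a b, DCons c d => data_eqb a c && data_eqb b d
  | _, _ => false
  end.

Lemma data_eqbP u v : reflect (u = v) (data_eqb u v).
Proof.
apply: (iffP idP) => [|->]; last by elim: v => //= a -> b ->.
by elim: u v => [|a IHa b IHb] [|c d] //= /andP[/IHa -> /IHb ->].
Qed.

(** Recursion into both branches of a tree is not a loop over a list, so this program is written by
    hand. It decides equality for every type with an injective encoding. *)
Lemma pt_data_eqb : pt (fun _ => True) (fun p : data * data => data_eqb p.1 p.2).
Proof.
pose U := EHead (EVar 0); pose V := ETail (EVar 0).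
pose e := EIf U (EIf V (EIf (ECall 0 (ECons (EHead U) (EHead V)))
   (ECall 0 (ECons (ETail U) (ETail V))) ENil) ENil) (EIf V ENil (ECons ENil ENil)).
apply: (@pt_new _ _ _ _ _ _ [::] e (fun n => n * (100 * n + 100))) => //; first by growth.
move=> [u v] _ /=; set P := [:: e].
set n := esize (u, v).
(* The price per node of the first tree depends only on the total size [n], so the costs of the two
   recursive calls add up. *)
have H u' v' : dsize u' + dsize v' < n ->
    runs_within P [:: DCons u' v'] e (enc_bool (data_eqb u' v')) (dsize u' * (100 * n + 100)).
  elim: u' v' => [|a IHa b IHb] [|c d] hn.
  - have hV : runs_within P [:: DCons DNil DNil] (EVar 0) (DCons DNil DNil) 3 by apply: within_var.
    have h := within_if_nil (EIf V (EIf (ECall 0 (ECons (EHead U) (EHead V)))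
       (ECall 0 (ECons (ETail U) (ETail V))) ENil) ENil) (within_head hV)
      (within_if_nil ENil (within_tail hV) (within_cons (within_nil P _) (within_nil P _))).
    by apply: within_le h _ => /=; lia.
  - set w := DCons DNil (DCons c d).
    have hV : runs_within P [:: w] (EVar 0) w (dsize w) by apply: within_var.
    have h := within_if_nil (EIf V (EIf (ECall 0 (ECons (EHead U) (EHead V)))
       (ECall 0 (ECons (ETail U) (ETail V))) ENil) ENil) (within_head hV)
      (within_if_cons (ECons ENil ENil) (within_tail hV) (within_nil P _)).
    by apply: within_le h _; move: hn; rewrite /w /=; lia.
  - set w := DCons (DCons a b) DNil.
    have hV : runs_within P [:: w] (EVar 0) w (dsize w) by apply: within_var.
    have h := within_if_cons (EIf V ENil (ECons ENil ENil)) (within_head hV)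
      (within_if_nil (EIf (ECall 0 (ECons (EHead U) (EHead V)))
       (ECall 0 (ECons (ETail U) (ETail V))) ENil) (within_tail hV) (within_nil P _)).
    by apply: within_le h _; move: hn; rewrite /w /=; nia.
  set w := DCons (DCons a b) (DCons c d).
  have hV : runs_within P [:: w] (EVar 0) w (dsize w) by apply: within_var.
  have hU := within_head hV; have hW := within_tail hV.
  have na : dsize a + dsize c < n by move: hn => /=; lia.
  have nb : dsize b + dsize d < n by move: hn => /=; lia.
  have h1 := within_call (f := 0) (within_cons (within_head hU) (within_head hW)) (IHa c na).
  have h2 := within_call (f := 0) (within_cons (within_tail hU) (within_tail hW)) (IHb d nb).
  have szb b' : dsize (enc_bool b') <= 3 by case: b'.
  (* The reserve [20 * n + 20] is spent on the two enclosing conditionals. *)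
  have [b1 h3 lb] : exists2 b1, runs_within P [:: w] (EIf (ECall 0 (ECons (EHead U) (EHead V)))
      (ECall 0 (ECons (ETail U) (ETail V))) ENil) (enc_bool (data_eqb (DCons a b) (DCons c d))) b1
      & b1 <= dsize (DCons a b) * (100 * n + 100) - (20 * n + 20).
    rewrite /=; case E : (data_eqb a c) h1 => h1.
      eexists; first exact: (within_if_cons (a := DNil) (c := DNil) ENil h1 h2).
      have := szb (data_eqb b d); move: hn; rewrite /w /=; move: (dsize (enc_bool _)) => z.
      rewrite !mulSn !mulnDl !mulnDr.
      move: (dsize a * (100 * n)) (dsize b * (100 * n)) => z1 z2; lia.
    eexists; first exact: (within_if_nil (ECall 0 (ECons (ETail U) (ETail V))) h1 (within_nil P _)).
    move: hn; rewrite /w /= !mulSn !mulnDl !mulnDr.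
    move: (dsize a * (100 * n)) (dsize b * (100 * n)) => z1 z2; lia.
  have h4 := within_if_cons (EIf V ENil (ECons ENil ENil)) hU (within_if_cons ENil hW h3).
  apply: within_le h4 _.
  have := szb (data_eqb (DCons a b) (DCons c d)); move: lb hn (dsize (enc_bool _)) => lb hn z hz.
  have : 100 * n + 100 <= dsize (DCons a b) * (100 * n + 100) by rewrite leq_pmull.
  by move: lb hn; rewrite /w /=; lia.
apply: within_le (H u v _) _; first by rewrite /n esize_pair.
rewrite leq_mul2r; apply/orP; right; rewrite /n esize_pair /esize /=; lia.
Qed.

Class enc_inj T {E : enc T} := encode_inj : injective (@encode T E).
Arguments enc_inj T {E}.

#[export] Instance enc_inj_bool : enc_inj bool. Proof. by case=> [] []. Qed.
#[export] Instance enc_inj_unit : enc_inj unit. Proof. by case=> [] []. Qed.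
#[export] Instance enc_inj_list {A} {EA : enc A} : enc_inj A -> enc_inj (seq A).
Proof.
move=> h; elim=> [|a s IH] [|b t] //= [] /h -> /IH.
by move=> ->.
Qed.
#[export] Instance enc_inj_nat : enc_inj nat.
Proof.
move=> m n /= e; rewrite -(size_nseq m tt) -(size_nseq n tt); congr size.
exact: (@encode_inj _ _ (enc_inj_list enc_inj_unit)).
Qed.
#[export] Instance enc_inj_pair {A B} {EA : enc A} {EB : enc B} :
  enc_inj A -> enc_inj B -> enc_inj (A * B).
Proof. by move=> hA hB [a b] [a' b'] /= [] /hA -> /hB ->. Qed.

Lemma pt_eqop {X} {EX : enc X} (D : X -> Prop) (T : eqType) (ET : enc T) (IT : enc_inj T) (a b : X -> T) :
  pt D a -> pt D b -> pt D (fun x => a x == b x).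
Proof.
move=> pa pb; apply: (@pt_eq _ _ _ _ _ (fun x => data_eqb (encode (a x)) (encode (b x)))).
  by move=> x _; apply/idP/idP => [/eqP -> | /data_eqbP e]; [exact/data_eqbP | exact/eqP/encode_inj].
by apply: (pt_app2 (f := data_eqb) pt_data_eqb); apply: pt_encode.
Qed.

Lemma pt_mem {X} {EX : enc X} (D : X -> Prop) (T : eqType) (ET : enc T) (IT : enc_inj T) (a : X -> T) (s : X -> seq T) :
  pt D a -> pt D s -> pt D (fun x => a x \in s x).
Proof.
move=> pa ps; apply: (@pt_eq _ _ _ _ _ (fun x => has (fun b => b == a x) (s x))).
  by move=> x _; rewrite has_pred1.
apply: pt_has => //; apply: pt_eqop; first exact/pt_snd/pt_id.
by apply: (@pt_comp _ _ _ _ _ _ _ _ a fst pa) => //; apply/pt_fst/pt_id.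
Qed.

Lemma pt_leq {X} {EX : enc X} (D : X -> Prop) (m n : X -> nat) :
  pt D m -> pt D n -> pt D (fun x => m x <= n x).
Proof.
move=> pm pn; apply: (@pt_eq _ _ _ _ _ (fun x => m x \in iota 0 (n x).+1)).
  by move=> x _; rewrite mem_iota.
exact/pt_mem/pt_iota0/pt_succ.
Qed.

(** * Binary digits and bit-serial loops *)

Record bin := Bin { unbin : nat }.
#[export] Instance enc_binary : enc bin := {| encode := fun b => enc_nat (unbin b) |}.

Definition bits_lsb (p : BinNums.positive) : seq bool :=
  (fix bits p := match p with BinNums.xH => [::] | BinNums.xO p => false :: bits p
    | BinNums.xI p => true :: bits p end) p.

(** With the most significant bit first, a left fold with [push_bit] reads the number by Horner's
    scheme; multiplication and division scan it in the same order. *)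
Definition bits_msb (n : nat) : seq bool :=
  if bin_of_nat n is BinNums.Npos p then true :: rev (bits_lsb p) else [::].

Definition push_bit (n : nat) (b : bool) : nat := b + n.*2.
Definition of_bits := foldl push_bit 0.

Lemma enc_pos_bits p : enc_pos p = encode (bits_lsb p).
Proof. by elim: p => //= p ->. Qed.

Lemma of_bits_msb n : of_bits (bits_msb n) = n.
Proof.
rewrite -[RHS]bin_of_natK /bits_msb; case: (bin_of_nat n) => // p /=.
have H : foldl push_bit 1 (rev (bits_lsb p)) = nat_of_pos p.
  by elim: p => [p IH|p IH|] //; rewrite [bits_lsb _]/= rev_cons foldl_rcons IH /push_bit /= NatTrec.doubleE.
by rewrite /of_bits /= -H.
Qed.

Lemma esize_bits_msb n : esize (bits_msb n) <= 3 * esize (Bin n).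
Proof.
rewrite /bits_msb /esize /= /enc_nat; case: (bin_of_nat n) => [|p] //=; rewrite enc_pos_bits.
generalize (esize_rev (bits_lsb p)); rewrite /esize /=; lia.
Qed.

Lemma of_bits_lt_aux s n : foldl push_bit n s < n.+1 * 2 ^ size s.
Proof.
elim/last_ind: s => [|s b IH]; first by rewrite muln1.
rewrite foldl_rcons size_rcons expnS {1}/push_bit mulnCA.
by case: b; move: IH; set u := foldl _ _ _; set v := _.+1 * _; lia.
Qed.

(** With [esize_bin_le] this makes the encoded size a logarithm up to constants, and so translates
    bounds on values into bounds on sizes and back. *)
Lemma bin_lt_exp n : n < 2 ^ esize (Bin n).
Proof.
rewrite -{1}(of_bits_msb n); apply: leq_trans (of_bits_lt_aux _ 0) _.
rewrite mul1n leq_exp2l //.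
rewrite /bits_msb /esize /= /enc_nat; case: (bin_of_nat n) => [|p] //=; rewrite enc_pos_bits size_rev.
generalize (size_le_esize (bits_lsb p)); rewrite /esize /=; lia.
Qed.

Lemma esize_bin_le n k : n < 2 ^ k -> esize (Bin n) <= 4 * k + 3.
Proof.
rewrite -{1}[n]bin_of_natK /esize /= /enc_nat; case: (bin_of_nat n) => [|p] /= h; first by lia.
suff {h}H : forall k, nat_of_pos p < 2 ^ k -> dsize (enc_pos p) <= 4 * k by have := H k h; lia.
elim: p {k} => [p IH|p IH|] [|k] /=; rewrite ?NatTrec.doubleE ?expnS //; try lia.
- by move=> h; have := IH k; lia.
- by move=> h; have := IH k; lia.
Qed.

Lemma enc_nat_push n b : 0 < n -> enc_nat (push_bit n b) =
  DCons DNil (DCons (enc_bool b) (dtail (enc_nat n))).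
Proof.
rewrite -{1 2}[n]bin_of_natK /enc_nat /push_bit; case: (bin_of_nat n) => //= p _.
have -> : b + (nat_of_pos p).*2 =
   nat_of_bin (BinNums.Npos (if b then BinNums.xI p else BinNums.xO p)).
  by case: b => /=; rewrite NatTrec.doubleE.
by rewrite nat_of_binK; case: b.
Qed.

Lemma is_cons_enc_nat n : is_cons (enc_nat n) = (0 < n).
Proof.
rewrite -{2}[n]bin_of_natK /enc_nat; case: (bin_of_nat n) => //= p.
by elim: p => //= p IH; rewrite ?NatTrec.doubleE ?double_gt0.
Qed.

Lemma push_half n : n = push_bit n./2 (odd n).
Proof. by rewrite /push_bit odd_double_half. Qed.

Lemma enc_nat_tail n : is_cons (dtail (enc_nat n)) = (1 < n).
Proof.
by case: n => [|[|n]] //; rewrite [X in enc_nat X]push_half enc_nat_push.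
Qed.

Lemma pt_push_bit {X} {EX : enc X} (D : X -> Prop) (n : X -> nat) (b : X -> bool) :
  pt D (fun x => Bin (n x)) -> pt D b -> pt D (fun x => Bin (push_bit (n x) (b x))).
Proof.
move=> pn pb; apply: (@pt_enc _ _ _ _ _ _ _ (fun x => if is_cons (encode (Bin (n x)))
  then DCons DNil (DCons (encode (b x)) (dtail (encode (Bin (n x)))))
  else if b x then DCons DNil DNil else DNil)).
  move=> x _ /=; rewrite is_cons_enc_nat; case: ltnP => [/enc_nat_push -> //|].
  by rewrite leqn0 => /eqP->; case: (b x).
apply: pt_dif; first exact: pt_encode.
  have sub : forall x, D x /\ is_cons (encode (Bin (n x))) -> D x by move=> x [].
  apply: pt_dcons; first exact: pt_const.
  apply: pt_dcons; first exact/pt_encode/(pt_sub sub).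
  exact/pt_dtail/pt_encode/(pt_sub sub).
have sub : forall x, D x /\ ~~ is_cons (encode (Bin (n x))) -> D x by move=> x [].
by apply: pt_ite; [exact: pt_sub sub pb|exact: pt_const|exact: pt_const].
Qed.

Lemma pt_odd {X} {EX : enc X} (D : X -> Prop) (n : X -> nat) : pt D (fun x => Bin (n x)) -> pt D (fun x => odd (n x)).
Proof.
move=> pn; pose (d := fun x => encode (Bin (n x))); have pd : pt D d by apply: pt_encode.
apply: (@pt_eq _ _ _ _ _ (fun x => if is_cons (dtail (d x)) then
   (if is_cons (dhead (dtail (d x))) then true else false) else (if is_cons (d x) then true else false))).
  move=> x _; rewrite /d /= enc_nat_tail is_cons_enc_nat; case: (n x) => [|[|m]] //.
  by rewrite [X in enc_nat X]push_half enc_nat_push //=; case: odd.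
apply: pt_dif; first exact: pt_dtail.
  apply: (@pt_sub _ _ _ _ _ D); first by move=> x [].
  by apply: pt_dif; [exact/pt_dhead/pt_dtail|apply: pt_const|apply: pt_const].
apply: (@pt_sub _ _ _ _ _ D); first by move=> x [].
by apply: pt_dif; [|apply: pt_const|apply: pt_const].
Qed.

Lemma pt_half {X} {EX : enc X} (D : X -> Prop) (n : X -> nat) : pt D (fun x => Bin (n x)) -> pt D (fun x => Bin (n x)./2).
Proof.
move=> pn; pose (d := fun x => encode (Bin (n x))); have pd : pt D d by apply: pt_encode.
apply: (@pt_enc _ _ _ _ _ _ _ (fun x => if is_cons (dtail (d x)) then
   DCons DNil (dtail (dtail (d x))) else DNil)).
  move=> x _; rewrite /d /= enc_nat_tail; case: (n x) => [|[|m]] //.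
  rewrite [X in dtail (dtail (enc_nat X))]push_half enc_nat_push //=.
apply: pt_dif; first exact: pt_dtail.
  apply: (@pt_sub _ _ _ _ _ D); first by move=> x [].
  by apply: pt_dcons; [apply: pt_const|exact/pt_dtail/pt_dtail].
exact: pt_const.
Qed.

Lemma pt_bits_msb {X} {EX : enc X} (D : X -> Prop) (n : X -> nat) : pt D (fun x => Bin (n x)) -> pt D (fun x => bits_msb (n x)).
Proof.
move=> pn; apply: (@pt_eq _ _ _ _ _ (fun x => if is_cons (encode (Bin (n x))) then bits_msb (n x) else [::])).
  by move=> x _; rewrite /= is_cons_enc_nat; case: (n x).
apply: pt_dif; [exact: pt_encode| |exact: pt_const].
set D' := (fun x => _).
have pr : pt (fun _ => True) (fun l : seq bool => true :: rev l).
  by apply: pt_cons; [apply: pt_const|apply/pt_rev/pt_id].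
apply: (pt_via pr (g := fun x => dtail (encode (Bin (n x))))).
  by apply/pt_dtail/pt_encode; apply: (@pt_sub _ _ _ _ _ D) => // x [].
move=> x [] _; rewrite /= /enc_nat /bits_msb; case: (bin_of_nat (n x)) => [|p] // _.
by exists (bits_lsb p); rewrite /= enc_pos_bits.
Qed.

Lemma pt_of_bits {X} {EX : enc X} (D : X -> Prop) (s : X -> seq bool) : pt D s -> pt D (fun x => Bin (of_bits (s x))).
Proof.
move=> ps; have E l n : foldl (fun acc b => Bin (push_bit (unbin acc) b)) (Bin n) l = Bin (foldl push_bit n l).
  by elim: l n => //= b l IH n; rewrite IH.
apply: (@pt_eq _ _ _ _ _ (fun x => foldl (fun acc b => Bin (push_bit (unbin acc) b)) (Bin 0) (s x))).
  by move=> x _; rewrite E.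
have [k hk] := pt_size ps.
apply: (@pt_foldl_free _ _ _ _ _ _ _ (fun x acc b => Bin (push_bit (unbin acc) b)) (fun=> Bin 0) s
  (fun n => 4 * (n + 2) ^ k + 3)) => //.
- exact: pt_const.
- apply: pt_push_bit; last exact/pt_snd/pt_id.
  by apply: (@pt_eq _ _ _ _ _ (fun y => y.1.2)) => [[[x []] ]|] //; apply/pt_snd/pt_fst/pt_id.
- by growth.
move=> x Dx s1 s2 es; rewrite E.
apply: leq_trans (esize_bin_le (k := size s1) _) _.
  by have := of_bits_lt_aux s1 0; rewrite mul1n.
rewrite leq_add2r leq_mul2l /=; apply: leq_trans (hk x Dx).
by apply: leq_trans (ltnW (size_le_esize _)); rewrite es size_cat leq_addr.
Qed.

Lemma of_bits_cons b s : of_bits (b :: s) = b * 2 ^ size s + of_bits s.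
Proof.
elim/last_ind: s => [|s b' IH]; first by rewrite /of_bits /= /push_bit; lia.
rewrite -rcons_cons /of_bits !foldl_rcons -/of_bits IH size_rcons expnS /push_bit; lia.
Qed.

Lemma esize_bits (s : seq bool) : esize s <= 4 * size s + 1.
Proof. by elim: s => //= b s IH; rewrite esize_cons; case: b; rewrite /esize /= in IH *; lia. Qed.

Lemma pt_unbin {X} {EX : enc X} (D : X -> Prop) (b : X -> bin) : pt D b -> pt D (fun x => Bin (unbin (b x))).
Proof. by apply: pt_eq => x _; case: (b x). Qed.

(* A bit-serial loop over [m], [n] and a carry, writing the output least significant bit first. *)
Definition serial_step (carry out : bool -> bool -> bool -> bool)
    (st : bin * bin * (bool * seq bool)) : bin * bin * (bool * seq bool) :=
  let m := unbin st.1.1 in let n := unbin st.1.2 in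
  (Bin m./2, Bin n./2,
    (carry (odd m) (odd n) st.2.1, out (odd m) (odd n) st.2.1 :: st.2.2)).

(** The list is only a counter of rounds, long enough for both numbers and the carry to be shifted
    out. *)
Definition serial carry out c m n :=
  foldl (fun st (_ : bool) => serial_step carry out st) (Bin m, Bin n, (c, [::]))
    (bits_msb m ++ true :: bits_msb n).

Lemma size_bits_msb n : size (bits_msb n) <= 3 * esize (Bin n).
Proof. exact: leq_trans (ltnW (size_le_esize _)) (esize_bits_msb n). Qed.

Lemma lt_exp_size_bits n : n < 2 ^ size (bits_msb n).
Proof. by rewrite -{1}[n]of_bits_msb; have := of_bits_lt_aux (bits_msb n) 0; rewrite mul1n. Qed.

Lemma serial_size carry out (s : seq bool) st :
  let r := foldl (fun st (_ : bool) => serial_step carry out st) st s in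
  [/\ unbin r.1.1 <= unbin st.1.1, unbin r.1.2 <= unbin st.1.2 & size r.2.2 = size s + size st.2.2].
Proof.
elim: s st => //= _ s IH st; have [h1 h2 h3] := IH (serial_step carry out st).
split; [apply: leq_trans h1 _|apply: leq_trans h2 _|rewrite h3 /=; lia]; rewrite /serial_step /=.
- by lia.
- by lia.
Qed.

Lemma pt_bool3 {X} {EX : enc X} (D : X -> Prop) (f : bool -> bool -> bool -> bool) (a b c : X -> bool) :
  pt D a -> pt D b -> pt D c -> pt D (fun x => f (a x) (b x) (c x)).
Proof.
move=> pa pb pc; apply: (@pt_eq _ _ _ _ _ (fun x => if a x
  then (if b x then (if c x then f true true true else f true true false)
        else (if c x then f true false true else f true false false))
  else (if b x then (if c x then f false true true else f false true false)
        else (if c x then f false false true else f false false false)))).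
  by move=> x _; case: (a x); case: (b x); case: (c x).
by do ![apply: pt_const | apply: pt_ite => //].
Qed.

Lemma pt_serial {X} {EX : enc X} (D : X -> Prop) carry out c (m n : X -> nat) :
  pt D (fun x => Bin (m x)) -> pt D (fun x => Bin (n x)) -> pt D (fun x => serial carry out c (m x) (n x)).
Proof.
move=> pm pn; have [k hk] := pt_size pm; have [l hl] := pt_size pn.
apply: (@pt_foldl_free _ _ _ _ _ _ _ (fun x st b => serial_step carry out st)
  (fun x => (Bin (m x), Bin (n x), (c, [::]))) (fun x => bits_msb (m x) ++ true :: bits_msb (n x))
  (fun N => 100 * (N + 2) ^ k + 100 * (N + 2) ^ l + 100)).
- by do ![apply: pt_pair => //]; apply: pt_const.
- apply: pt_cat; first exact: pt_bits_msb.
  by apply: pt_cons; [apply: pt_const|exact: pt_bits_msb].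
- have q1 : pt (fun y : X * (bin * bin * (bool * seq bool)) * bool => D y.1.1) (fun y => Bin (unbin y.1.2.1.1)).
    exact/pt_unbin/pt_fst/pt_fst/pt_snd/pt_fst/pt_id.
  have q2 : pt (fun y : X * (bin * bin * (bool * seq bool)) * bool => D y.1.1) (fun y => Bin (unbin y.1.2.1.2)).
    exact/pt_unbin/pt_snd/pt_fst/pt_snd/pt_fst/pt_id.
  have q3 : pt (fun y : X * (bin * bin * (bool * seq bool)) * bool => D y.1.1) (fun y => y.1.2.2.1).
    exact/pt_fst/pt_snd/pt_snd/pt_fst/pt_id.
  apply: pt_pair; first by apply: pt_pair; apply: pt_half.
  apply: pt_pair; first by apply: pt_bool3 => //; apply: pt_odd.
  apply: pt_cons; first by apply: pt_bool3 => //; apply: pt_odd.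
  exact/pt_snd/pt_snd/pt_snd/pt_fst/pt_id.
- by growth.
move=> x Dx s1 s2 es; set st := foldl _ _ _.
have [h1 h2 h3] := serial_size carry out s1 (Bin (m x), Bin (n x), (c, [::])).
rewrite -/st in h1 h2 h3.
have : size s1 <= 3 * esize (Bin (m x)) + (3 * esize (Bin (n x))).+1.
  have /(congr1 size) := es; rewrite !size_cat /=.
  by have := size_bits_msb (m x); have := size_bits_msb (n x); lia.
have hm := esize_bin_le (leq_ltn_trans h1 (bin_lt_exp (m x))).
have hn := esize_bin_le (leq_ltn_trans h2 (bin_lt_exp (n x))).
have := hk x Dx; have := hl x Dx.
case: st h3 hm hn {h1 h2} => [[[m'] [n']] [c' o']] /=; rewrite addn0 => h3 hm hn.
generalize (esize_bits o'); rewrite !esize_pair h3.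
have : esize c' <= 3 by case: (c').
by lia.
Qed.

Lemma addn_serial m n :
  m + n = of_bits (serial (fun a b c => 1 < a + b + c) (fun a b c => a (+) b (+) c) false m n).2.2.
Proof.
rewrite /serial; set st0 := (_, _, _); set s := _ ++ _.
(* Invariant: the digits written, plus the pending sum weighted by the next power of 2. The pending
   sum at least halves in each round, so it is 0 at the end. *)
suff H : forall s st, let r := foldl (fun st (_ : bool) => serial_step (fun a b c => 1 < a + b + c) (fun a b c => a (+) b (+) c) st) st s in
  of_bits r.2.2 + 2 ^ size r.2.2 * (unbin r.1.1 + unbin r.1.2 + r.2.1) =
  of_bits st.2.2 + 2 ^ size st.2.2 * (unbin st.1.1 + unbin st.1.2 + st.2.1) /\
  (unbin r.1.1 + unbin r.1.2 + r.2.1) * 2 ^ size s <= unbin st.1.1 + unbin st.1.2 + st.2.1.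
  have [] := H s st0; set r := foldl _ _ _; rewrite {3 4 5 6 7 8}/st0 /= mul1n add0n addn0 => e1 e2.
  have e3 : m + n < 2 ^ size s.
    rewrite size_cat /= addnS expnS expnD.
    have := lt_exp_size_bits m; have := lt_exp_size_bits n.
    move: (2 ^ _) (2 ^ _) => a b h h'.
    apply: leq_trans (_ : a + b <= _); first by lia.
    by case: a b h h' => [|a] [|b] //; nia.
  have e4 : unbin r.1.1 + unbin r.1.2 + r.2.1 = 0.
    move: e2; case: (_ + _ + _) => // u; rewrite mulSn => e2; lia.
  by rewrite -e1 e4 muln0 addn0.
elim=> [|b s0 IH] [[[m0] [n0]] [c0 o0]] //=; first by split=> //; rewrite muln1.
set st' := serial_step _ _ _.
have [-> h2] := IH st'; rewrite {IH}.
rewrite /st' /serial_step /= of_bits_cons expnS.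
have e : forall m0 n0 (c0 : bool), m0 + n0 + c0 = (odd m0 (+) odd n0 (+) c0) + ((m0)./2 + n0./2 + (1 < odd m0 + odd n0 + c0)).*2.
  move=> m1 n1 c1; have := odd_double_half m1; have := odd_double_half n1.
  by move: (m1./2) (n1./2) => u1 u2; case: (odd m1); case: (odd n1); case: c1 => /=; lia.
split; first by rewrite (e m0 n0 c0); move: (2 ^ _) (_./2 + _./2 + _) (nat_of_bool (_ (+) _)) => u v w; nia.
rewrite (e m0 n0 c0) expnS mulnCA; apply: leq_trans (leq_mul (leqnn 2) h2) _.
by rewrite mul2n leq_addl.
Qed.

Lemma pt_badd {X} {EX : enc X} (D : X -> Prop) (m n : X -> nat) :
  pt D (fun x => Bin (m x)) -> pt D (fun x => Bin (n x)) -> pt D (fun x => Bin (m x + n x)).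
Proof.
move=> pm pn; apply: (@pt_eq _ _ _ _ _ (fun x => Bin (of_bits (serial _ _ false (m x) (n x)).2.2))).
  by move=> x _; rewrite addn_serial.
by apply/pt_of_bits/pt_snd/pt_snd/pt_serial.
Qed.

Lemma serial_exhaust carry out (s : seq bool) st :
  let r := foldl (fun st (_ : bool) => serial_step carry out st) st s in
  unbin r.1.1 * 2 ^ size s <= unbin st.1.1 /\ unbin r.1.2 * 2 ^ size s <= unbin st.1.2.
Proof.
elim: s st => [|b s IH] st /=; first by rewrite !muln1.
have [h1 h2] := IH (serial_step carry out st); rewrite expnS !(mulnCA _ 2).
by split; [apply: leq_trans (leq_mul (leqnn 2) h1) _|apply: leq_trans (leq_mul (leqnn 2) h2) _];
  rewrite /serial_step /=; lia.
Qed.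

Lemma serial_end carry out c m n : let r := serial carry out c m n in
  unbin r.1.1 = 0 /\ unbin r.1.2 = 0.
Proof.
rewrite /serial; have [] := serial_exhaust carry out (bits_msb m ++ true :: bits_msb n) (Bin m, Bin n, (c, [::])).
set r := foldl _ _ _; rewrite size_cat /= => h1 h2.
have e1 : m < 2 ^ (size (bits_msb m) + (size (bits_msb n)).+1).
  by apply: leq_trans (lt_exp_size_bits m) _; rewrite leq_exp2l // leq_addr.
have e2 : n < 2 ^ (size (bits_msb m) + (size (bits_msb n)).+1).
  by apply: leq_trans (lt_exp_size_bits n) _; rewrite leq_exp2l //; lia.
split; [move: h1 e1|move: h2 e2]; case: (unbin _) => // u; rewrite mulSn; lia.
Qed.

(** The carry compares the low parts scanned so far and is overridden by a higher bit in which the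
    numbers differ. Invariant: comparison of the unread parts, ties decided by the carry. *)
Lemma leq_serial m n :
  (m <= n) = (serial (fun a b c => if a == b then c else b) (fun _ _ _ => true) true m n).2.1.
Proof.
have [] := serial_end (fun a b c => if a == b then c else b) (fun _ _ _ => true) true m n.
rewrite /serial; set s := _ ++ _.
pose cmp (st : bin * bin * (bool * seq bool)) :=
  (unbin st.1.1 < unbin st.1.2) || ((unbin st.1.1 == unbin st.1.2) && st.2.1).
have -> : (m <= n) = cmp (Bin m, Bin n, (true, [::])) by rewrite /cmp /= andbT orbC leq_eqVlt.
have H : forall s st, cmp (foldl (fun st (_ : bool) => serial_step (fun a b c => if a == b then c else b) (fun _ _ _ => true) st) st s) = cmp st.
  elim=> //= b s0 IH st; rewrite IH; case: st => [[[m0] [n0]] [c0 o0]].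
  rewrite /cmp /serial_step /=; have := odd_double_half m0; have := odd_double_half n0.
  by move: (m0./2) (n0./2) => u v; case: (odd m0); case: (odd n0); case: c0 => /=; lia.
rewrite -(H s); set r := foldl _ _ _ => e1 e2.
by rewrite /cmp e1 e2 /=.
Qed.

Lemma subn_serial m n : n <= m ->
  m - n = of_bits (serial (fun a b c => a < b + c) (fun a b c => a (+) b (+) c) false m n).2.2.
Proof.
have [] := serial_end (fun a b c => a < b + c) (fun a b c => a (+) b (+) c) false m n.
rewrite /serial; set s := _ ++ _; set r := foldl _ _ _ => e1 e2 nm.
(* That the unread minuend covers the unread subtrahend and the borrow is preserved by a step, and
   it makes the truncated subtraction exact. *)
have H : forall s (st : bin * bin * (bool * seq bool)), unbin st.1.2 + st.2.1 <= unbin st.1.1 ->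
  let r := foldl (fun st (_ : bool) => serial_step (fun a b c => a < b + c) (fun a b c => a (+) b (+) c) st) st s in
  of_bits r.2.2 + 2 ^ size r.2.2 * (unbin r.1.1 - (unbin r.1.2 + r.2.1)) =
  of_bits st.2.2 + 2 ^ size st.2.2 * (unbin st.1.1 - (unbin st.1.2 + st.2.1)).
  elim=> // b s0 IH [[[m0] [n0]] [c0 o0]] le /=; rewrite IH /=; last first.
    move: le => /=; have := odd_double_half m0; have := odd_double_half n0.
    by move: (m0./2) (n0./2) => u v; case: (odd m0); case: (odd n0); case: c0 => /=; lia.
  rewrite of_bits_cons expnS.
  have -> : m0 - (n0 + c0) = (odd m0 (+) odd n0 (+) c0) + (m0./2 - (n0./2 + (odd m0 < odd n0 + c0))).*2.
    move: le => /=; have := odd_double_half m0; have := odd_double_half n0.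
    by move: (m0./2) (n0./2) => u v; case: (odd m0); case: (odd n0); case: c0 => /=; lia.
  by move: (2 ^ _) (_./2 - _) (nat_of_bool (_ (+) _)) => u v w; nia.
have := H s (Bin m, Bin n, (false, [::])); rewrite /= addn0 => /(_ nm); rewrite -/r e1 e2 mul1n add0n.
by rewrite sub0n muln0 addn0 => ->.
Qed.

Lemma pt_bleq {X} {EX : enc X} (D : X -> Prop) (m n : X -> nat) :
  pt D (fun x => Bin (m x)) -> pt D (fun x => Bin (n x)) -> pt D (fun x => m x <= n x).
Proof.
move=> pm pn; apply: (@pt_eq _ _ _ _ _ (fun x => (serial _ _ true (m x) (n x)).2.1)).
  by move=> x _; rewrite leq_serial.
by apply/pt_fst/pt_snd/pt_serial.
Qed.

Lemma pt_bsub {X} {EX : enc X} (D : X -> Prop) (m n : X -> nat) :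
  pt D (fun x => Bin (m x)) -> pt D (fun x => Bin (n x)) -> pt D (fun x => Bin (m x - n x)).
Proof.
move=> pm pn; apply: (@pt_eq _ _ _ _ _ (fun x => if n x <= m x then Bin (of_bits (serial _ _ false (m x) (n x)).2.2) else Bin 0)).
  move=> x _; case: leqP => [/subn_serial -> //|/ltnW]; by rewrite -subn_eq0 => /eqP->.
apply: pt_ite; [exact: pt_bleq| |exact: pt_const].
by apply/pt_of_bits/pt_snd/pt_snd/pt_serial.
Qed.

Lemma leq_push_bit n b : n <= push_bit n b.
Proof. by rewrite /push_bit; lia. Qed.

Lemma bits_msb_prefix n s1 s2 : bits_msb n = s1 ++ s2 -> of_bits s1 <= n /\ size s1 <= 3 * esize (Bin n).
Proof.
move=> e; split; last by have := size_bits_msb n; rewrite e size_cat; lia.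
rewrite -[n]of_bits_msb e /of_bits foldl_cat.
by elim/last_ind: s2 {e} => // s b IH; rewrite foldl_rcons; apply: leq_trans IH (leq_push_bit _ _).
Qed.

Lemma esize_bin_mul m n m' n' : m' <= m -> n' <= n ->
  esize (Bin (m' * n')) <= 4 * (esize (Bin m) + esize (Bin n)) + 3.
Proof.
move=> hm hn; apply: esize_bin_le; rewrite expnD.
have := bin_lt_exp m; have := bin_lt_exp n; move: (2 ^ _) (2 ^ _) => u v h1 h2.
apply: leq_ltn_trans (leq_mul hm hn) _; case: u v h1 h2 => [|u] [|v] //; nia.
Qed.

Lemma pt_bmul {X} {EX : enc X} (D : X -> Prop) (m n : X -> nat) :
  pt D (fun x => Bin (m x)) -> pt D (fun x => Bin (n x)) -> pt D (fun x => Bin (m x * n x)).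
Proof.
move=> pm pn; apply: (pt_app2 (f := fun a b => Bin (unbin a * unbin b)) _ pm pn).
pose step (n acc : bin) (b : bool) := Bin ((if b then unbin n else 0) + push_bit (unbin acc) false).
have E n' s : foldl (step n') (Bin 0) s = Bin (of_bits s * unbin n').
  elim/last_ind: s => [|s b IH] //; rewrite /of_bits !foldl_rcons IH -/of_bits /step /push_bit /=.
  by congr Bin; case: b; lia.
apply: (@pt_eq _ _ _ _ _ (fun p : bin * bin => foldl (step p.2) (Bin 0) (bits_msb (unbin p.1)))).
  by move=> p _; rewrite E of_bits_msb.
apply: (@pt_foldl_free _ _ _ _ _ _ _ (fun (p : bin * bin) => step p.2) (fun=> Bin 0) (fun p => bits_msb (unbin p.1)) (fun N => 4 * (N + N) + 3)).
- exact: pt_const.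
- exact/pt_bits_msb/pt_unbin/pt_fst/pt_id.
- apply: pt_badd; last first.
    by apply: pt_push_bit; [exact/pt_unbin/pt_snd/pt_fst/pt_id|apply: pt_const].
  apply: (@pt_eq _ _ _ _ _ (fun y => if y.2 then Bin (unbin y.1.1.2) else Bin 0)) => [y _|].
    by case: y.2.
  by apply: pt_ite; [exact/pt_snd/pt_id|exact/pt_unbin/pt_snd/pt_fst/pt_fst/pt_id|apply: pt_const].
- by growth.
move=> [[a] [b]] _ s1 s2 /= /bits_msb_prefix [h _]; rewrite E.
by apply: leq_trans (esize_bin_mul h (leqnn b)) _; rewrite esize_pair; lia.
Qed.

Definition div_step (d : nat) (st : bin * bin) (b : bool) : bin * bin :=
  let r := push_bit (unbin st.2) b in
  if d <= r then (Bin (push_bit (unbin st.1) true), Bin (r - d))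
  else (Bin (push_bit (unbin st.1) false), Bin r).

(** Long division: the remainder is below [d], so after one more bit it is below [2 * d] and a
    single subtraction restores it. *)
Lemma div_bits d s : 0 < d -> foldl (div_step d) (Bin 0, Bin 0) s = (Bin (of_bits s %/ d), Bin (of_bits s %% d)).
Proof.
move=> d0; elim/last_ind: s => [|s b IH]; first by rewrite div0n mod0n.
rewrite /of_bits !foldl_rcons IH -/of_bits /div_step /=.
have := divn_eq (of_bits s) d; have := ltn_pmod (of_bits s) d0.
move: (_ %/ _) (_ %% _) => q r rd e.
set r' := push_bit r b; set k := push_bit (of_bits s) b.
have hk : k = q.*2 * d + r' by rewrite /k /r' /push_bit e; lia.
have r'd : r' < d + d by rewrite /r' /push_bit; case: b {k hk r'}; lia.
clearbody k r'; rewrite /push_bit; case: leqP => h.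
  have ek : k = (q.*2.+1) * d + (r' - d) by rewrite mulSn hk; lia.
  have lt : r' - d < d by lia.
  by rewrite ek divnMDl // modnMDl (divn_small lt) (modn_small lt) addn0.
by rewrite hk divnMDl // modnMDl (divn_small h) (modn_small h) addn0.
Qed.

Lemma pt_bdivmod {X} {EX : enc X} (D : X -> Prop) (m d : X -> nat) :
  pt D (fun x => Bin (m x)) -> pt D (fun x => Bin (d x)) -> (forall x, D x -> 0 < d x) ->
  pt D (fun x => (Bin (m x %/ d x), Bin (m x %% d x))).
Proof.
move=> pm pd dpos.
have pf : pt (fun p : bin * bin => 0 < unbin p.2) (fun p => (Bin (unbin p.1 %/ unbin p.2), Bin (unbin p.1 %% unbin p.2))).
  apply: (@pt_eq _ _ _ _ _ (fun p : bin * bin => foldl (div_step (unbin p.2)) (Bin 0, Bin 0) (bits_msb (unbin p.1)))).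
    by move=> p hp; rewrite div_bits ?of_bits_msb.
  apply: (@pt_foldl_free _ _ _ _ _ _ _ (fun (p : bin * bin) => div_step (unbin p.2)) (fun=> (Bin 0, Bin 0)) (fun p => bits_msb (unbin p.1)) (fun N => 10 * N + 10)).
  - exact: pt_const.
  - exact/pt_bits_msb/pt_unbin/pt_fst/pt_id.
  - have p1 : pt (fun y : bin * bin * (bin * bin) * bool => 0 < unbin y.1.1.2) (fun y => Bin (unbin y.1.1.2)).
      exact/pt_unbin/pt_snd/pt_fst/pt_fst/pt_id.
    have p2 : pt (fun y : bin * bin * (bin * bin) * bool => 0 < unbin y.1.1.2) (fun y => Bin (unbin y.1.2.1)).
      exact/pt_unbin/pt_fst/pt_snd/pt_fst/pt_id.
    have p3 : pt (fun y : bin * bin * (bin * bin) * bool => 0 < unbin y.1.1.2) (fun y => Bin (push_bit (unbin y.1.2.2) y.2)).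
      by apply: pt_push_bit; [exact/pt_unbin/pt_snd/pt_snd/pt_fst/pt_id|exact/pt_snd/pt_id].
    apply: pt_ite; first exact: pt_bleq.
      by apply: pt_pair; [apply: pt_push_bit => //; apply: pt_const|apply: pt_bsub].
    by apply: pt_pair => //; apply: pt_push_bit => //; apply: pt_const.
  - by growth.
  move=> [[a] [b]] /= b0 s1 s2 /bits_msb_prefix [h _]; rewrite div_bits // !esize_pair.
  have h1 := esize_bin_le (leq_ltn_trans (leq_trans (leq_div _ _) h) (bin_lt_exp a)).
  have h2 := esize_bin_le (ltn_trans (ltn_pmod (of_bits s1) b0) (bin_lt_exp b)).
  by have := h1 b; lia.
by apply: (pt_comp pf (pt_pair pm pd)) => x /dpos.
Qed.

Lemma pt_bdiv {X} {EX : enc X} (D : X -> Prop) (m d : X -> nat) :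
  pt D (fun x => Bin (m x)) -> pt D (fun x => Bin (d x)) -> (forall x, D x -> 0 < d x) ->
  pt D (fun x => Bin (m x %/ d x)).
Proof. by move=> pm pd dpos; apply: (pt_fst (pt_bdivmod pm pd dpos)). Qed.

Lemma pt_bmod {X} {EX : enc X} (D : X -> Prop) (m d : X -> nat) :
  pt D (fun x => Bin (m x)) -> pt D (fun x => Bin (d x)) -> (forall x, D x -> 0 < d x) ->
  pt D (fun x => Bin (m x %% d x)).
Proof. by move=> pm pd dpos; apply: (pt_snd (pt_bdivmod pm pd dpos)). Qed.

Definition euclid_step (st : bin * bin) : bin * bin :=
  if 0 < unbin st.1 then (Bin (unbin st.2 %% unbin st.1), st.1) else st.

(** For a < b and r = b mod a one has b >= a + r > 2 r, so the product of the two numbers more than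
    halves. The number of rounds is bounded by the bit length of the initial product. *)
Lemma euclid_gcd k st : let r := iter k euclid_step st in
  [/\ gcdn (unbin r.1) (unbin r.2) = gcdn (unbin st.1) (unbin st.2),
      maxn (unbin r.1) (unbin r.2) <= maxn (unbin st.1) (unbin st.2)
    & forall j, unbin st.1 < unbin st.2 -> unbin st.1 * unbin st.2 < 2 ^ j -> j <= k -> unbin r.1 = 0].
Proof.
elim: k st => [|k IH] st.
  split=> // j lt hj; rewrite leqn0 => /eqP j0; move: hj; rewrite j0; case: (unbin st.1) lt => // a.
  by case: (unbin st.2).
rewrite iterSr; have [h1 h2 h3] := IH (euclid_step st); split.
- rewrite h1 /euclid_step; case: ifP => //= a0.
  by rewrite gcdn_modl gcdnC.
- apply: leq_trans h2 _; rewrite /euclid_step; case: ifP => //= a0.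
  by have := ltn_pmod (unbin st.2) a0; lia.
move=> j lt hj jk; case: (posnP (unbin st.1)) => [a0|a0].
  have e1 : euclid_step st = st by rewrite /euclid_step a0.
  by rewrite e1 iter_fix.
case: j hj jk => [|j] hj jk; first by move: lt a0 hj; case: (unbin st.1) (unbin st.2) => [|u] [|v].
apply: (h3 j) => //; rewrite /euclid_step a0 /=; first by rewrite ltn_pmod.
have := ltn_pmod (unbin st.2) a0; have := divn_eq (unbin st.2) (unbin st.1).
have : 0 < unbin st.2 %/ unbin st.1 by rewrite divn_gt0 // ltnW.
move: hj; rewrite expnS; move: (2 ^ j) (_ %/ _) (_ %% _) => P q r hj q0 e hr.
have : unbin st.1 + r <= unbin st.2 by rewrite e leq_add2r leq_pmull.
by nia.
Qed.

Lemma pt_bgcd {X} {EX : enc X} (D : X -> Prop) (m d : X -> nat) :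
  pt D (fun x => Bin (m x)) -> pt D (fun x => Bin (d x)) -> (forall x, D x -> 0 < d x) ->
  pt D (fun x => Bin (gcdn (m x) (d x))).
Proof.
move=> pm pd dpos.
(* Reducing modulo the second number first makes the first component the smaller one, as the halving
   of the product requires. *)
pose F (p : bin * bin) := iter (size (bits_msb (unbin p.1 %% unbin p.2)) + size (bits_msb (unbin p.2)))
  euclid_step (Bin (unbin p.1 %% unbin p.2), p.2).
have pF : pt (fun p : bin * bin => 0 < unbin p.2) F.
  have pmod : pt (fun p : bin * bin => 0 < unbin p.2) (fun p => Bin (unbin p.1 %% unbin p.2)).
    by apply: pt_bmod => //; [exact/pt_unbin/pt_fst/pt_id|exact/pt_unbin/pt_snd/pt_id].
  apply: (@pt_iter _ _ _ _ _ (fun p : bin * bin => size (bits_msb (unbin p.1 %% unbin p.2)) + size (bits_msb (unbin p.2)))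
    (fun p => euclid_step) (fun p => (Bin (unbin p.1 %% unbin p.2), p.2)) (fun N => 10 * N + 10)).
  - apply: pt_addn; apply/pt_size_seq/pt_bits_msb => //; exact/pt_unbin/pt_snd/pt_id.
  - by apply: pt_pair => //; apply/pt_snd/pt_id.
  - apply: (@pt_sub _ _ _ _ _ (fun _ => True)) => //.
    have q1 D' : pt D' (fun y : bin * bin * (bin * bin) => Bin (unbin y.2.1)) by apply/pt_unbin/pt_fst/pt_snd/pt_id.
    have q2 D' : pt D' (fun y : bin * bin * (bin * bin) => Bin (unbin y.2.2)) by apply/pt_unbin/pt_snd/pt_snd/pt_id.
    apply: pt_if; last exact/pt_snd/pt_id.
      by apply: pt_bleq => //; apply: pt_const.
    by apply: pt_pair; [apply: pt_bmod => // x []|exact/pt_fst/pt_snd/pt_id].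
  - by growth.
  move=> [[a] [b]] /= b0 i _; have [_ h _] := euclid_gcd i (Bin (a %% b), Bin b).
  move: h; case: (iter _ _ _) => [[u] [v]] /=; rewrite geq_max (maxn_idPr (ltnW (ltn_pmod a b0))) => /andP[h1 h2].
  have := esize_bin_le (leq_ltn_trans h1 (bin_lt_exp b)).
  have := esize_bin_le (leq_ltn_trans h2 (bin_lt_exp b)).
  by rewrite !esize_pair; lia.
apply: (@pt_eq _ _ _ _ _ (fun x => (F (Bin (m x), Bin (d x))).2)); last first.
  by apply/pt_snd/(pt_comp pF (pt_pair pm pd)) => x /dpos.
move=> x /dpos d0; rewrite /F /=; set st := (_, _); set k := _ + _.
have [h1 _ h3] := euclid_gcd k st.
have e0 : unbin (iter k euclid_step st).1 = 0.
  apply: (h3 k) => //=; first exact: ltn_pmod.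
  have := lt_exp_size_bits (m x %% d x); have := lt_exp_size_bits (d x); rewrite expnD.
  by move: (2 ^ _) (2 ^ _) => u v hu hv; apply: leq_ltn_trans (_ : _ <= u.-1 * v) _; nia.
move: h1; rewrite e0 gcd0n /= gcdn_modl => <-; by case: (_.2).
Qed.

Import Order.TTheory GRing.Theory Num.Theory.
Local Open Scope ring_scope.

(** * Integers and rationals *)

#[export] Instance enc_integer : enc int := {| encode := enc_int |}.
#[export] Instance enc_rational : enc rat := {| encode := enc_rat |}.

Lemma enc_nat_inj : injective enc_nat.
Proof.
move=> m n; rewrite -{2}[m]bin_of_natK -{2}[n]bin_of_natK /enc_nat.
case: (bin_of_nat m) (bin_of_nat n) => [|p] [|q] //= [].
rewrite !enc_pos_bits => e; have {e} := @encode_inj _ _ (enc_inj_list enc_inj_bool) _ _ e.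
by elim: p q => [p IH|p IH|] [q|q|] //= [] /IH; rewrite ?NatTrec.doubleE => ->.
Qed.

#[export] Instance enc_inj_int : enc_inj int.
Proof.
move=> y z e0; have [s0 /enc_nat_inj e] : DCons (enc_bool (y < 0)%R) (enc_nat `|y|%N) = DCons (enc_bool (z < 0)%R) (enc_nat `|z|%N) := e0.
have s := @encode_inj _ _ enc_inj_bool _ _ s0.
by move: s e; case: ltP; case: ltP; lia.
Qed.

#[export] Instance enc_inj_rat : enc_inj rat.
Proof.
move=> x y e; have [s1 n1 /enc_nat_inj ed] : DCons (enc_int (numq x)) (enc_nat `|denq x|) = DCons (enc_int (numq y)) (enc_nat `|denq y|) := e.
have en : numq x = numq y by apply: (@encode_inj _ _ enc_inj_int); rewrite /= /enc_int s1 n1.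
rewrite -[x]divq_num_den -[y]divq_num_den en; congr (_ / _%:~R)%R.
by rewrite -[denq x]absz_denq -[denq y]absz_denq ed.
Qed.

(** A rational is encoded in lowest terms, so every arithmetic operation must normalise its result;
    this expresses normalisation by a gcd, which is computable on binary numbers. *)
Lemma numden_frac (z : int) (d : nat) : (0 < d)%N ->
  let g := gcdn `|z| d in
  numq (z%:~R / d%:R) = (if z < 0 then - (`|z| %/ g)%:Z else (`|z| %/ g)%:Z)
  /\ `|denq (z%:~R / d%:R)|%N = (d %/ g)%N.
Proof.
move=> d0 g; have g0 : (0 < g)%N by rewrite gcdn_gt0 d0 orbT.
set z' : int := if z < 0 then - (`|z| %/ g)%:Z else (`|z| %/ g)%:Z.
have ez : z = z' * g%:Z.
  have e : (`|z| = `|z| %/ g * g)%N by rewrite divnK // dvdn_gcdl.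
  rewrite {1}[z]intEsign {1}e PoszM mulrA /z'; congr (_ * _).
  by case: ltP; rewrite ?expr0 ?expr1 ?mul1r ?mulN1r.
have ed : d = (d %/ g * g)%N by rewrite divnK // dvdn_gcdr.
have d'0 : (0 < d %/ g)%N by rewrite divn_gt0 // dvdn_leq // dvdn_gcdr.
have -> : (z%:~R / d%:R : rat) = z'%:~R / (d %/ g)%:Z%:~R.
  rewrite {1}ez {1}ed natrM intrM /=.
  have gn : g%:R != 0 :> rat by rewrite pnatr_eq0 -lt0n.
  have dn : (d %/ g)%:R != 0 :> rat by rewrite pnatr_eq0 -lt0n.
  by rewrite -!pmulrn -mulf_div divff // mulr1.
have cop : coprime `|z'| `|(d %/ g)%:Z|.
  have -> : `|z'|%N = (`|z| %/ g)%N by rewrite /z'; case: ifP; rewrite ?abszN absz_nat.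
  rewrite absz_nat /coprime -(eqn_pmul2r g0) muln_gcdl !divnK ?dvdn_gcdl ?dvdn_gcdr //.
  by rewrite mul1n.
rewrite coprimeq_num // coprimeq_den //.
have sg : Num.sg (d %/ g)%N%:Z = 1 by rewrite gtr0_sg.
by rewrite sg mul1r; split=> //; case: ifP => // /eqP; lia.
Qed.

Section Numbers.
Context {X : Type} {EX : enc X}.
Implicit Types D : X -> Prop.

Lemma pt_absz D (z : X -> int) : pt D z -> pt D (fun x => Bin `|z x|).
Proof.
move=> pz; apply: (@pt_enc _ _ _ _ _ _ _ (fun x => dtail (encode (z x)))) => //.
exact/pt_dtail/pt_encode.
Qed.

Lemma pt_int_lt0 D (z : X -> int) : pt D z -> pt D (fun x => z x < 0).
Proof.
move=> pz; apply: (@pt_enc _ _ _ _ _ _ _ (fun x => dhead (encode (z x)))) => //.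
exact/pt_dhead/pt_encode.
Qed.

Lemma pt_signed D (s : X -> bool) (n : X -> nat) : pt D s -> pt D (fun x => Bin (n x)) ->
  pt D (fun x => if s x then - (n x)%:Z else (n x)%:Z).
Proof.
(* The sign bit is masked for 0, whose encoding carries a nonnegative sign. *)
move=> ps pn; apply: (@pt_enc _ _ _ _ _ _ _ (fun x =>
   DCons (encode (s x && (1 <= n x)%N)) (encode (Bin (n x))))).
  move=> x _ /=; rewrite /enc_int; case: (s x) => //=; rewrite abszN absz_nat oppr_lt0.
  by case: (n x).
apply: pt_dcons; apply: pt_encode => //; apply: pt_andb => //.
by apply: pt_bleq => //; apply: pt_const.
Qed.

Lemma pt_nat_int D (n : X -> nat) : pt D (fun x => Bin (n x)) -> pt D (fun x => (n x)%:Z).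
Proof. by move=> pn; apply: (pt_signed (pt_const D false) pn). Qed.

Lemma pt_opp_int D (z : X -> int) : pt D z -> pt D (fun x => - z x).
Proof.
move=> pz; apply: (@pt_eq _ _ _ _ _ (fun x => if ~~ (z x < 0) then - (`|z x|%N)%:Z else (`|z x|%N)%:Z)).
  by move=> x _; case: ifP; lia.
by apply: pt_signed; [apply/pt_negb/pt_int_lt0|apply: pt_absz].
Qed.

Lemma pt_add_int D (y z : X -> int) : pt D y -> pt D z -> pt D (fun x => y x + z x).
Proof.
move=> py pz.
apply: (@pt_eq _ _ _ _ _ (fun x => if (y x < 0) == (z x < 0) then
   (if y x < 0 then - (`|y x| + `|z x|)%N%:Z else (`|y x| + `|z x|)%N%:Z)
   else if (`|z x| <= `|y x|)%N then (if y x < 0 then - (`|y x| - `|z x|)%N%:Z else (`|y x| - `|z x|)%N%:Z)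
   else (if z x < 0 then - (`|z x| - `|y x|)%N%:Z else (`|z x| - `|y x|)%N%:Z))).
  by move=> x _; repeat case: ifP; lia.
have p1 := pt_int_lt0 py; have p2 := pt_int_lt0 pz; have p3 := pt_absz py; have p4 := pt_absz pz.
apply: pt_ite; first exact: pt_eqop.
  by apply: pt_signed => //; apply: pt_badd.
by apply: pt_ite; [apply: pt_bleq|apply: pt_signed => //; apply: pt_bsub|apply: pt_signed => //; apply: pt_bsub].
Qed.

Lemma pt_mul_int D (y z : X -> int) : pt D y -> pt D z -> pt D (fun x => y x * z x).
Proof.
move=> py pz.
apply: (@pt_eq _ _ _ _ _ (fun x => if ~~ ((y x < 0) == (z x < 0)) then - (`|y x| * `|z x|)%N%:Z
   else (`|y x| * `|z x|)%N%:Z)).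
  move=> x _; rewrite PoszM {1}[y x]intEsign {1}[z x]intEsign mulrACA -signr_addb.
  by case: (y x < 0) => //=; case: (z x < 0) => //=; rewrite ?expr0 ?expr1 ?mul1r ?mulN1r.
by apply: pt_signed; [apply/pt_negb/pt_eqop; apply: pt_int_lt0|apply: pt_bmul; apply: pt_absz].
Qed.

Lemma pt_numq D (a : X -> rat) : pt D a -> pt D (fun x => numq (a x)).
Proof.
move=> pz; apply: (@pt_enc _ _ _ _ _ _ _ (fun x => dhead (encode (a x)))) => //.
exact/pt_dhead/pt_encode.
Qed.

Lemma pt_denq D (a : X -> rat) : pt D a -> pt D (fun x => Bin `|denq (a x)|).
Proof.
move=> pz; apply: (@pt_enc _ _ _ _ _ _ _ (fun x => dtail (encode (a x)))) => //.
exact/pt_dtail/pt_encode.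
Qed.

Lemma pt_frac D (z : X -> int) (d : X -> nat) : pt D z -> pt D (fun x => Bin (d x)) ->
  (forall x, D x -> 0 < d x)%N -> pt D (fun x => (z x)%:~R / (d x)%:R : rat).
Proof.
move=> pz pd d0; pose g x := gcdn `|z x| (d x).
have pg : pt D (fun x => Bin (g x)) by apply: pt_bgcd => //; apply: pt_absz.
have g0 x : D x -> (0 < g x)%N by move=> /d0 h; rewrite gcdn_gt0 h orbT.
apply: (@pt_enc _ _ _ _ _ _ _ (fun x => DCons
   (encode (if z x < 0 then - (`|z x| %/ g x)%N%:Z else (`|z x| %/ g x)%N%:Z))
   (encode (Bin (d x %/ g x))))).
  by move=> x /d0 h; have [h1 h2] := numden_frac (z x) h; rewrite /= /enc_rat h1 h2.
apply: pt_dcons; apply: pt_encode; last exact: pt_bdiv.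
by apply: pt_signed; [exact: pt_int_lt0|apply: pt_bdiv => //; apply: pt_absz].
Qed.

Lemma pt_denq_int D (a : X -> rat) : pt D a -> pt D (fun x => denq (a x)).
Proof.
move=> pa; apply: (@pt_eq _ _ _ _ _ (fun x => (`|denq (a x)|%N)%:Z)).
  by move=> x _; rewrite absz_denq.
exact/pt_nat_int/pt_denq.
Qed.

Lemma denq_gt0N (a : rat) : (0 < `|denq a|)%N.
Proof. by rewrite absz_gt0 denq_neq0. Qed.

Lemma pt_addr D (a b : X -> rat) : pt D a -> pt D b -> pt D (fun x => a x + b x).
Proof.
move=> pa pb; apply: (@pt_eq _ _ _ _ _ (fun x =>
   (numq (a x) * denq (b x) + numq (b x) * denq (a x))%:~R / (`|denq (a x)| * `|denq (b x)|)%N%:R)).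
  move=> x _; rewrite -{1}[a x]divq_num_den -{1}[b x]divq_num_den natrM !pmulrn !absz_denq rmorphD !rmorphM /=.
  by field; rewrite !intr_eq0 !denq_neq0.
apply: pt_frac; last by move=> x _; rewrite muln_gt0 !denq_gt0N.
  apply: pt_add_int; apply: pt_mul_int.
  - exact: pt_numq.
  - exact: pt_denq_int.
  - exact: pt_numq.
  - exact: pt_denq_int.
by apply: pt_bmul; apply: pt_denq.
Qed.

Lemma pt_mulr D (a b : X -> rat) : pt D a -> pt D b -> pt D (fun x => a x * b x).
Proof.
move=> pa pb; apply: (@pt_eq _ _ _ _ _ (fun x =>
   (numq (a x) * numq (b x))%:~R / (`|denq (a x)| * `|denq (b x)|)%N%:R)).
  move=> x _; rewrite -{1}[a x]divq_num_den -{1}[b x]divq_num_den natrM !pmulrn !absz_denq !rmorphM /=.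
  by field; rewrite !intr_eq0 !denq_neq0.
apply: pt_frac; last by move=> x _; rewrite muln_gt0 !denq_gt0N.
  by apply: pt_mul_int; apply: pt_numq.
by apply: pt_bmul; apply: pt_denq.
Qed.

Lemma pt_oppr D (a : X -> rat) : pt D a -> pt D (fun x => - a x).
Proof.
move=> pa; apply: (@pt_eq _ _ _ _ _ (fun x => a x * (-1))).
  by move=> x _; rewrite mulrN1.
by apply: pt_mulr => //; apply: pt_const.
Qed.

Lemma pt_subr D (a b : X -> rat) : pt D a -> pt D b -> pt D (fun x => a x - b x).
Proof. by move=> pa pb; apply: pt_addr => //; apply: pt_oppr. Qed.

Lemma pt_ltr D (a b : X -> rat) : pt D a -> pt D b -> pt D (fun x => a x < b x).
Proof.
move=> pa pb; apply: (@pt_eq _ _ _ _ _ (fun x => numq (a x - b x) < 0)).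
  by move=> x _; rewrite numq_lt0 subr_lt0.
exact/pt_int_lt0/pt_numq/pt_subr.
Qed.

Lemma pt_ler D (a b : X -> rat) : pt D a -> pt D b -> pt D (fun x => a x <= b x).
Proof.
move=> pa pb; apply: (@pt_eq _ _ _ _ _ (fun x => ~~ (b x < a x))).
  by move=> x _; rewrite leNgt.
exact/pt_negb/pt_ltr.
Qed.

Lemma pt_int_rat D (z : X -> int) : pt D z -> pt D (fun x => (z x)%:~R : rat).
Proof.
move=> pz; apply: (@pt_eq _ _ _ _ _ (fun x => (z x)%:~R / 1%N%:R)).
  by move=> x _; rewrite divr1.
by apply: pt_frac => //; apply: pt_const.
Qed.

Lemma pt_invr D (a : X -> rat) : pt D a -> pt D (fun x => (a x)^-1).
Proof.
move=> pa; apply: (@pt_eq _ _ _ _ _ (fun x => if a x == 0 then 0 else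
   (if numq (a x) < 0 then - `|denq (a x)|%N%:Z else `|denq (a x)|%N%:Z)%:~R / `|numq (a x)|%N%:R)).
  move=> x _; case: eqP => [->|/eqP nz]; first by rewrite invr0.
  rewrite -{1}[a x]divq_num_den invf_div absz_denq.
  have : numq (a x) != 0 by rewrite numq_eq0.
  case: ltP => h nz'; rewrite pmulrn.
    by rewrite ltz0_abs // !rmorphN invrN mulrNN.
  by rewrite gez0_abs.
apply: pt_if; [by apply: pt_eqop => //; apply: pt_const|exact: pt_const|].
have pa' : pt (fun x => D x /\ a x != 0) a by apply: pt_sub pa => x [].
apply: pt_frac; last by move=> x [_]; rewrite absz_gt0 numq_eq0.
  by apply: pt_signed; [exact/pt_int_lt0/pt_numq|exact: pt_denq].
exact/pt_absz/pt_numq.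
Qed.

End Numbers.

Lemma esize_rat_frac (z : int) (d k : nat) : (0 < d)%N -> (`|z| < 2 ^ k)%N -> (d < 2 ^ k)%N ->
  (esize (z%:~R / d%:R : rat) <= 8 * k + 11)%N.
Proof.
move=> d0 hz hd; have [h1 h2] := numden_frac z d0.
set a : rat := _ / _ in h1 h2 *; set g := gcdn _ _ in h1 h2.
have -> : esize a = (dsize (enc_bool (numq a < 0)) + esize (Bin `|numq a|)).+1.+1 + esize (Bin `|denq a|).
  by rewrite /esize /=; lia.
rewrite h2 h1.
have -> : `|(if (z < 0)%R then - (`|z| %/ g)%N%:Z else (`|z| %/ g)%N%:Z)%R|%N = (`|z| %/ g)%N.
  by case: ifP; rewrite ?abszN absz_nat.
have := esize_bin_le (leq_ltn_trans (leq_div `|z| g) hz).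
have := esize_bin_le (leq_ltn_trans (leq_div d g) hd).
by case: (_ < 0); rewrite /=; lia.
Qed.

Lemma rat_lt_exp (a : rat) : (`|numq a| < 2 ^ esize a)%N /\ (`|denq a| < 2 ^ esize a)%N.
Proof.
have e : esize a = (dsize (enc_bool (numq a < 0)) + esize (Bin `|numq a|)).+1.+1 + esize (Bin `|denq a|).
  by rewrite /esize /=; lia.
by split; apply: leq_trans (bin_lt_exp _) _; rewrite leq_exp2l // e; lia.
Qed.

(** Iterating the bound for one addition would compound it. With the product of all denominators as
    common denominator, every partial sum has size linear in that of the list. *)
Lemma sum_rat_frac (s : seq rat) : exists z d, [/\ \sum_(a <- s) a = z%:~R / d%:R, (0 < d)%N,
  (d < 2 ^ esize s)%N & (`|z| <= size s * 2 ^ esize s)%N].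
Proof.
elim: s => [|a s [z [d [e d0 hd hz]]]]; first by exists 0, 1%N; rewrite big_nil mul0r.
have [h1 h2] := rat_lt_exp a; have p := denq_gt0N a.
exists (numq a * d%:Z + z * denq a), (`|denq a| * d)%N; split.
- rewrite big_cons e -{1}[a]divq_num_den rmorphD !rmorphM ?natrM /= !pmulrn absz_denq.
  by rewrite addf_div ?intr_eq0 ?denq_neq0 //; lia.
- by rewrite muln_gt0 p.
- rewrite esize_cons expnS expnD; move: h2 hd p d0; move: (2 ^ _)%N (2 ^ _)%N `|denq a|%N => u v w; nia.
rewrite esize_cons expnS expnD /=.
apply: leq_trans (_ : `|numq a| * d + `|z| * `|denq a| <= _)%N; first by lia.
have i1 : (`|numq a| * d <= 2 ^ esize a * 2 ^ esize s)%N by rewrite leq_mul // ltnW.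
have i2 : (`|z| * `|denq a| <= size s * 2 ^ esize s * 2 ^ esize a)%N by rewrite leq_mul // ltnW.
move: i1 i2; move: (2 ^ esize a)%N (2 ^ esize s)%N => u v; nia.
Qed.

Lemma esize_sum_rat (s : seq rat) : (esize (\sum_(a <- s) a)%R <= 16 * esize s + 11)%N.
Proof.
have [z [d [-> d0 hd hz]]] := sum_rat_frac s.
apply: leq_trans (esize_rat_frac (k := 2 * esize s) d0 _ _) _.
- apply: leq_ltn_trans hz _; rewrite mul2n -addnn expnD ltn_mul2r expn_gt0 /=.
  apply: ltn_trans (ltn_expl _ (isT : 1 < 2)%N); exact: size_le_esize.
- by apply: ltn_trans hd _; rewrite ltn_exp2l //; generalize (esize_gt0 s); lia.
lia.
Qed.

Lemma esize_prefix {A} {EA : enc A} (s1 s2 : seq A) : (esize s1 <= esize (s1 ++ s2))%N.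
Proof. by generalize (esize_cat s1 s2); generalize (esize_gt0 s2); lia. Qed.

Section Sums.
Context {X : Type} {EX : enc X}.
Implicit Types D : X -> Prop.

Lemma pt_sum_seq D (s : X -> seq rat) : pt D s -> pt D (fun x => \sum_(a <- s x) a).
Proof.
move=> ps; have E (l : seq rat) : foldl (fun acc a => acc + a) 0 l = \sum_(a <- l) a.
  by elim/last_ind: l => [|l a IH]; rewrite ?big_nil // foldl_rcons IH big_rcons.
apply: (@pt_eq _ _ _ _ _ (fun x => foldl (fun acc a => acc + a) 0 (s x))) => [x _|]; first by rewrite E.
have [k hk] := pt_size ps.
apply: (@pt_foldl_free _ _ _ _ _ _ _ (fun x acc a => acc + a) (fun=> 0) s (fun n => 16 * (n + 2) ^ k + 11)%N) => //.
- exact: pt_const.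
- by apply: pt_addr; [apply/pt_snd/pt_fst/pt_id|apply/pt_snd/pt_id].
- by growth.
move=> x Dx s1 s2 es; rewrite E; apply: leq_trans (esize_sum_rat _) _.
rewrite leq_add2r leq_mul2l /=; apply: leq_trans (hk x Dx); rewrite es.
exact: esize_prefix.
Qed.

Lemma pt_mkseq {A} {EA : enc A} D (f : X -> nat -> A) (n : X -> nat) :
  pt D n -> pt (fun y : X * nat => D y.1) (fun y => f y.1 y.2) -> pt D (fun x => mkseq (f x) (n x)).
Proof. by move=> pn pf; apply: pt_map_free => //; apply: pt_iota0. Qed.

Lemma pt_sum D (f : X -> nat -> rat) (n : X -> nat) :
  pt D n -> pt (fun y : X * nat => D y.1) (fun y => f y.1 y.2) -> pt D (fun x => \sum_(0 <= i < n x) f x i).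
Proof.
move=> pn pf; apply: (@pt_eq _ _ _ _ _ (fun x => \sum_(a <- mkseq (f x) (n x)) a)).
  by move=> x _; rewrite big_map /index_iota subn0.
exact/pt_sum_seq/pt_mkseq.
Qed.

Lemma pt_natr D (n : X -> nat) : pt D n -> pt D (fun x => (n x)%:R : rat).
Proof.
move=> pn; apply: (@pt_eq _ _ _ _ _ (fun x => \sum_(0 <= i < n x) 1)).
  by move=> x _; rewrite sumr_const_nat subn0.
by apply: pt_sum => //; apply: pt_const.
Qed.

Lemma pt_half_exp D (n : X -> nat) : pt D n -> pt D (fun x => 2^-1 ^+ n x : rat).
Proof.
move=> pn; have E m : iter m (fun a : rat => a * 2^-1) 1 = 2^-1 ^+ m.
  by elim: m => //= m ->; rewrite exprSr.
apply: (@pt_eq _ _ _ _ _ (fun x => iter (n x) (fun a : rat => a * 2^-1) 1)) => [x _|]; first by rewrite E.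
have [k hk] := pt_size pn.
apply: (@pt_iter _ _ _ _ _ n (fun x (a : rat) => a * 2^-1) (fun=> 1) (fun m => 8 * ((m + 2) ^ k).+1 + 11)%N) => //.
- exact: pt_const.
- by apply: pt_mulr; [apply/pt_snd/pt_id|apply: pt_const].
- by growth.
move=> x Dx i hi; rewrite E.
have -> : 2^-1 ^+ i = 1%:~R / (2 ^ i)%N%:R :> rat by rewrite natrX mul1r exprVn.
apply: leq_trans (esize_rat_frac (k := i.+1) _ _ _) _; first by rewrite expn_gt0.
- by rewrite -[`|1%R|%N]/(2 ^ 0)%N ltn_exp2l.
- by rewrite ltn_exp2l.
rewrite leq_add2r leq_mul2l /= ltnS; apply: leq_trans hi _; apply: leq_trans (hk x Dx).
by rewrite esize_nat; lia.
Qed.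

End Sums.

Ltac pt_user := fail.

Ltac pt1 := cbv beta; lazymatch goal with
  | |- pt _ (fun _ => ?c) => apply: pt_const
  | |- pt _ (fun x => x) => apply: pt_id
  | |- pt _ (fun x => (@?f x).1) => apply: pt_fst
  | |- pt _ (@fst _ _) => apply: (pt_fst (pt_id _))
  | |- pt _ (@snd _ _) => apply: (pt_snd (pt_id _))
  | |- pt _ (fun x => (@?f x).2) => apply: pt_snd
  | |- pt _ (fun x => (@?f x, @?g x)) => apply: pt_pair
  | |- pt _ (fun x => @?f x :: @?g x) => apply: pt_cons
  | |- pt _ (fun x => @?f x ++ @?g x) => apply: pt_cat
  | |- pt _ (fun x => ~~ @?f x) => apply: pt_negb
  | |- pt _ (fun x => @?f x && @?g x) => apply: pt_andb
  | |- pt _ (fun x => @?f x || @?g x) => apply: pt_orb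
  | |- pt _ (fun x => Some (@?f x)) => apply: pt_some
  | |- pt _ (fun x => nth _ (@?f x) (@?g x)) => apply: pt_nth
  | |- pt _ (fun x => head _ (@?f x)) => apply: pt_head
  | |- pt _ (fun x => size (@?f x)) => apply: pt_size_seq
  | |- pt _ (fun x => rev (@?f x)) => apply: pt_rev
  | |- pt _ (fun x => flatten (@?f x)) => apply: pt_flatten
  | |- pt _ (fun x => iota 0 (@?f x)) => apply: pt_iota0
  | |- pt _ (fun x => nseq (@?f x) tt) => apply: pt_nseq
  | |- pt _ (fun x => sumn (@?f x)) => apply: pt_sumn
  | |- pt _ (fun x => mkseq (@?f x) (@?g x)) => apply: pt_mkseq
  | |- pt _ (fun x => map (@?f x) (@?g x)) => apply: pt_map_free
  | |- pt _ (fun x => filter (@?f x) (@?g x)) => apply: pt_filter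
  | |- pt _ (fun x => has (@?f x) (@?g x)) => apply: pt_has
  | |- pt _ (fun x => all (@?f x) (@?g x)) => apply: pt_all
  | |- pt _ (fun x => (@?f x).+1) => apply: pt_succ
  | |- pt _ (fun x => ((@?f x) + (@?g x))%N) => apply: pt_addn
  | |- pt _ (fun x => ((@?f x) * (@?g x))%N) => apply: pt_muln
  | |- pt _ (fun x => ((@?f x) <= (@?g x))%N) => apply: pt_leq
  | |- pt _ (fun x => (@?f x) == (@?g x)) => apply: pt_eqop
  | |- pt _ (fun x => (@?f x) \in (@?g x)) => apply: pt_mem
  | |- pt _ (fun x => (2^-1 ^+ (@?f x))%R) => apply: pt_half_exp
  | |- pt _ (fun x => ((@?f x) + (@?g x) )%R) => first [apply: pt_addr | apply: pt_add_int]
  | |- pt _ (fun x => ((@?f x) * (@?g x) )%R) => first [apply: pt_mulr | apply: pt_mul_int]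
  | |- pt _ (fun x => (- (@?f x) )%R) => first [apply: pt_oppr | apply: pt_opp_int]
  | |- pt _ (fun x => ((@?f x)^-1 )%R) => apply: pt_invr
  | |- pt _ (fun x => ((@?f x) < (@?g x) )%R) => apply: pt_ltr
  | |- pt _ (fun x => ((@?f x) <= (@?g x) )%R) => apply: pt_ler
  | |- pt _ (fun x => ((@?f x)%:R )%R) => apply: pt_natr
  | |- pt _ (fun x => ((@?f x)%:~R )%R) => apply: pt_int_rat
  | |- pt _ (fun x => numq (@?f x)) => apply: pt_numq
  | |- pt _ (fun x => denq (@?f x)) => apply: pt_denq_int
  | |- _ => first [pt_user | apply: pt_sum | apply: pt_ite]
  end.
Ltac pt_auto := repeat (first [assumption | pt1]).

(** * Projection onto a kernel *)

Section Projection.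
Variables (K : realFieldType) (N : nat).
Implicit Types (rows : seq 'rV[K]_N) (P Q : 'M[K]_N).

(* [P] is the orthogonal projection onto the common kernel of the rows. *)
Definition kernel_proj rows P :=
  [/\ forall r, r \in rows -> r *m P = 0, P^T = P
    & forall k (B : 'M[K]_(N, k)), (forall r, r \in rows -> r *m B = 0) -> P *m B = B].

Lemma kernel_proj_idem rows P : kernel_proj rows P -> P *m P = P.
Proof. by case=> h1 _ h3; apply: h3. Qed.

(** Each projection fixes the columns of the other, and transposing one of the two equations gives
    equality. Uniqueness carries the size bound of the explicit determinant formula over to the
    projection computed row by row. *)
Lemma kernel_proj_uniq rows P Q : kernel_proj rows P -> kernel_proj rows Q -> P = Q.
Proof.
move=> [p1 p2 p3] [q1 q2 q3].
by rewrite -p2 -(q3 _ _ p1) trmx_mul p2 q2 (p3 _ _ q1).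
Qed.

Lemma kernel_proj_scale rows P (c : K) : c != 0 -> kernel_proj rows P -> kernel_proj [seq c *: r | r <- rows] P.
Proof.
move=> c0 [p1 p2 p3]; split=> // [_ /mapP[r rin ->]|k B h].
  by rewrite -scalemxAl p1 ?scaler0.
apply: p3 => r rin; have /eqP := h _ (map_f _ rin).
by rewrite -scalemxAl scaler_eq0 (negPf c0) /= => /eqP.
Qed.

Lemma kernel_proj_nil : kernel_proj [::] 1%:M.
Proof. by split=> //; [rewrite trmx1|move=> k B _; rewrite mul1mx]. Qed.

Lemma sqr_eq0_row k (u : 'rV[K]_k) : (u *m u^T) 0 0 = 0 -> u = 0.
Proof.
rewrite mxE => /eqP; rewrite psumr_eq0 => [/allP h|i _]; last by rewrite mxE -expr2 sqr_ge0.
apply/rowP => i; have := h i (mem_index_enum i); rewrite !mxE -expr2 sqrf_eq0.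
by move/eqP.
Qed.

(** One Gram-Schmidt step: the rank-one part along [P *m a^T] is removed. Since [s] is the squared
    length of that vector, [s == 0] means that [a] depends on the earlier rows. *)
Definition project_mx P (a : 'rV[K]_N) : 'M[K]_N :=
  let u := P *m a^T in let s := (a *m u) 0 0 in
  if s == 0 then P else P - s^-1 *: (u *m u^T).

Lemma project_mxP rows P a : kernel_proj rows P -> kernel_proj (rcons rows a) (project_mx P a).
Proof.
move=> kP; have idem := kernel_proj_idem kP; case: kP => p1 p2 p3.
have aP : a *m P = (P *m a^T)^T by rewrite trmx_mul trmxK p2.
rewrite /project_mx; case: eqP => s0.
  have u0 : a *m P = 0.
    apply: sqr_eq0_row; rewrite -s0 trmx_mul p2 -mulmxA (mulmxA P) idem.
    by [].
  split=> // [r|k B h]; first by rewrite mem_rcons inE => /orP[/eqP->|/p1].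
  by apply: p3 => r rin; apply: h; rewrite mem_rcons inE rin orbT.
set u := P *m a^T; set s := (a *m u) 0 0.
have as_ : a *m u = s%:M by rewrite [LHS]mx11_scalar.
have sn : s != 0 by apply/eqP.
split=> [r||k B h].
- rewrite mem_rcons inE mulmxBr -scalemxAr mulmxA => /orP[/eqP->|rin].
    by rewrite as_ mul_scalar_mx scalerA mulVf // scale1r aP subrr.
  by rewrite mulmxA p1 // !mul0mx scaler0 subr0.
- by rewrite linearB linearZ /= trmx_mul trmxK p2.
have PB : P *m B = B by apply: p3 => r rin; apply: h; rewrite mem_rcons inE rin orbT.
rewrite mulmxBl PB -scalemxAl -mulmxA -aP -(mulmxA a) PB.
by rewrite h ?mem_rcons ?inE ?eqxx // mulmx0 scaler0 subr0.
Qed.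

(** For a symmetric idempotent, [P i i] is the sum of the squares of row [i]. So
    [P i i ^+ 2 <= P i i], which gives [P i i <= 1], and every entry of the row is then at most 1 in
    absolute value. *)
Lemma kernel_proj_le1 rows P i j : kernel_proj rows P -> `|P i j| <= 1.
Proof.
move=> kP; have idem := kernel_proj_idem kP; case: kP => _ sym _.
have symE a b : P a b = P b a by rewrite -{1}sym mxE.
have sq a b : P a b ^+ 2 <= P a a.
  rewrite -{2}idem mxE (bigD1 b) //= [P b a]symE -expr2 lerDl sumr_ge0 // => c _.
  by rewrite [P c a]symE -expr2 sqr_ge0.
have d1 : P i i <= 1 by have := sq i i; nra.
by rewrite ler_norml; have := sq i j; nra.
Qed.

Lemma kernel_proj_diag rows P i : kernel_proj rows P -> P i i = \sum_k P i k ^+ 2.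
Proof.
move=> kP; have idem := kernel_proj_idem kP; case: kP => _ sym _.
rewrite -{1}idem mxE; apply: eq_bigr => k _; rewrite expr2; congr (_ * _).
by rewrite -{1}sym mxE.
Qed.

(** Leibniz bound for a Gram determinant of order at most [N], whose entries are scalar products of
    [N] terms of size at most [a ^ 2]. *)
Definition minor_bound (a : nat) : nat := (N * (N * a ^ 2)).+1 ^ N.

Lemma det_int_bound r (M : 'M[int]_r) (c : nat) : (forall i j, `|M i j| <= c)%N ->
  (`|\det M| <= (r * c).+1 ^ r)%N.
Proof.
move=> h; apply: (@leq_trans (r`! * c ^ r)).
  have H : `|\det M| <= \sum_(s : {perm 'I_r}) (c ^ r)%N%:Z.
    apply: le_trans (ler_norm_sum _ _ _) (ler_sum _ _) => s _.
    rewrite normrM normrX normrN1 expr1n mul1r normr_prod.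
    have -> : ((c ^ r)%N%:Z) = \prod_(i < r) c%:Z by rewrite prodr_const card_ord -rmorphXn.
    by apply: ler_prod => i _; rewrite normr_ge0 /=; have := h i (s i); lia.
  by move: H; rewrite sumr_const card_Sn -natz -mulrnA natz -abszE lez_nat mulnC.
apply: (@leq_trans ((r * c) ^ r)); last by case: (r) => // r'; rewrite leq_exp2r.
rewrite expnMn leq_mul2r; apply/orP; right.
elim: (r) => // n IH; rewrite factS expnS leq_mul2l /=.
by apply: leq_trans IH _; case: (n) => // n'; rewrite leq_exp2r.
Qed.

(** For a maximal independent set [B] of rows the projection is [1 - B^T (B B^T)^-1 B], so by
    Cramer's rule the Gram determinant is a common denominator of its entries. *)
Lemma kernel_proj_int (rows : seq 'rV[int]_N) (a : nat) :
  (forall r j, r \in rows -> `|r ord0 j| <= a)%N ->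
  exists P (del : nat), [/\ kernel_proj [seq map_mx intr r | r <- rows] P,
    (0 < del <= minor_bound a)%N & forall i j, exists z : int, P i j * del%:R = z%:~R].
Proof.
move=> ha; pose m := size rows.
pose A : 'M[int]_(m, N) := \matrix_(i < m) nth 0 rows i.
pose AK : 'M[K]_(m, N) := map_mx intr A.
pose f := maxrankfun AK.
pose Bi : 'M[int]_(_, N) := rowsub f A.
pose B := map_mx intr Bi : 'M[K]_(_, N).
have BE : B = rowsub f AK by apply/matrixP => i j; rewrite !mxE.
have Bfree : row_free B by rewrite BE; apply: maxrowsub_free.
have Beq : (B :=: AK)%MS by rewrite BE; apply: eq_maxrowsub.
have [C AE] : exists C, AK = C *m B by apply/submxP; rewrite Beq.
pose G := B *m B^T; pose Gi := Bi *m Bi^T.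
have GE : G = map_mx intr Gi by rewrite /G /B map_mxM map_trmx.
(* [v G = 0] gives [|v B|^2 = 0], hence [v B = 0] since a sum of squares in [K] vanishes only
   trivially, hence [v = 0] as the rows of [B] are independent. *)
have Gunit : G \in unitmx.
  rewrite -row_free_unit -kermx_eq0; apply/eqP/row_matrixP => i; rewrite row0.
  set v := row i _; have : v *m G = 0 by rewrite /v -row_mul mulmx_ker row0.
  move=> vG; have : v *m B = 0.
    by apply: sqr_eq0_row; rewrite trmx_mul mulmxA -(mulmxA v) vG mul0mx mxE.
  by move/eqP; rewrite mulmx_free_eq0 // => /eqP.
have detE : \det G = (\det Gi)%:~R by rewrite GE det_map_mx.
have det0 : \det Gi != 0.
  by move: Gunit; rewrite unitmxE detE unitfE intr_eq0.
pose P : 'M[K]_N := 1%:M - B^T *m invmx G *m B.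
have BP : B *m P = 0 by rewrite /P mulmxBr mulmx1 !mulmxA mulmxV // mul1mx subrr.
have rowsA r : r \in [seq map_mx intr r | r <- rows] -> exists i, r = row i AK.
  move=> /mapP[r' r'in ->]; move: (r'in); rewrite -index_mem => lt.
  by exists (Ordinal lt); apply/rowP => j; rewrite !mxE /= nth_index.
exists P, `|\det Gi|%N; split.
- split.
  + by move=> r /rowsA [i ->]; rewrite -row_mul AE -mulmxA BP mulmx0 row0.
  + rewrite /P linearB /= trmx1 !trmx_mul trmxK trmx_inv mulmxA.
    by have -> : G^T = G by rewrite /G trmx_mul trmxK.
  move=> k M h; rewrite /P mulmxBl mul1mx -(mulmxA _ B M).
  suff -> : B *m M = 0 by rewrite mulmx0 subr0.
  apply/row_matrixP => i; rewrite row_mul row0.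
  have -> : row i B = map_mx intr (nth 0 rows (f i)).
    by apply/rowP => j; rewrite !mxE.
  by apply: h; apply/map_f/mem_nth.
- rewrite absz_gt0 det0 /=.
  have rN : (\rank AK <= N)%N by rewrite rank_leq_col.
  apply: leq_trans (det_int_bound (c := N * a ^ 2) _) _.
    move=> i j; rewrite mxE.
    have : `|\sum_k Bi i k * Bi^T k j| <= \sum_(k < N) (a ^ 2)%N%:Z.
      apply: le_trans (ler_norm_sum _ _ _) (ler_sum _ _) => k _; rewrite normrM.
      have le1 : (`|Bi i k| <= a)%N by rewrite !mxE; apply: ha; apply: mem_nth.
      have le2 : (`|Bi^T k j| <= a)%N by rewrite !mxE; apply: ha; apply: mem_nth.
      by move: le1 le2; nia.
    by rewrite sumr_const card_ord -natz -mulrnA natz -abszE lez_nat mulnC.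
  apply: (@leq_trans ((N * (N * a ^ 2)).+1 ^ \rank AK)); last by rewrite leq_pexp2l.
  case: (\rank AK) rN => // r' hr; rewrite leq_exp2r // ltnS leq_mul2r hr orbT //.
move=> i j; pose S := Num.sg (\det Gi).
pose Z : 'M[int]_N := (\det Gi)%:M - Bi^T *m \adj Gi *m Bi.
exists (S * Z i j).
have -> : (`|\det Gi|%N)%:R = (S * \det Gi)%:~R :> K.
  by rewrite pmulrn abszE normrEsg.
have -> : P i j * (S * \det Gi)%:~R = S%:~R * (P i j * \det G) by rewrite intrM detE mulrCA.
rewrite intrM; congr (_ * _).
have -> : P i j * \det G = (\det G *: P) i j by rewrite [RHS]mxE [RHS]mulrC.
have -> : \det G *: P = map_mx intr Z.
  rewrite /P scalerBr scalemxAl scalemxAr /invmx Gunit scalerA divff ?scale1r; last first.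
    by rewrite detE intr_eq0.
  rewrite /Z raddfB /= !map_mxM map_scalar_mx /= detE GE map_mx_adj map_trmx.
  by rewrite scalemx1.
by rewrite mxE.
Qed.

End Projection.

(** * Nonnegative solutions of homogeneous systems *)

Lemma mul_delta_col (K : realFieldType) N (i : 'I_N) (x : 'cV[K]_N) :
  (delta_mx 0 i : 'rV[K]_N) *m x = 0 -> x i 0 = 0.
Proof. by rewrite -rowE => /rowP /(_ 0); rewrite !mxE. Qed.

(** Caratheodory's argument: shrink the support of [x], keeping [x j 0] positive, until [x] is
    proportional to column [j] of the projection for that support, which is integral up to a bounded
    factor. It leads from a solution over any ordered field to a small integral one. *)
Lemma small_solution (K : realFieldType) N (rows : seq 'rV[int]_N) (a : nat) (x : 'cV[K]_N) (j : 'I_N) :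
  (forall r i, r \in rows -> `|r ord0 i| <= a)%N -> (forall i, 0 <= x i 0) ->
  (forall r, r \in rows -> map_mx intr r *m x = 0) -> 0 < x j 0 ->
  exists z : 'I_N -> nat, [/\ forall r, r \in rows -> \sum_i r 0 i * (z i)%:Z = 0, (0 < z j)%N
    & forall i, (z i <= minor_bound N a.+1)%N].
Proof.
move=> ha; have [n] := ubnP #|[set i | x i 0 != 0]|.
elim: n x => // n IH x hn x0 hx xj.
pose S := [set i | x i 0 != 0].
pose units := [seq delta_mx 0 i : 'rV[int]_N | i <- enum (~: S)].
have unitE i : map_mx intr (delta_mx 0 i : 'rV[int]_N) = delta_mx 0 i :> 'rV[K]_N.
  by apply/rowP => k; rewrite !mxE; case: (_ && _).
(* The successor accounts for the unit rows, which force the coordinates outside the support to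
   vanish, in case [a] is 0. *)
have ha' : forall r i, r \in rows ++ units -> (`|r ord0 i| <= a.+1)%N.
  move=> r i; rewrite mem_cat => /orP[/ha h|/mapP[i' _ ->]]; first exact: leqW.
  by rewrite mxE; case: (_ && _).
have [P [del [kP /andP[del0 delB] Pint]]] := @kernel_proj_int K N (rows ++ units) a.+1 ha'.
have Px : P *m x = x.
  case: kP => _ _ h3; apply: h3 => _ /mapP[r rin ->].
  move: rin; rewrite mem_cat => /orP[/hx //|/mapP[i]]; rewrite mem_enum !inE negbK => /eqP xi ->.
  by rewrite unitE -rowE; apply/rowP => k; rewrite !mxE !ord1 xi.
have Pjj : 0 < P j j.
  rewrite (kernel_proj_diag j kP) lt_neqAle sumr_ge0 ?andbT => [|k _]; last exact: sqr_ge0.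
  rewrite eq_sym psumr_eq0 => [|k _]; last exact: sqr_ge0.
  apply/negP => /allP h; move: xj; rewrite -Px mxE big1 ?ltxx // => k _.
  by have := h k (mem_index_enum k); rewrite /= sqrf_eq0 => /eqP ->; rewrite mul0r.
(* With this [c] the direction [y] vanishes at [j], so moving along it leaves [x j 0] unchanged. *)
pose c := P j j / x j 0; have c0 : 0 < c by rewrite divr_gt0.
pose y : 'cV[K]_N := col j P - c *: x.
have yj : y j 0 = 0 by rewrite !mxE /c divfK ?subrr // gt_eqF.
have kery r : r \in rows ++ units -> map_mx intr r *m y = 0.
  move=> rin; case: kP => h1 _ _; have hr := h1 _ (map_f _ rin).
  have rx : map_mx intr r *m x = 0.
    move: rin; rewrite mem_cat => /orP[/hx //|/mapP[i]]; rewrite mem_enum !inE negbK => /eqP xi ->.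
    by rewrite unitE -rowE; apply/rowP => k; rewrite !mxE !ord1 xi.
  by rewrite mulmxBr -scalemxAr rx scaler0 subr0 colE mulmxA hr mul0mx.
have ysupp i : x i 0 = 0 -> y i 0 = 0.
  move=> xi; have : delta_mx 0 i \in rows ++ units.
    by rewrite mem_cat map_f ?orbT // mem_enum !inE xi eqxx.
  by move/kery; rewrite unitE => /mul_delta_col.
have [y0|[w [wker wj wsupp [i0 wi0]]]] : y = 0 \/ exists w : 'cV[K]_N,
    [/\ forall r, r \in rows -> map_mx intr r *m w = 0, w j 0 = 0, forall i, x i 0 = 0 -> w i 0 = 0 & exists i, w i 0 < 0].
- case: (eqVneq y 0) => [|yn]; [by left|right].
  have [i yi] : exists i, y i 0 != 0.
    apply/existsP; apply: contraR yn; rewrite negb_exists => /forallP h.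
    by apply/eqP/colP => i; rewrite !mxE; have := h i; rewrite negbK => /eqP; rewrite !mxE.
  have ker' r : r \in rows -> map_mx intr r *m y = 0 by move=> rin; apply: kery; rewrite mem_cat rin.
  case: (ltgtP (y i 0) 0) yi => // yi _.
    by exists y; split=> //; exists i.
  exists (- y); split=> [r rin|||].
  + by rewrite mulmxN ker' ?oppr0.
  + by rewrite mxE yj oppr0.
  + by move=> k xk; rewrite mxE ysupp ?oppr0.
  + by exists i; rewrite mxE oppr_lt0.
- have colE i : P i j = c * x i 0.
    by move/colP: y0 => /(_ i); rewrite !mxE => /eqP; rewrite subr_eq0 => /eqP.
  have Pnat i : exists z : nat, P i j * del%:R = z%:R.
    have [z ez] := Pint i j.
    have : 0 <= z.
      rewrite -(ler0z K) -ez colE; apply: mulr_ge0 (ler0n _ _); exact: mulr_ge0 (ltW c0) (x0 i).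
    by case: z ez => // m ez _; exists m.
  have [z hz] := fin_all_exists Pnat; exists z.
  have zK r : r \in rows -> (\sum_i r 0 i * (z i)%:Z)%:~R = (0 : K).
    move=> rin; rewrite rmorph_sum /=.
    rewrite (eq_bigr (fun i => (c * del%:R) * (map_mx intr r 0 i * x i 0))).
      have /rowP /(_ 0) := hx r rin; rewrite -mulr_sumr !mxE => e.
      have -> : \sum_i map_mx intr r 0 i * x i 0 = 0 by [].
      by rewrite mulr0.
    by move=> i _; rewrite rmorphM /= -[X in _ * X]pmulrn -hz colE !mxE; ring.
  split.
  + by move=> r /zK /eqP; rewrite intr_eq0 => /eqP.
  + by rewrite lt0n -(eqr_nat K) -hz mulf_neq0 // ?gt_eqF // ltr0n.
  + move=> i; apply: leq_trans delB; rewrite -(ler_nat K) -hz ler_piMl ?ler0n //.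
    by apply: le_trans (ler_norm _) (kernel_proj_le1 _ _ kP).
(* Ratio test: the smallest quotient is the largest step along [w] that keeps all coordinates
   nonnegative, and it makes the coordinate [i1] vanish. *)
pose t i := x i 0 / (- w i 0).
pose i1 := [arg min_(i < i0 | w i 0 < 0) t i]%O.
have [wi1 ti1] : w i1 0 < 0 /\ forall i, w i 0 < 0 -> t i1 <= t i.
  by rewrite /i1; case: Order.TotalTheory.arg_minP => // i wi hi; split.
have t0 : 0 <= t i1 by rewrite divr_ge0 // oppr_ge0 ltW.
pose x' : 'cV[K]_N := x + t i1 *: w.
have x'E i : x' i 0 = x i 0 + t i1 * w i 0 by rewrite !mxE.
have x'i1 : x' i1 0 = 0 by rewrite x'E /t; field; rewrite lt_eqF.
apply: (IH x').
- rewrite ltnS in hn; apply: leq_trans hn; apply: proper_card; apply/properP; split.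
    apply/subsetP => i; rewrite !inE; apply: contraNneq => xi.
    by rewrite x'E xi wsupp // mulr0 addr0.
  exists i1; rewrite !inE ?x'i1 ?eqxx //.
  by apply/eqP => xi; move: wi1; rewrite wsupp ?ltxx.
- move=> i; rewrite x'E; case: (ltP (w i 0) 0) => wi.
    have := ti1 i wi; rewrite {2}/t ler_pdivlMr ?oppr_gt0 // mulrN; lra.
  by rewrite addr_ge0 // mulr_ge0.
- by move=> r rin; rewrite mulmxDr -scalemxAr wker // scaler0 addr0 hx.
- by rewrite x'E wj mulr0 addr0.
Qed.

(** * Perceptron updates and the contraction certificate *)

Section Perceptron.
Variables (N : nat) (rows : seq 'rV[rat]_N) (P : 'M[rat]_N).
Hypothesis kP : kernel_proj rows P.

(** [<Y, PY>] is the squared length of [PY]. Adding the unit vector at [i] changes it by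
    [2 (PY)_i + P_ii <= 1], which is the growth of the sum of the weights. *)
Lemma perceptron_step (Y Y' : 'cV[rat]_N) (i : 'I_N) : Y' = Y + delta_mx i 0 ->
  (Y^T *m (P *m Y)) 0 0 <= \sum_k Y k 0 -> (P *m Y) i 0 <= 0 ->
  (Y'^T *m (P *m Y')) 0 0 <= \sum_k Y' k 0.
Proof.
move=> Y'E hY Zi; have sym : P^T = P by case: kP.
have -> : \sum_k Y' k 0 = \sum_k Y k 0 + 1.
  rewrite Y'E -[1](_ : \sum_k (delta_mx i 0 : 'cV[rat]_N) k 0 = 1).
    by rewrite -big_split; apply: eq_bigr => k _; rewrite !mxE.
  by rewrite (bigD1 i) //= mxE !eqxx big1 ?addr0 // => k /negPf ki; rewrite mxE ki.
have d1 : (Y^T *m (P *m (delta_mx i 0 : 'cV[rat]_N))) 0 0 = (P *m Y) i 0.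
  have -> : P *m (delta_mx i 0 : 'cV[rat]_N) = ((delta_mx 0 i : 'rV[rat]_N) *m P)^T by rewrite trmx_mul sym trmx_delta.
  by rewrite -trmx_mul -mulmxA -rowE !mxE.
have d2 : ((delta_mx i 0 : 'cV[rat]_N)^T *m (P *m Y)) 0 0 = (P *m Y) i 0.
  by rewrite trmx_delta -rowE mxE.
have d3 : ((delta_mx i 0 : 'cV[rat]_N)^T *m (P *m (delta_mx i 0 : 'cV[rat]_N))) 0 0 = P i i.
  by rewrite trmx_delta -colE -rowE !mxE.
rewrite Y'E mulmxDr [(_ + _)^T]raddfD /= mulmxDl !mulmxDr.
rewrite [X in X <= _]mxE [X in X + _ <= _]mxE [X in _ + X <= _]mxE.
rewrite d1 d2 d3.
have := kernel_proj_le1 i i kP; rewrite ler_norml => /andP[_ P1].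
by move: hY Zi P1; lra.
Qed.

(* With [x] in the kernel, [Y_j x_j <= <Y, x> = <PY, x> <= |PY| |x|], where
   [|PY|^2 <= sum Y = 4 N^3] and [|x|^2 <= N], while the largest weight is at least [4 N^2]. *)
Lemma perceptron_cert (Y x : 'cV[rat]_N) (j : 'I_N) :
  (Y^T *m (P *m Y)) 0 0 <= \sum_k Y k 0 -> \sum_k Y k 0 = (4 * N ^ 3)%:R ->
  (forall i, 0 <= Y i 0 <= Y j 0) -> (forall r, r \in rows -> r *m x = 0) ->
  (forall i, 0 <= x i 0 <= 1) -> x j 0 <= 2^-1.
Proof.
move=> hY sY Yj kx x01; have idem := kernel_proj_idem kP.
have [_ sym h3] := kP; have Px := h3 _ _ kx.
set Z := P *m Y.
have ZZ : \sum_i Z i 0 ^+ 2 <= (4 * N ^ 3)%:R.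
  rewrite -sY; apply: le_trans hY.
  have -> : Y^T *m (P *m Y) = Z^T *m Z.
    by rewrite /Z trmx_mul sym -mulmxA (mulmxA P P) idem.
  by rewrite [X in _ <= X]mxE; apply: ler_sum => i _; rewrite [Z^T 0 i]mxE expr2.
have Zx : \sum_i Y i 0 * x i 0 = \sum_i Z i 0 * x i 0.
  have : (Y^T *m x) 0 0 = (Z^T *m x) 0 0.
    by rewrite /Z trmx_mul sym -mulmxA Px.
  rewrite [LHS]mxE [RHS]mxE => e; rewrite (eq_bigr (fun i => Y^T 0 i * x i 0)) => [|i _]; last by rewrite [Y^T 0 i]mxE.
  by rewrite e; apply: eq_bigr => i _; rewrite [Z^T 0 i]mxE.
have xx : \sum_i x i 0 ^+ 2 <= N%:R.
  rewrite -[N in N%:R]card_ord -sumr_const; apply: ler_sum => i _.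
  by have /andP[x0 x1] := x01 i; rewrite expr_le1.
have N0 : (0 < N)%N := leq_ltn_trans (leq0n _) (ltn_ord j).
set n : rat := N%:R in xx.
have n0 : 0 < n by rewrite ltr0n.
have sq : 0 <= \sum_i (Z i 0 - 2 * n * x i 0) ^+ 2 by apply: sumr_ge0 => i _; apply: sqr_ge0.
have eq : \sum_i (Z i 0 - 2 * n * x i 0) ^+ 2 =
   \sum_i Z i 0 ^+ 2 - 4 * n * (\sum_i Z i 0 * x i 0) + 4 * n ^+ 2 * \sum_i x i 0 ^+ 2.
  rewrite !mulr_sumr -sumrB -big_split /=; apply: eq_bigr => i _; ring.
have n3 : (4 * N ^ 3)%:R = 4 * n ^+ 3 :> rat by rewrite natrM natrX.
rewrite n3 in ZZ sY.
have Zle : \sum_i Z i 0 * x i 0 <= 2 * n ^+ 2.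
  rewrite -(ler_pM2l n0); move: sq; rewrite eq; have := mulr_ge0 (ltW n0) (ltW n0).
  have : n ^+ 2 * \sum_i x i 0 ^+ 2 <= n ^+ 2 * n by rewrite ler_wpM2l // exprn_ge0 // ltW.
  move: ZZ; set u := \sum_i _; set v := \sum_i _; set w := \sum_i _; rewrite !exprS expr0; nra.
have Yx : Y j 0 * x j 0 <= 2 * n ^+ 2.
  apply: le_trans Zle; rewrite -Zx (bigD1 j) //= lerDl sumr_ge0 // => i _.
  by rewrite mulr_ge0 //; [have /andP[] := Yj i|have /andP[] := x01 i].
have Yj' : 4 * n ^+ 2 <= Y j 0.
  rewrite -(ler_pM2l n0).
  have : \sum_k Y k 0 <= \sum_(k < N) Y j 0 by apply: ler_sum => k _; have /andP[] := Yj k.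
  by rewrite sY sumr_const card_ord -[Y j 0 *+ N]mulr_natl -/n => h; apply: le_trans _ h; rewrite mulrCA -exprS.
have /andP[xj0 _] := x01 j.
have n2 : 0 < n ^+ 2 by rewrite exprn_gt0.
have := ler_wpM2r xj0 Yj'; move: Yx n2; move: (Y j 0 * _) (n ^+ 2) => u v h1 h2 h3'.
by nra.
Qed.

End Perceptron.

(** * The solver on lists *)

Definition ent (M : seq (seq rat)) (i j : nat) : rat := nth 0 (nth [::] M i) j.
Definition mulv (N : nat) (M : seq (seq rat)) (v : seq rat) : seq rat :=
  mkseq (fun i => \sum_(0 <= j < N) ent M i j * nth 0 v j) N.
Definition dotl (N : nat) (u v : seq rat) : rat := \sum_(0 <= i < N) nth 0 u i * nth 0 v i.
Definition unit_row (N i : nat) : seq rat := mkseq (fun j => (i == j)%:R) N.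
Definition project_list (N : nat) (P : seq (seq rat)) (a : seq rat) : seq (seq rat) :=
  if dotl N a (mulv N P a) == 0 then P
  else mkseq (fun i => mkseq (fun j => ent P i j -
    (dotl N a (mulv N P a))^-1 * (nth 0 (mulv N P a) i * nth 0 (mulv N P a) j)) N) N.
Definition proj_list (N : nat) (rows : seq (seq rat)) : seq (seq rat) :=
  foldl (project_list N) (mkseq (unit_row N) N) rows.

Definition mx_of (N : nat) (M : seq (seq rat)) : 'M[rat]_N := \matrix_(i, j) ent M i j.
Definition row_of (N : nat) (a : seq rat) : 'rV[rat]_N := \row_j nth 0 a j.
Definition col_of (N : nat) (a : seq rat) : 'cV[rat]_N := \col_j nth 0 a j.

Lemma nth_mulv N M v (i : 'I_N) : nth 0 (mulv N M v) i = (mx_of N M *m col_of N v) i 0.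
Proof.
by rewrite nth_mkseq // mxE big_mkord; apply: eq_bigr => j _; rewrite !mxE.
Qed.

Lemma mx_project N P a : mx_of N (project_list N P a) = project_mx (mx_of N P) (row_of N a).
Proof.
have eT : (row_of N a)^T = col_of N a by apply/colP => i; rewrite !mxE.
have ed : dotl N a (mulv N P a) = (row_of N a *m (mx_of N P *m (row_of N a)^T)) 0 0.
  by rewrite /dotl big_mkord [RHS]mxE; apply: eq_bigr => i _; rewrite nth_mulv eT [row_of N a 0 i]mxE.
rewrite /project_list /project_mx ed; case: eqP => // _.
apply/matrixP => i j; rewrite [LHS]mxE /ent nth_mkseq // nth_mkseq // !nth_mulv eT.
by rewrite [RHS]mxE; congr (_ + _); rewrite ?mxE // big_ord1 !mxE.
Qed.

Lemma proj_listP N rows : kernel_proj [seq row_of N a | a <- rows] (mx_of N (proj_list N rows)).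
Proof.
rewrite /proj_list; elim/last_ind: rows => [|rows a IH].
  have -> : mx_of N (mkseq (unit_row N) N) = 1%:M.
    by apply/matrixP => i j; rewrite !mxE /ent /unit_row !nth_mkseq // -val_eqE.
  exact: kernel_proj_nil.
by rewrite map_rcons foldl_rcons mx_project; apply: project_mxP.
Qed.

Definition natcol (y : seq nat) (N : nat) : seq rat := mkseq (fun j => (nth 0%N y j)%:R) N.
(** The system in the unknowns [2 ^ e_j * x_j]. It is always formed from the integral matrix [A], so
    rescaling accumulates no arithmetic. *)
Definition scaled_rows (N : nat) (A : seq (seq int)) (e : seq nat) : seq (seq rat) :=
  [seq mkseq (fun j => (nth 0 a j)%:~R * 2^-1 ^+ nth 0%N e j) N | a <- A].
Definition dead_rows (N L : nat) (e : seq nat) : seq (seq rat) :=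
  [seq unit_row N i | i <- [seq i <- iota 0 N | ~~ (nth 0%N e i <= L)%N]].
Definition iterate (N L : nat) (A : seq (seq int)) (e y : seq nat) : seq rat :=
  mulv N (proj_list N (scaled_rows N A e ++ dead_rows N L e)) (natcol y N).
Definition nonpositive (N L : nat) (A : seq (seq int)) (e y : seq nat) : seq nat :=
  [seq i <- iota 0 N | (nth 0%N e i <= L)%N && (nth 0 (iterate N L A e y) i <= 0)].
Definition incr_at (N j : nat) (v : seq nat) : seq nat :=
  mkseq (fun i => if i == j then (nth 0%N v i).+1 else nth 0%N v i) N.
Definition argmax (N : nat) (y : seq nat) : nat :=
  head 0%N [seq j <- iota 0 N | all (fun i => nth 0%N y i <= nth 0%N y j)%N (iota 0 N)].
(* The state [(e, y)] consists of scaling exponents, such that every solution [x] with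
   entries in [0, 1] has [x_j <= 2^-e_j], and of the perceptron weights.  By
   [small_solution], indices with [e_j > L] can be assumed to vanish, and rows are added
   that force them to. *)
Definition rescale_step (N L C : nat) (A : seq (seq int)) (st : seq nat * seq nat) : seq nat * seq nat :=
  match nonpositive N L A st.1 st.2 with
  | i :: _ => if (C <= sumn st.2)%N then (incr_at N (argmax N st.2) st.1, mkseq (fun _ => 0%N) N)
              else (st.1, incr_at N i st.2)
  | [::] => st
  end.

Definition bit_bound (A : seq (seq int)) : nat :=
  sumn [seq sumn [seq size (bits_msb `|z|) | z <- a] | a <- A].
(** Chosen so that [2 ^ depth_bound] dominates the entries of the small integral solutions: if some
    solution is positive at [j], one with entries in [0, 1] has value at least [2 ^ - depth_bound]
    there. *)
Definition depth_bound (N : nat) (A : seq (seq int)) : nat :=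
  (N * (N + N + (bit_bound A + bit_bound A)))%N.
Definition cut_bound (N : nat) : nat := (4 * (N * (N * N)))%N.
(** Each of the [N] exponents grows at most [L.+1] times, and at most [cut_bound N] updates precede
    each growth. *)
Definition step_bound (N L : nat) : nat := ((cut_bound N).+1 * (N * L.+1).+1)%N.
Definition final_state (N : nat) (A : seq (seq int)) : seq nat * seq nat :=
  iter (step_bound N (depth_bound N A)) (rescale_step N (depth_bound N A) (cut_bound N) A)
    (mkseq (fun _ => 0%N) N, mkseq (fun _ => 0%N) N).
Definition read_solution (N : nat) (A : seq (seq int)) (st : seq nat * seq nat) : option (seq rat) :=
  if (nth 0%N st.1 0 <= depth_bound N A)%N then
    Some (mkseq (fun j => nth 0 (iterate N (depth_bound N A) A st.1 st.2) j * 2^-1 ^+ nth 0%N st.1 j) N)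
  else None.
Definition solve (N : nat) (A : seq (seq int)) : option (seq rat) := read_solution N A (final_state N A).

(** * Correctness of the rescaled perceptron *)

Section Correctness.
Variables (N : nat) (A : seq (seq int)).
Let L := depth_bound N A.
Let C := cut_bound N.
Implicit Types (e y : seq nat).

Definition feasible (x : 'cV[rat]_N) :=
  (forall i, 0 <= x i 0 <= 1) /\
  forall a, a \in A -> \sum_(j < N) (nth 0 a j)%:~R * x j 0 = 0.

Definition contracted e := forall x, feasible x -> forall j : 'I_N, 2 ^+ nth 0%N e j * x j 0 <= 1.

Definition irow (a : seq int) : 'rV[int]_N := \row_j nth 0 a j.
Definition max_coef := (2 ^ bit_bound A).-1.

Lemma coef_le a j : a \in A -> (`|nth (0%R : int) a j| <= max_coef)%N.
Proof.
move=> ain; case: (ltnP j (size a)) => [jlt|jge]; last by rewrite nth_default.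
rewrite -ltnS /max_coef prednK ?expn_gt0 //; apply: leq_trans (lt_exp_size_bits _) _.
rewrite leq_exp2l // /bit_bound.
have le_sumn (s : seq nat) n : n \in s -> (n <= sumn s)%N.
  by elim: s => //= m s IH; rewrite inE => /orP[/eqP->|/IH]; lia.
apply: leq_trans (le_sumn _ _ (map_f _ ain)).
by apply/le_sumn/map_f/mem_nth.
Qed.

Lemma minor_bound_le : (minor_bound N max_coef.+1 <= 2 ^ L)%N.
Proof.
rewrite /minor_bound /max_coef prednK ?expn_gt0 // /L /depth_bound [X in (_ <= 2 ^ X)%N]mulnC [leqRHS]expnM.
case: (N) => [|n]; first by rewrite !expn0.
rewrite leq_exp2r // expnD expnD.
have h : forall m, (m * m < 2 ^ m * 2 ^ m)%N by move=> m; have := ltn_expl m (isT : 1 < 2)%N; nia.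
have -> : (2 ^ (bit_bound A + bit_bound A) = (2 ^ bit_bound A) ^ 2)%N by rewrite expnD mulnn.
move: (h n.+1); have : (0 < (2 ^ bit_bound A) ^ 2)%N by rewrite expn_gt0 expn_gt0.
by move: (2 ^ n.+1)%N ((2 ^ bit_bound A) ^ 2)%N => u v; rewrite mulnA; nia.
Qed.

(** A solution positive at [j] yields an integral one with [1 <= z j] and all entries at most
    [2 ^ L]. Divided by [2 ^ L] it is feasible and at least [2 ^ - L] at [j], against the
    contraction to [2 ^ - e_j] with [e_j > L]. *)
Lemma contracted_zero (K : realFieldType) e (x : 'I_N -> K) (j : 'I_N) :
  contracted e -> (forall i, 0 <= x i) ->
  (forall a, a \in A -> \sum_(i < N) (nth 0 a i)%:~R * x i = 0) -> ~~ (nth 0%N e j <= L)%N -> x j = 0.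
Proof.
move=> ce x0 xA; rewrite -ltnNge => ej; apply/eqP; rewrite eq_le x0 andbT leNgt; apply/negP => xj.
have hb r i : r \in [seq irow a | a <- A] -> (`|r ord0 i| <= max_coef)%N.
  by case/mapP => a ain ->; rewrite mxE; apply: coef_le.
have hx r : r \in [seq irow a | a <- A] -> map_mx intr r *m (\col_i x i) = 0.
  case/mapP => a ain ->; apply/rowP => k; rewrite !mxE -[RHS](xA a ain).
  by apply: eq_bigr => i _; rewrite !mxE.
have [||z [z1 z2 z3]] := @small_solution K N [seq irow a | a <- A] max_coef (\col_i x i) j hb _ hx.
- by move=> i; rewrite mxE.
- by rewrite mxE.
pose w : 'cV[rat]_N := \col_i ((z i)%:R / 2 ^+ L).
have p2 n : 0 < 2 ^+ n :> rat by rewrite exprn_gt0.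
have fw : feasible w.
  split=> [i|a ain].
    rewrite mxE divr_ge0 ?ler0n ?(ltW (p2 _)) //= ler_pdivrMr // mul1r.
    by rewrite -natrX ler_nat; apply: leq_trans (z3 i) minor_bound_le.
  have := z1 _ (map_f irow ain) => /(congr1 (fun n : int => n%:~R / 2 ^+ L : rat)).
  rewrite rmorph_sum mulr_suml mul0r => {2}<-; apply: eq_bigr => i _.
  by rewrite !mxE rmorphM /= mulrA.
have := ce w fw j; rewrite mxE mulrCA mulrA ler_pdivrMr // mul1r => h.
have : (2 ^+ L.+1 : rat) <= 2 ^+ L.
  apply: le_trans h; apply: (@le_trans _ _ (2 ^+ nth 0%N e j)).
    by rewrite ler_eXn2l // ltr1n.
  by rewrite ler_pMl // ler1n.
by rewrite exprS; have := p2 L; lra.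
Qed.

Definition rows_at e := scaled_rows N A e ++ dead_rows N L e.
Definition proj_at e : 'M[rat]_N := mx_of N (proj_list N (rows_at e)).
Definition ycol y : 'cV[rat]_N := col_of N (natcol y N).

Lemma ycolE y (i : 'I_N) : ycol y i 0 = (nth 0%N y i)%:R.
Proof. by rewrite mxE nth_mkseq. Qed.

Lemma iterateE e y (i : 'I_N) : nth 0 (iterate N L A e y) i = (proj_at e *m ycol y) i 0.
Proof. exact: nth_mulv. Qed.

Lemma ker_rows_at e (v : 'cV[rat]_N) :
  (forall r, r \in [seq row_of N a | a <- rows_at e] -> r *m v = 0) <->
  (forall a, a \in A -> \sum_(j < N) (nth 0 a j)%:~R * (2^-1 ^+ nth 0%N e j * v j 0) = 0) /\
  (forall j : 'I_N, ~~ (nth 0%N e j <= L)%N -> v j 0 = 0).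
Proof.
split=> [h|[h1 h2] r].
  split=> [a ain|j ej].
    have rin : row_of N (mkseq (fun j => (nth 0 a j)%:~R * 2^-1 ^+ nth 0%N e j) N)
        \in [seq row_of N a | a <- rows_at e].
      by apply: map_f; rewrite mem_cat (map_f (fun a => mkseq _ N)).
    have /rowP /(_ 0) := h _ rin; rewrite !mxE => {2}<-.
    by apply: eq_bigr => j _; rewrite !mxE nth_mkseq // mulrA.
  have rin : row_of N (unit_row N j) \in [seq row_of N a | a <- rows_at e].
    apply: map_f; rewrite mem_cat; apply/orP; right; apply: map_f.
    by rewrite mem_filter ej mem_iota /=.
  have /rowP /(_ 0) := h _ rin; rewrite !mxE (bigD1 j) //= !mxE nth_mkseq // eqxx mul1r big1 ?addr0 //.
  by move=> i ij; rewrite !mxE nth_mkseq // val_eqE eq_sym (negPf ij) mul0r.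
rewrite map_cat mem_cat => /orP[/mapP[_ /mapP[a ain ->] ->]|/mapP[_ /mapP[j jin ->] ->]].
  apply/rowP => k; rewrite !mxE -[RHS](h1 a ain); apply: eq_bigr => i _.
  by rewrite !mxE nth_mkseq // ord1 mulrA.
move: jin; rewrite mem_filter mem_iota => /andP[ej /= jN].
apply/rowP => k; rewrite !mxE big1 // => i _; rewrite !mxE nth_mkseq //.
case: eqP => [ji|_]; last by rewrite mul0r.
by rewrite ord1 (h2 i) ?mulr0 // -ji.
Qed.

(** By [inv_live] only indices with exponent at most [L] carry weight. The index of largest weight
    is therefore live whenever it is rescaled, which keeps the exponents at most [L.+1]. *)
Record invariant (st : seq nat * seq nat) : Prop := Invariant {
  inv_sizes : size st.1 = N /\ size st.2 = N;
  inv_contracted : contracted st.1;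
  inv_norm : ((ycol st.2)^T *m (proj_at st.1 *m ycol st.2)) 0 0 <= \sum_k ycol st.2 k 0;
  inv_live : forall j, (0 < nth 0%N st.2 j)%N -> (nth 0%N st.1 j <= L)%N;
  inv_depth : forall j, (nth 0%N st.1 j <= L.+1)%N;
  inv_cut : (sumn st.2 <= C)%N
}.

(** The potential grows by 1 in an update; in a rescaling it loses the weight [C] and gains
    [C.+1]. *)
Definition progress (st : seq nat * seq nat) := (C.+1 * sumn st.1 + sumn st.2)%N.

Arguments progress : simpl never.
Arguments incr_at : simpl never.

Lemma progressE e y : progress (e, y) = (C.+1 * sumn e + sumn y)%N.
Proof. by []. Qed.

Lemma sumn_nth (s : seq nat) : size s = N -> sumn s = (\sum_(j < N) nth 0%N s j)%N.
Proof. by move=> sz; rewrite sumnE (big_nth 0%N) big_mkord sz. Qed.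

Lemma sumn_incr_at (s : seq nat) j : size s = N -> (j < N)%N -> sumn (incr_at N j s) = (sumn s).+1.
Proof.
move=> sz jN; rewrite !sumn_nth ?size_mkseq // (bigD1 (Ordinal jN)) //= [in RHS](bigD1 (Ordinal jN)) //=.
rewrite nth_mkseq // eqxx addSn; congr (_ + _).+1; apply: eq_bigr => i ij.
by rewrite nth_mkseq // -(inj_eq val_inj) /= in ij *; rewrite (negPf ij).
Qed.

Lemma sumn_zeros : sumn (mkseq (fun _ => 0%N) N) = 0%N.
Proof. by rewrite sumn_nth ?size_mkseq // big1 // => i _; rewrite nth_mkseq. Qed.

Lemma nth_zeros j : nth 0%N (mkseq (fun _ => 0%N) N) j = 0%N.
Proof.
by case: (ltnP j N) => h; [rewrite nth_mkseq|rewrite nth_default // size_mkseq].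
Qed.

Lemma ycol_zeros : ycol (mkseq (fun _ => 0%N) N) = 0.
Proof. by apply/colP => i; rewrite ycolE nth_zeros mxE. Qed.

Lemma invariant_start : invariant (mkseq (fun _ => 0%N) N, mkseq (fun _ => 0%N) N).
Proof.
split; rewrite /= ?size_mkseq ?sumn_zeros //.
- by move=> x [h _] j; rewrite nth_zeros mul1r; have /andP[] := h j.
- by rewrite ycol_zeros !mulmx0 mxE sumr_ge0 // => k _; rewrite mxE.
- by move=> j; rewrite nth_zeros.
- by move=> j; rewrite nth_zeros.
Qed.

Lemma argmaxP y : (0 < N)%N -> (argmax N y < N)%N /\ forall i, (i < N)%N -> (nth 0%N y i <= nth 0%N y (argmax N y))%N.
Proof.
move=> N0; rewrite /argmax; set s := [seq _ <- _ | _].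
have [j js] : exists j, j \in s.
  pose j := [arg max_(j > Ordinal N0) nth 0%N y j]; exists (val j).
  rewrite mem_filter mem_iota /= ltn_ord andbT; apply/allP => i; rewrite mem_iota /= => iN.
  by rewrite /j; case: arg_maxnP => // k _ /(_ (Ordinal iN) isT).
have : head 0%N s \in s by case: (s) js => //= a l _; rewrite inE eqxx.
rewrite mem_filter mem_iota /= => /andP[/allP h ->]; split=> // i iN.
by apply: h; rewrite mem_iota.
Qed.

Lemma rescale_stepP st : invariant st ->
  invariant (rescale_step N L C A st) /\
  (nonpositive N L A st.1 st.2 = [::] \/ (progress st < progress (rescale_step N L C A st))%N).
Proof.
case: st => e y [[/= se sy] ic inorm il id icut]; rewrite /rescale_step /=.
case E : nonpositive => [|i s] /=; first by split; [split|left].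
have : i \in nonpositive N L A e y by rewrite E inE eqxx.
rewrite mem_filter mem_iota /= => /andP[/andP[ei Zi] iN].
have N0 : (0 < N)%N := leq_ltn_trans (leq0n _) iN.
have kP := proj_listP N (rows_at e).
case: (leqP C (sumn y)) => hC; last first.
  split; last by right; rewrite !progressE sumn_incr_at // addnS.
  split; rewrite ?[_.1]/= ?[_.2]/= ?size_mkseq ?sumn_incr_at //.
    apply: (perceptron_step kP (Y := ycol y) (i := Ordinal iN)) => //.
      apply/colP => k; rewrite [RHS]mxE !ycolE nth_mkseq // !mxE eqxx andbT -val_eqE /=.
      by case: eqP => _; rewrite ?addr0 // -natr1.
    by rewrite -/(proj_at e) -iterateE.
  move=> j; case: (ltnP j N) => jN; last by rewrite nth_default ?size_mkseq.
  by rewrite nth_mkseq //; case: eqP => [->//|_]; apply: il.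
have eC : sumn y = C by apply/eqP; rewrite eqn_leq icut.
have [jN jmax] := argmaxP y N0; set j := argmax N y in jN jmax *.
have yj0 : (0 < nth 0%N y j)%N.
  rewrite lt0n; apply/eqP => y0; have : sumn y = 0%N.
    rewrite sumn_nth // big1 // => k _; have := jmax k (ltn_ord k).
    by rewrite y0 leqn0 => /eqP.
  by rewrite eC /C /cut_bound; nia.
have ej := il j yj0.
split; last first.
  by right; rewrite !progressE sumn_incr_at // sumn_zeros addn0 mulnS eC; lia.
split; rewrite ?[_.1]/= ?[_.2]/= ?size_mkseq ?sumn_zeros //.
- move=> x fx k; rewrite nth_mkseq //; case: eqP => [kj|_]; last exact: ic.
  (* In the scaled unknowns the solution lies in the kernel, its dead coordinates being 0 by
     [contracted_zero], and in [0, 1] by contraction. The certificate halves coordinate [j] once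
     more. *)
  pose x' : 'cV[rat]_N := \col_i (2 ^+ nth 0%N e i * x i 0).
  have [x01 xA] := fx.
  have h : x' (Ordinal jN) 0 <= 2^-1.
    apply: (perceptron_cert kP (Y := ycol y)) => //.
    + transitivity ((sumn y)%:R : rat).
        by rewrite sumn_nth // natr_sum; apply: eq_bigr => l _; rewrite ycolE.
      by rewrite eC /C /cut_bound !expnS expn0 muln1.
    + by move=> l; rewrite !ycolE ler0n ler_nat jmax.
    + apply/(ker_rows_at e x'); split=> [a ain|l el].
        rewrite -[RHS](xA a ain); apply: eq_bigr => l _; rewrite mxE; congr (_ * _).
        by rewrite mulrA -exprMn mulVf // expr1n mul1r.
      rewrite mxE (contracted_zero (x := fun i => x i 0) ic _ xA el) ?mulr0 //.
      by move=> m; have /andP[] := x01 m.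
    move=> l; rewrite mxE ic // andbT mulr_ge0 ?exprn_ge0 //.
    by have /andP[] := x01 l.
  have -> : k = Ordinal jN by apply: val_inj.
  by move: h; rewrite mxE /= exprS; move: (2 ^+ _ * x _ 0) (mulrA 2 (2 ^+ nth 0%N e j) (x (Ordinal jN) 0)) => u <-; lra.
- by rewrite ycol_zeros !mulmx0 mxE sumr_ge0 // => k _; rewrite mxE.
- by move=> k; rewrite nth_zeros.
move=> k; case: (ltnP k N) => kN; last by rewrite nth_default ?size_mkseq.
by rewrite nth_mkseq //; case: eqP => [->|_].
Qed.

Lemma progress_le st : invariant st -> (progress st < step_bound N L)%N.
Proof.
case=> [[/= se sy] _ _ _ id icut]; rewrite /progress /step_bound -/C.
have : (sumn st.1 <= N * L.+1)%N.
  rewrite sumn_nth // -[X in (_ <= X * _)%N]card_ord -sum_nat_const.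
  by apply: leq_sum => i _; apply: id.
by move: icut; nia.
Qed.

(** Progress stays below the number of rounds, so some round must have left the state unchanged. *)
Lemma final_stateP : invariant (final_state N A) /\
  nonpositive N L A (final_state N A).1 (final_state N A).2 = [::].
Proof.
rewrite /final_state -/L -/C; set f := rescale_step N L C A; set st0 := (_, _).
have H k : invariant (iter k f st0) /\ (nonpositive N L A (iter k f st0).1 (iter k f st0).2 = [::]
    \/ (k <= progress (iter k f st0))%N).
  elim: k => [|k [IH1 IH2]]; first by split; [exact: invariant_start|right].
  have [h1 h2] := rescale_stepP IH1; rewrite -/f in h1 h2; rewrite iterS; split=> //.
  case: (nonpositive N L A (iter k f st0).1 (iter k f st0).2 =P [::]) => [e|ne].
    by left; have -> : f (iter k f st0) = iter k f st0 by rewrite /f /rescale_step e.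
  by case: IH2 h2 => // IH2 [//|h2]; right; lia.
have [h1 [//|h2]] := H (step_bound N L).
by have := progress_le h1; lia.
Qed.

(** In the final state the projected weights are positive on the live indices and 0 on the dead
    ones; undoing the scaling gives a nonnegative solution, positive at 0 since index 0 is live. *)
Theorem solve_sound x : (0 < N)%N -> solve N A = Some x ->
  [/\ size x = N, forall j, 0 <= nth 0 x j, 0 < nth 0 x 0
    & forall a, a \in A -> \sum_(0 <= j < N) (nth 0 a j)%:~R * nth 0 x j = 0].
Proof.
have [] := final_stateP; rewrite /solve /read_solution -/L; case: final_state => e y /= ist np N0.
case: ifP => // e0 [<-].
have kP := proj_listP N (rows_at e).
have pos (j : 'I_N) : (nth 0%N e j <= L)%N -> 0 < (proj_at e *m ycol y) j 0.
  move=> ej; rewrite ltNge; apply/negP => h.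
  have : val j \in nonpositive N L A e y by rewrite mem_filter ej iterateE h mem_iota /=.
  by rewrite np.
have ker : forall r, r \in [seq row_of N a | a <- rows_at e] -> r *m (proj_at e *m ycol y) = 0.
  by move=> r rin; case: kP => h _ _; rewrite mulmxA h // mul0mx.
have [k1 k2] := (ker_rows_at e (proj_at e *m ycol y)).1 ker.
have p2 n : 0 < 2^-1 ^+ n :> rat by rewrite exprn_gt0 // invr_gt0.
split; first by rewrite size_mkseq.
- move=> j; case: (ltnP j N) => jN; last by rewrite nth_default ?size_mkseq.
  rewrite nth_mkseq // -[j]/(val (Ordinal jN)) iterateE mulr_ge0 ?(ltW (p2 _)) //.
  case: (boolP (nth 0%N e j <= L)%N) => ej; first exact/ltW/pos.
  by rewrite k2.
- by rewrite nth_mkseq // -[0%N]/(val (Ordinal N0)) iterateE mulr_gt0 // pos.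
move=> a ain; rewrite big_mkord -[RHS](k1 a ain); apply: eq_bigr => j _.
by rewrite nth_mkseq // iterateE; congr (_ * _); apply: mulrC.
Qed.

(** The refutation covers every ordered field, in particular the reals: index 0 is dead, and dead
    indices vanish in all solutions. *)
Theorem solve_complete (K : realFieldType) (x : nat -> K) : (0 < N)%N -> solve N A = None ->
  (forall j, 0 <= x j) -> (forall a, a \in A -> \sum_(0 <= j < N) (nth 0 a j)%:~R * x j = 0) -> x 0%N = 0.
Proof.
have [] := final_stateP; rewrite /solve /read_solution -/L; case: final_state => e y /= ist np N0.
case: ifP => // /negbT e0 _ x0 xA.
apply: (contracted_zero (x := fun i : 'I_N => x i) (j := Ordinal N0) (inv_contracted ist)) => //.
by move=> a ain; rewrite -[RHS](xA a ain) big_mkord.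
Qed.

End Correctness.

(** * Sizes and running time of the solver *)

Definition den_prod (rows : seq (seq rat)) : nat := (\prod_(a <- rows) \prod_(x <- a) `|denq x|)%N.

Lemma prod_den_row (a : seq rat) : (0 < \prod_(x <- a) `|denq x| <= 2 ^ esize a)%N.
Proof.
elim: a => [|x a /andP[h1 h2]]; first by rewrite big_nil.
rewrite big_cons muln_gt0 denq_gt0N h1 esize_cons expnS expnD /=.
have [_ h] := rat_lt_exp x; apply: leq_trans (leq_mul (ltnW h) h2) _.
by rewrite leq_pmull.
Qed.

Lemma den_prod_bound rows : (0 < den_prod rows <= 2 ^ esize rows)%N.
Proof.
rewrite /den_prod; elim: rows => [|a rows /andP[h1 h2]]; first by rewrite big_nil.
have /andP[h3 h4] := prod_den_row a.
rewrite big_cons muln_gt0 h1 h3 esize_cons expnS expnD /=.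
by apply: leq_trans (leq_mul h4 h2) _; rewrite leq_pmull.
Qed.

Lemma den_prod_dvd (rows : seq (seq rat)) (a : seq rat) x : a \in rows -> x \in a -> (`|denq x| %| den_prod rows)%N.
Proof.
move=> ain xin; rewrite /den_prod (big_rem a ain) /= (big_rem x xin) /=.
by rewrite -mulnA dvdn_mulr.
Qed.

Lemma esize_mem {A : eqType} {EA : enc A} (a : A) (s : seq A) : a \in s -> (esize a < esize s)%N.
Proof.
by elim: s => //= b s IH; rewrite inE esize_cons => /orP[/eqP->|/IH]; lia.
Qed.

Lemma esize_all {A : eqType} {EA : enc A} (s : seq A) m : (forall a, a \in s -> (esize a <= m)%N) ->
  (esize s <= size s * m.+1 + 1)%N.
Proof.
elim: s => [|a s IH] h; first by rewrite esize_nil.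
rewrite esize_cons /= mulSn; have := h a (mem_head _ _).
by have := IH (fun b bs => h b (@mem_behead _ (a :: s) b bs)); lia.
Qed.

Definition proj_bits (N s : nat) : nat := (N * (N + N + (4 * s + 4 * s))).+1.

(** Following the rank-one updates would give an exponential bound. By uniqueness, each intermediate
    matrix is the projection for the rows read so far, and is bounded by the determinant formula. *)
Lemma esize_proj_entry N rows (i j : 'I_N) :
  (esize (ent (proj_list N rows) i j) <= 8 * proj_bits N (esize rows) + 11)%N.
Proof.
have /andP[D0 hD] := den_prod_bound rows; set D := den_prod rows in D0 hD.
(* The rows times their common denominator [D]: integral, with the same kernel and hence the same
   projection. *)
pose ir (a : seq rat) : 'rV[int]_N := \row_j (numq (nth 0 a j) * (D %/ `|denq (nth 0%R a j)|)%N%:Z).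
have irE a : a \in rows -> map_mx intr (ir a) = D%:R *: row_of N a.
  move=> ain; apply/rowP => k; rewrite !mxE rmorphM /=.
  have dv : (`|denq a`_k| %| D)%N.
    case: (ltnP k (size a)) => ka; first by apply: den_prod_dvd ain _; apply: mem_nth.
    by rewrite nth_default //.
  have dE : (`|denq a`_k|%N)%:R = (denq a`_k)%:~R :> rat by rewrite -[in RHS]absz_denq.
  have dn : (denq a`_k)%:~R != 0 :> rat by rewrite intr_eq0 denq_neq0.
  have ek : a`_k * (denq a`_k)%:~R = (numq a`_k)%:~R by rewrite -{1}[a`_k]divq_num_den divfK.
  by rewrite -[D in RHS](divnK dv) natrM dE -ek -[LHS]mulrA [RHS]mulrC; congr (_ * _); apply: mulrC.
pose (a0 := (2 ^ (2 * esize rows))%N).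
have ha r k : r \in [seq ir a | a <- rows] -> (`|r ord0 k| <= a0)%N.
  case/mapP => a ain ->; rewrite mxE abszM absz_nat.
  case: (ltnP k (size a)) => ka; last by rewrite nth_default.
  have [h _] := rat_lt_exp a`_k.
  have h1 : (esize (a`_k : rat) <= esize a)%N by apply/ltnW/esize_mem/mem_nth.
  have h2 : (esize (a : seq rat) <= esize rows)%N by apply/ltnW/esize_mem.
  rewrite /a0 mul2n -addnn expnD; apply: leq_mul; last exact: leq_trans (leq_div _ _) hD.
  by apply: leq_trans (ltnW h) _; rewrite leq_exp2l // (leq_trans h1).
have [P [del [kP /andP[del0 delB] Pint]]] := @kernel_proj_int rat N _ a0 ha.
have eP : mx_of N (proj_list N rows) = P.
  apply: kernel_proj_uniq kP; rewrite -map_comp.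
  have -> : map (map_mx intr \o ir) rows = [seq D%:R *: row_of N a | a <- rows].
    by apply/eq_in_map => a ain /=; rewrite irE.
  have -> : [seq D%:R *: row_of N a | a <- rows] = [seq D%:R *: r | r <- [seq row_of N a | a <- rows]].
    by rewrite -map_comp.
  by apply: kernel_proj_scale (proj_listP N rows); rewrite pnatr_eq0 -lt0n.
have -> : ent (proj_list N rows) i j = P i j by rewrite -eP mxE.
have [z ez] := Pint i j.
have dn : del%:R != 0 :> rat by rewrite pnatr_eq0 -lt0n.
have Pz : P i j = z%:~R / del%:R by rewrite -ez mulfK.
have zdel : (`|z| <= del)%N.
  have := kernel_proj_le1 i j kP; rewrite Pz normf_div normr_nat ler_pdivrMr ?ltr0n // mul1r.
  by rewrite -intr_norm -[del%:R]/(del%:Z%:~R) ler_int; lia.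
have hdel : (del < 2 ^ proj_bits N (esize rows))%N.
  apply: leq_ltn_trans delB _; rewrite /proj_bits.
  have : (minor_bound N a0 <= 2 ^ (N * (N + N + (4 * esize rows + 4 * esize rows))))%N.
    rewrite /minor_bound [X in (_ <= 2 ^ X)%N]mulnC [leqRHS]expnM.
    have -> : (4 * esize rows + 4 * esize rows = 2 * (2 * esize rows) * 2)%N by lia.
    case: (N) => [|n]; first by rewrite !expn0.
    rewrite leq_exp2r // !expnD; rewrite expnM -/a0.
    have h : forall m, (m * m < 2 ^ m * 2 ^ m)%N by move=> m; have := ltn_expl m (isT : 1 < 2)%N; nia.
    have a1 : (0 < a0)%N by rewrite expn_gt0.
    have -> : (2 ^ (2 * (2 * esize rows)) = a0 ^ 2)%N by rewrite /a0 -expnM [in RHS]mulnC.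
    move: (h n.+1) a1; move: (2 ^ n.+1)%N => u hu a1; rewrite mulnA.
    have : (a0 ^ 2 <= (a0 ^ 2) ^ 2)%N by rewrite -[X in (X <= _)%N]expn1 leq_pexp2l // expn_gt0 a1.
    have : (0 < a0 ^ 2)%N by rewrite expn_gt0 a1.
    by move: (a0 ^ 2)%N ((a0 ^ 2) ^ 2)%N => v w; nia.
  by move=> h; apply: leq_ltn_trans h _; rewrite ltn_exp2l.
rewrite Pz; apply: esize_rat_frac => //; exact: leq_ltn_trans zdel hdel.
Qed.

Lemma proj_list_mkseq N rows : exists F, proj_list N rows = mkseq (fun i => mkseq (F i) N) N.
Proof.
rewrite /proj_list; elim/last_ind: rows => [|rows a [F IH]].
  by eexists.
rewrite foldl_rcons IH {1}/project_list; case: ifP => _; first by exists F.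
by eexists.
Qed.

Lemma esize_proj N rows :
  (esize (proj_list N rows) <= N * (N * (8 * proj_bits N (esize rows) + 11).+1 + 1).+1 + 1)%N.
Proof.
have [F E] := proj_list_mkseq N rows.
have e i j (iN : (i < N)%N) (jN : (j < N)%N) : (esize (F i j) <= 8 * proj_bits N (esize rows) + 11)%N.
  by have := esize_proj_entry rows (Ordinal iN) (Ordinal jN); rewrite E /ent !nth_mkseq.
rewrite E -{3}(size_mkseq (fun i => mkseq (F i) N) N); apply: esize_all => a /mapP[i].
rewrite mem_iota /= => iN ->; rewrite -{2}(size_mkseq (F i) N); apply: esize_all => x /mapP[j].
by rewrite mem_iota /= => jN ->; apply: e.
Qed.

Lemma pt_mulv {X} {EX : enc X} (D : X -> Prop) (N : X -> nat) (M : X -> seq (seq rat)) (v : X -> seq rat) :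
  pt D N -> pt D M -> pt D v -> pt D (fun x => mulv (N x) (M x) (v x)).
Proof. by apply: (pt_app3 (f := mulv)); rewrite /mulv /ent; pt_auto. Qed.

Lemma pt_dotl {X} {EX : enc X} (D : X -> Prop) (N : X -> nat) (u v : X -> seq rat) :
  pt D N -> pt D u -> pt D v -> pt D (fun x => dotl (N x) (u x) (v x)).
Proof. by apply: (pt_app3 (f := dotl)); rewrite /dotl; pt_auto. Qed.

Lemma pt_unit_row {X} {EX : enc X} (D : X -> Prop) (N i : X -> nat) : pt D N -> pt D i -> pt D (fun x => unit_row (N x) (i x)).
Proof. by apply: (pt_app2 (f := unit_row)); rewrite /unit_row; pt_auto. Qed.

Ltac pt_solver1 := lazymatch goal with
  | |- pt _ (fun x => mulv (@?n x) (@?M x) (@?v x)) => apply: pt_mulv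
  | |- pt _ (fun x => dotl (@?n x) (@?M x) (@?v x)) => apply: pt_dotl
  | |- pt _ (fun x => unit_row (@?n x) (@?M x)) => apply: pt_unit_row
  | |- pt _ (fun x => bits_msb (absz (@?z x))) => apply/pt_bits_msb/pt_absz
  end.
Ltac pt_user ::= pt_solver1.

Lemma esize_proj_le N rows n : (N <= n)%N -> (esize rows <= n)%N ->
  (esize (proj_list N rows) <= n * (n * (8 * proj_bits n n + 11).+1 + 1).+1 + 1)%N.
Proof.
move=> hN hr; apply: leq_trans (esize_proj N rows) _; rewrite /proj_bits.
by do ![apply: leq_add | apply: leq_mul | rewrite ltnS | assumption | exact: leqnn].
Qed.

Lemma pt_proj_list {X} {EX : enc X} (D : X -> Prop) (N : X -> nat) (rows : X -> seq (seq rat)) :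
  pt D N -> pt D rows -> pt D (fun x => proj_list (N x) (rows x)).
Proof.
apply: (pt_app2 (f := proj_list)).
apply: (@pt_foldl_free _ _ _ _ _ _ _ (fun (p : nat * seq (seq rat)) => project_list p.1)
  (fun p => mkseq (unit_row p.1) p.1) snd
  (fun n => n * (n * (8 * proj_bits n n + 11).+1 + 1).+1 + 1)%N).
- by pt_auto.
- by pt_auto.
- apply: (pt_app3 (f := project_list)); first by rewrite /project_list /ent; pt_auto.
  + by pt_auto.
  + by pt_auto.
  + by pt_auto.
- by rewrite /proj_bits; growth.
move=> [n rows'] _ s1 s2 /= e; apply: esize_proj_le; rewrite esize_pair.
  by rewrite esize_nat; lia.
by rewrite e; apply: leq_trans (esize_prefix s1 s2) _; lia.
Qed.

Lemma pt_natcol {X} {EX : enc X} (D : X -> Prop) (y : X -> seq nat) (N : X -> nat) :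
  pt D y -> pt D N -> pt D (fun x => natcol (y x) (N x)).
Proof. by apply: (pt_app2 (f := natcol)); rewrite /natcol; pt_auto. Qed.

Lemma pt_scaled_rows {X} {EX : enc X} (D : X -> Prop) (N : X -> nat) (A : X -> seq (seq int)) (e : X -> seq nat) :
  pt D N -> pt D A -> pt D e -> pt D (fun x => scaled_rows (N x) (A x) (e x)).
Proof. by apply: (pt_app3 (f := scaled_rows)); rewrite /scaled_rows; pt_auto. Qed.

Lemma pt_dead_rows {X} {EX : enc X} (D : X -> Prop) (N L : X -> nat) (e : X -> seq nat) :
  pt D N -> pt D L -> pt D e -> pt D (fun x => dead_rows (N x) (L x) (e x)).
Proof. by apply: (pt_app3 (f := dead_rows)); rewrite /dead_rows; pt_auto. Qed.

Lemma pt_incr_at {X} {EX : enc X} (D : X -> Prop) (N j : X -> nat) (v : X -> seq nat) :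
  pt D N -> pt D j -> pt D v -> pt D (fun x => incr_at (N x) (j x) (v x)).
Proof. by apply: (pt_app3 (f := incr_at)); rewrite /incr_at; pt_auto. Qed.

Lemma pt_argmax {X} {EX : enc X} (D : X -> Prop) (N : X -> nat) (y : X -> seq nat) :
  pt D N -> pt D y -> pt D (fun x => argmax (N x) (y x)).
Proof. by apply: (pt_app2 (f := argmax)); rewrite /argmax; pt_auto. Qed.

Ltac pt_solver2 := lazymatch goal with
  | |- pt _ (fun x => proj_list (@?n x) (@?M x)) => apply: pt_proj_list
  | |- pt _ (fun x => natcol (@?n x) (@?M x)) => apply: pt_natcol
  | |- pt _ (fun x => scaled_rows (@?n x) (@?M x) (@?e x)) => apply: pt_scaled_rows
  | |- pt _ (fun x => dead_rows (@?n x) (@?M x) (@?e x)) => apply: pt_dead_rows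
  | |- pt _ (fun x => incr_at (@?n x) (@?M x) (@?e x)) => apply: pt_incr_at
  | |- pt _ (fun x => argmax (@?n x) (@?M x)) => apply: pt_argmax
  end.
Ltac pt_user ::= first [pt_solver1 | pt_solver2].

Lemma pt_iterate {X} {EX : enc X} (D : X -> Prop) (N L : X -> nat) (A : X -> seq (seq int)) (e y : X -> seq nat) :
  pt D N -> pt D L -> pt D A -> pt D e -> pt D y ->
  pt D (fun x => iterate (N x) (L x) (A x) (e x) (y x)).
Proof.
move=> pN pL pA pe py.
apply: (pt_app4 (f := fun N L A st => iterate N L A st.1 st.2) _ pN pL pA (pt_pair pe py)).
by rewrite /iterate; pt_auto.
Qed.

Lemma pt_rescale_step {X} {EX : enc X} (D : X -> Prop) (N L C : X -> nat) (A : X -> seq (seq int)) (st : X -> seq nat * seq nat) :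
  pt D N -> pt D L -> pt D C -> pt D A -> pt D st ->
  pt D (fun x => rescale_step (N x) (L x) (C x) (A x) (st x)).
Proof.
move=> pN pL pC; apply: (pt_app3 (f := fun p A st => rescale_step p.1.1 p.1.2 p.2 A st)
  (a := fun x => (N x, L x, C x))); last by pt_auto.
rewrite /rescale_step; set f0 := fun _ => _.
apply: (@pt_match _ _ _ _ _ _ _ (fun p : nat * nat * nat * seq (seq int) * (seq nat * seq nat) =>
   nonpositive p.1.1.1.1 p.1.1.1.2 p.1.2 p.2.1 p.2.2)
   (fun p i _ => if (p.1.1.2 <= sumn p.2.2)%N then
      (incr_at p.1.1.1.1 (argmax p.1.1.1.1 p.2.2) p.2.1, mkseq (fun _ => 0%N) p.1.1.1.1)
      else (p.2.1, incr_at p.1.1.1.1 i p.2.2)) (fun p => p.2)).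
- rewrite /nonpositive; apply: pt_filter; first by pt_auto.
  apply: pt_andb; first by pt_auto.
  apply: pt_ler; last by pt_auto.
  apply: pt_nth; last by pt_auto.
  by apply: pt_iterate; pt_auto.
- by pt_auto.
- by pt_auto.
Qed.

Lemma pt_depth_bound {X} {EX : enc X} (D : X -> Prop) (N : X -> nat) (A : X -> seq (seq int)) :
  pt D N -> pt D A -> pt D (fun x => depth_bound (N x) (A x)).
Proof. by apply: (pt_app2 (f := depth_bound)); rewrite /depth_bound /bit_bound; pt_auto. Qed.

Lemma esize_natseq (s : seq nat) : esize s = (2 * sumn s + 2 * size s).+1.
Proof. by elim: s => //= n s IH; rewrite esize_cons esize_nat IH; lia. Qed.

Lemma sumn_incr_at_le N j (s : seq nat) : size s = N -> (sumn (incr_at N j s) <= (sumn s).+1)%N.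
Proof.
move=> sz; case: (ltnP j N) => h; first by rewrite sumn_incr_at.
suff -> : incr_at N j s = s by [].
apply: (@eq_from_nth _ 0%N); rewrite ?size_mkseq // => i iN.
by rewrite nth_mkseq //; case: eqP => // e; move: iN; rewrite e ltnNge h.
Qed.

(** A round adds at most one to all entries together, so the unary state has size linear in the
    number of rounds. *)
Lemma rescale_size N L C A k : let st := iter k (rescale_step N L C A)
    (mkseq (fun _ => 0%N) N, mkseq (fun _ => 0%N) N) in
  [/\ size st.1 = N, size st.2 = N & (sumn st.1 + sumn st.2 <= k)%N].
Proof.
elim: k => [|k [h1 h2 h3]]; first by rewrite /= !size_mkseq sumn_zeros.
rewrite iterS; set st := iter _ _ _ in h1 h2 h3 *.
have b1 := sumn_incr_at_le (argmax N st.2) h1.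
have b2 i := sumn_incr_at_le i h2.
rewrite /rescale_step; case: nonpositive => [|i _]; first by split=> //; lia.
case: ifP => _; split; rewrite ?[(_, _).1]/= ?[(_, _).2]/= ?size_mkseq ?sumn_zeros //; first by lia.
by have := b2 i; lia.
Qed.

Lemma pt_solve {X} {EX : enc X} (D : X -> Prop) (N : X -> nat) (A : X -> seq (seq int)) :
  pt D N -> pt D A -> pt D (fun x => solve (N x) (A x)).
Proof.
apply: (pt_app2 (f := solve)).
set T := fun _ : nat * seq (seq int) => True.
have pL : pt T (fun p : nat * seq (seq int) => depth_bound p.1 p.2) by apply: pt_depth_bound; pt_auto.
have pS : pt T (fun p : nat * seq (seq int) => final_state p.1 p.2).
  have pM : pt T (fun p : nat * seq (seq int) => step_bound p.1 (depth_bound p.1 p.2)).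
    by rewrite /step_bound /cut_bound; pt_auto.
  have [k hk] := pt_size pM.
  apply: (@pt_iter _ _ _ _ _ (fun p : nat * seq (seq int) => step_bound p.1 (depth_bound p.1 p.2))
    (fun p => rescale_step p.1 (depth_bound p.1 p.2) (cut_bound p.1) p.2)
    (fun p => (mkseq (fun _ => 0%N) p.1, mkseq (fun _ => 0%N) p.1))
    (fun n => 2 * (n + 2) ^ k + 4 * n + 3)%N) => //.
  - by pt_auto.
  - apply: (@pt_sub _ _ _ _ _ (fun _ => True)) => //.
    apply: pt_rescale_step; rewrite /cut_bound; last by pt_auto.
    + by pt_auto.
    + by apply: pt_depth_bound; pt_auto.
    + by pt_auto.
    + by pt_auto.
  - by growth.
  move=> p _ i hi; have := rescale_size p.1 (depth_bound p.1 p.2) (cut_bound p.1) p.2 i => /= -[h1 h2 h3].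
  move: h1 h2 h3; case: (iter _ _ _) => e y /= h1 h2 h3; rewrite esize_pair !esize_natseq h1 h2.
  have h4 := hk p I; rewrite esize_nat in h4.
  have h5 : (esize p.1 < esize p)%N by case: (p) => a b; rewrite esize_pair /=; lia.
  by rewrite esize_nat in h5; lia.
rewrite /solve /read_solution; apply: pt_ite; last by pt_auto.
  by pt_auto.
apply/pt_some/pt_mkseq; first by pt_auto.
have p1 : pt (fun y : nat * seq (seq int) * nat => T y.1) (fun y => final_state y.1.1 y.1.2).
  by apply: (pt_comp pS) => //; pt_auto.
have p2 : pt (fun y : nat * seq (seq int) * nat => T y.1) (fun y => depth_bound y.1.1 y.1.2).
  by apply: pt_depth_bound; pt_auto.
apply: pt_mulr; last by pt_auto.
apply: pt_nth; last by pt_auto.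
by apply: pt_iterate; pt_auto.
Qed.

(** * Representatives and chains *)

Definition insert_desc (key : nat -> rat) (l : seq nat) (x : nat) : seq nat :=
  [seq u <- l | key x <= key u] ++ x :: [seq u <- l | ~~ (key x <= key u)].
Definition sort_desc (key : nat -> rat) (l : seq nat) : seq nat := foldl (insert_desc key) [::] l.

Definition select_step (near : rel nat) (rad : nat -> rat) (acc : seq nat) (v : nat) : seq nat :=
  if has (fun u => near u v && (rad u <= 4%:R * rad v)) acc then acc else acc ++ [:: v].
Definition select (near : rel nat) (rad : nat -> rat) (l : seq nat) : seq nat :=
  foldl (select_step near rad) [::] l.

(** Scanning from the end, it puts [v :: c] directly after the last chain [c] whose head is near
    [v]; the flag records that this is done. *)
Definition chain_scan (near : rel nat) (v : nat) (st : bool * seq (seq nat)) (c : seq nat) :=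
  if st.1 then (true, c :: st.2)
  else if near (head 0%N c) v then (true, c :: (v :: c) :: st.2) else (false, c :: st.2).
Definition insert_chain (near : rel nat) (L : seq (seq nat)) (v : nat) : seq (seq nat) :=
  let st := foldl (chain_scan near v) (false, [::]) (rev L) in
  if st.1 then st.2 else [:: v] :: L.
Definition build_chains (near : rel nat) (l : seq nat) : seq (seq nat) :=
  foldl (insert_chain near) [::] l.

(** Counts the maximal blocks of [true], a leading one only if [prev] is false. At most one rise
    means consecutive occurrences. *)
Fixpoint rises (prev : bool) (bs : seq bool) : nat :=
  if bs is b :: bs' then ((~~ prev && b) + rises b bs')%N else 0%N.

Lemma rises_ins_same s1 b s2 prev : rises prev (s1 ++ b :: b :: s2) = rises prev (s1 ++ b :: s2).
Proof. by elim: s1 prev => [|c s IH] prev /=; [case: b; case: prev|rewrite IH]. Qed.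

Lemma rises_le_cons prev b bs : (rises prev bs <= (~~ prev && b) + rises b bs)%N.
Proof. by case: bs => //= c bs; case: prev; case: b; case: c => /=; lia. Qed.

(** Leaving out entries can merge or delete blocks but not split them. So a path, which skips
    chains, still enters the block of a representative at most once. *)
Lemma rises_subseq prev bs bs' : subseq bs bs' -> (rises prev bs <= rises prev bs')%N.
Proof.
elim: bs' bs prev => [|b' bs' IH] [|b bs] prev //=.
case: eqP => [->|_] h; first by rewrite leq_add2l IH.
apply: leq_trans (_ : (~~ prev && b' + rises b' (b :: bs) <= _)%N); last by rewrite leq_add2l IH.
exact: rises_le_cons prev b' (b :: bs).
Qed.

Lemma rises_has bs : (0 < rises false bs)%N = has id bs.
Proof. by elim: bs => //= -[] bs IH //=; rewrite add0n. Qed.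

Lemma sort_desc_perm key l : perm_eq (sort_desc key l) l.
Proof.
rewrite /sort_desc; elim/last_ind: l => // l x IH.
rewrite foldl_rcons perm_sym perm_rcons perm_sym /insert_desc.
set s := foldl _ _ _ in IH *; rewrite -[x :: filter _ _]cat1s perm_catCA /= perm_cons.
by apply: perm_trans IH; apply/permPl/perm_filterC.
Qed.

Lemma sort_desc_pairwise key l : pairwise (fun u v => key v <= key u) (sort_desc key l).
Proof.
rewrite /sort_desc; elim/last_ind: l => // l x IH; rewrite foldl_rcons /insert_desc.
set s := foldl _ _ _ in IH *.
rewrite pairwise_cat pairwise_cons; apply/and3P; split.
- apply/allrelP => u v; rewrite mem_filter inE => /andP[xu _] /orP[/eqP->//|].
  by rewrite mem_filter -ltNge => /andP[/ltW vx _]; apply: le_trans xu.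
- exact: pairwise_filter.
apply/andP; split; last exact: pairwise_filter.
by apply/allP => v; rewrite mem_filter -ltNge => /andP[/ltW].
Qed.

Lemma pairwise_mem (T : eqType) (R : rel T) s u v :
  pairwise R s -> u \in s -> v \in s -> u != v -> R u v || R v u.
Proof.
elim: s => //= a s IH /andP[/allP h hs]; rewrite !inE => /orP[/eqP->|us] /orP[/eqP->|vs] uv.
- by rewrite eqxx in uv.
- by rewrite h.
- by rewrite h ?orbT.
- exact: IH.
Qed.

(** * Geometry of the representatives and the chain invariant *)

Section Metric.
Variables (n : nat) (d : nat -> nat -> rat) (r prob : nat -> rat).
Hypothesis d_refl : forall u, (u < n)%N -> d u u = 0.
Hypothesis d_sym : forall u v, (u < n)%N -> (v < n)%N -> d u v = d v u.
Hypothesis d_tri : forall u v w, (u < n)%N -> (v < n)%N -> (w < n)%N -> d u w <= d u v + d v w.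
Hypothesis r_gt0 : forall u, (u < n)%N -> 0 < r u.

Definition near u v := (d u v <= r u + 2%:R * r v) && (d u v <= r v + 2%:R * r u).

Lemma near_sym u v : (u < n)%N -> (v < n)%N -> near u v = near v u.
Proof. by move=> un vn; rewrite /near (d_sym un vn) andbC. Qed.

(** Through [v] the distance is at most [r u + r w + 4 r v], and [4 r v] is less than either of the
    other two radii. *)
Lemma near_trans u v w : (u < n)%N -> (v < n)%N -> (w < n)%N ->
  near u v -> near w v -> 4%:R * r v < r u -> 4%:R * r v < r w -> near u w.
Proof.
move=> un vn wn /andP[h1 h2] /andP[h3 h4] h5 h6.
have := d_tri un vn wn; rewrite (d_sym vn wn) => h7.
by rewrite /near; apply/andP; split; lra.
Qed.

(** Balls with a common point belong to near representatives. Hence one center can hit several balls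
    only if their radii are widely separated. *)
Lemma near_cover u v s : (u < n)%N -> (v < n)%N -> (s < n)%N ->
  d u s <= r u -> d v s <= r v -> near u v.
Proof.
move=> un vn sn h1 h2; have := d_tri un sn vn; rewrite (d_sym sn vn) => h3.
by have := r_gt0 un; have := r_gt0 vn; rewrite /near => h4 h5; apply/andP; split; lra.
Qed.

Definition separated (s : seq nat) := forall u v, u \in s -> v \in s -> u != v -> near u v ->
  (4%:R * r u < r v) || (4%:R * r v < r u).

Lemma selectP l (R := select near r l) : uniq l -> all (gtn n) l -> pairwise (fun u v => prob v <= prob u) l ->
  [/\ uniq R, {subset R <= l}, separated R
    & forall v, v \in l -> exists u, [/\ u \in R, near u v, r u <= 4%:R * r v & prob v <= prob u]].
Proof.
rewrite /R /select => {R} ul ln pl.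
suff [h1 h2 h3 h4] : let R := foldl (select_step near r) [::] l in
  [/\ uniq R, {subset R <= l}, pairwise (fun u v => ~~ (near u v && (r u <= 4%:R * r v))) R
    & forall v, v \in l -> exists u, [/\ u \in R, near u v, r u <= 4%:R * r v & prob v <= prob u]].
  split=> // u v uR vR uv nuv.
  have un : (u < n)%N by move/allP: ln; apply; apply: h2.
  have vn : (v < n)%N by move/allP: ln; apply; apply: h2.
  have := pairwise_mem h3 uR vR uv; rewrite (near_sym vn un) nuv /= -!ltNge => /orP[->|->]; by rewrite ?orbT.
elim/last_ind: l ul ln pl => [|l x IH] //=; rewrite rcons_uniq all_rcons pairwise_rcons.
move=> /andP[xl ul] /andP[xn ln] /andP[px pl]; have [h1 h2 h3 h4] := IH ul ln pl; rewrite foldl_rcons.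
set R := foldl _ _ _ in h1 h2 h3 h4 *; rewrite /= /select_step.
have memx : x \in rcons l x by rewrite mem_rcons inE eqxx.
have sub : {subset l <= rcons l x} by move=> y yl; rewrite mem_rcons inE yl orbT.
case: ifP => hx.
  split=> //; first by move=> y /h2 /sub.
  move=> v; rewrite mem_rcons inE => /orP[/eqP->|/h4 //].
  have [u uR /andP[a b]] := hasP hx; exists u; split=> //.
  by move/allP: px; apply; apply: h2.
rewrite cats1; split.
- by rewrite rcons_uniq h1 andbT; apply: contra xl; apply: h2.
- by move=> y; rewrite mem_rcons inE => /orP[/eqP->//|/h2 /sub].
- by rewrite pairwise_rcons h3 andbT all_predC hx.
move=> v; rewrite mem_rcons inE => /orP[/eqP->|/h4 [u [a b c e]]].
  have rx := r_gt0 xn; exists x; split=> //; first by rewrite mem_rcons inE eqxx.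
    by rewrite /near d_refl //; apply/andP; split; lra.
  by lra.
by exists u; split=> //; rewrite mem_rcons inE a orbT.
Qed.

Lemma insert_chainP L v :
  (all (fun c => ~~ near (head 0%N c) v) L /\ insert_chain near L v = [:: v] :: L) \/
  exists L1 c L2, [/\ L = L1 ++ c :: L2, near (head 0%N c) v,
    all (fun c => ~~ near (head 0%N c) v) L2 & insert_chain near L v = L1 ++ c :: (v :: c) :: L2].
Proof.
rewrite /insert_chain foldl_rev; set f := (fun c st => chain_scan near v st c).
have : let st := foldr f (false, [::]) L in
  (~~ st.1 /\ all (fun c => ~~ near (head 0%N c) v) L /\ st.2 = L) \/
  (st.1 /\ exists L1 c L2, [/\ L = L1 ++ c :: L2, near (head 0%N c) v,
    all (fun c => ~~ near (head 0%N c) v) L2 & st.2 = L1 ++ c :: (v :: c) :: L2]).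
  elim: L => [|c L IH] /=; first by left.
  move: IH; case: (foldr f _ L) => [b s] /=; rewrite /f /chain_scan /=.
  case=> [[nb [h1 ->]]|[-> [L1 [c' [L2 [-> h1 h2 ->]]]]]]; last first.
    by right; split=> //; exists (c :: L1), c', L2.
  rewrite (negPf nb); case: ifP => hc /=; last by left; rewrite h1.
  by right; split=> //; exists [::], c, L.
case=> [[nb [h1 _]]|[-> h]]; last by right.
by left; rewrite (negPf nb).
Qed.

(* [ci_rises] says that the chains through [u] are consecutive in [L]. *)
Record chain_inv (Q : seq nat) (L : seq (seq nat)) : Prop := ChainInv {
  ci_heads : perm_eq (map (head 0%N) L) Q;
  ci_nil : [::] \notin L;
  ci_sub : forall c u, c \in L -> u \in c -> u \in Q;
  ci_rises : forall u, (rises false [seq u \in c | c <- L] <= 1)%N;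
  ci_first : forall u, u \in Q -> head 0%N (head [::] [seq c <- L | u \in c]) = u;
  ci_closed : forall c u, c \in L -> u \in Q -> near u (head 0%N c) -> r (head 0%N c) <= r u -> u \in c;
  ci_chain : forall c, c \in L -> sorted (fun a b => near b a && (4%:R * r a < r b)) c
}.

(** The chain of [v] extends that of its smallest larger neighbour [q]. Placed right after the chain
    headed by [q], it lengthens by one the block of each member of that chain and interrupts no
    other block. *)
Lemma chain_inv_insert Q L v : chain_inv Q L -> uniq Q -> v \notin Q -> all (gtn n) Q -> (v < n)%N ->
  separated Q -> (forall u, u \in Q -> r v <= r u /\ (near u v -> 4%:R * r v < r u)) ->
  chain_inv (rcons Q v) (insert_chain near L v).
Proof.
move=> [ih i0 isub iris ifst icl ich] uQ vQ Qn vn sepQ hv; have rv := r_gt0 vn.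
have headQ c : c \in L -> head 0%N c \in Q by move=> cL; rewrite -(perm_mem ih) map_f.
have vnc c : c \in L -> (v \in c) = false.
  by move=> cL; apply/negP => vc; case/negP: vQ; apply: isub vc.
have uheads : uniq (map (head 0%N) L) by rewrite (perm_uniq ih).
have old c u : c \in L -> u \in rcons Q v -> near u (head 0%N c) -> r (head 0%N c) <= r u -> u \in c.
  move=> cL; rewrite mem_rcons inE => /orP[/eqP->|uQ']; last exact: icl.
  have hn := allP Qn _ (headQ c cL); rewrite near_sym // => nr.
  by have [_ /(_ nr)] := hv _ (headQ c cL); lra.
have norise s : all (fun b => ~~ b) s -> rises false s = 0%N.
  by elim: s => //= -[].
have bits_v s : {subset s <= L} -> [seq v \in c | c <- s] = nseq (size s) false.
  elim: s => //= c s IH sub; rewrite vnc ?sub ?inE ?eqxx // IH // => y ys.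
  by apply: sub; rewrite inE ys orbT.
have ris_nseq m : rises false (nseq m false) = 0%N by elim: m.
case: (insert_chainP L v) => [[far ->]|[L1 [p [L2 [EL np far ->]]]]].
  split.
  - by rewrite /= perm_sym perm_rcons perm_cons perm_sym.
  - by rewrite inE negb_or i0.
  - move=> c u; rewrite inE => /orP[/eqP->|cL uc]; rewrite mem_rcons inE; first by rewrite inE => ->.
    by rewrite (isub c u) ?orbT.
  - move=> u /=; rewrite inE; case: eqP => [->|_]; last exact: iris.
    by rewrite bits_v //= ; case: (size L) => //= m; rewrite ris_nseq.
  - move=> u; rewrite mem_rcons inE /= inE; case: eqP => [->//|_] /= uQ'; exact: ifst.
  - move=> c u; rewrite inE => /orP[/eqP->|cL]; last exact: old.
    rewrite /= mem_rcons !inE => /orP[-> //|uQ' nu _].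
    have : u \in map (head 0%N) L by rewrite (perm_mem ih).
    by case/mapP => c' c'L e; move/allP: far => /(_ _ c'L); rewrite -e nu.
  - by move=> c; rewrite inE => /orP[/eqP->|/ich].
have pL : p \in L by rewrite EL mem_cat inE eqxx orbT.
have [p' pE] : exists p', p = head 0%N p :: p'.
  by move: i0; case: (p) pL => [->//|a p'] _ _; exists p'.
have hpp : head 0%N p \in p by rewrite pE inE eqxx.
set L' := L1 ++ p :: (v :: p) :: L2.
have memL' c : (c \in L') = (c == v :: p) || (c \in L).
  by rewrite /L' EL !mem_cat !inE; case: (c \in L1); case: (c == p); case: (c == v :: p); case: (c \in L2).
have sub1 : {subset L1 <= L} by move=> c h; rewrite EL mem_cat h.
have sub2 : {subset L2 <= L} by move=> c h; rewrite EL mem_cat inE h !orbT.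
split.
- rewrite map_cat /= perm_sym perm_rcons perm_sym.
  rewrite -cat_rcons -[v :: map _ L2]cat1s perm_catCA /= cat_rcons perm_cons.
  by move: ih; rewrite EL map_cat.
- by rewrite memL' negb_or i0.
- move=> c u; rewrite memL' mem_rcons inE => /orP[/eqP->|cL uc]; last by rewrite (isub c u) ?orbT.
  by rewrite inE => /orP[->//|up]; rewrite (isub p u) ?orbT.
- move=> u; case: (eqVneq u v) => [->|uv].
    rewrite /L' map_cat /= inE eqxx /= !bits_v // vnc //.
    elim: (size L1) => [|m IH] //=.
    by case: (size L2) => [|m'] //=; rewrite ris_nseq.
  have := iris u; rewrite EL /L' !map_cat /= inE (negPf uv) /=.
  by rewrite rises_ins_same.
- move=> u; rewrite mem_rcons inE => /orP[/eqP->|uQ'].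
    rewrite /L' filter_cat /= inE eqxx /= vnc //.
    have -> : [seq c <- L1 | v \in c] = [::].
      by apply/eqP; rewrite -[_ == _]negbK -has_filter; apply/hasPn => c cL; rewrite vnc ?sub1.
    by [].
  have uv : u != v by apply: contraNneq vQ => <-.
  have := ifst u uQ'; rewrite EL /L' !filter_cat /= inE (negPf uv) /=.
  by case: [seq c <- L1 | u \in c] => //=; case: (u \in p).
- move=> c u; rewrite memL' => /orP[/eqP->|cL]; last exact: old.
  rewrite /= mem_rcons !inE => /orP[-> //|uQ' nu _]; apply/orP; right.
  have pQ := headQ p pL; set q := head 0%N p in pQ np hpp *.
  have un := allP Qn _ uQ'; have qn := allP Qn _ pQ.
  case: (eqVneq u q) => [->//|uq].
  have [_ /(_ nu) ru] := hv u uQ'; have [_ /(_ np) rq] := hv q pQ.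
  have nuq := near_trans un vn qn nu np ru rq.
  have [lt|lt] := orP (sepQ u q uQ' pQ uq nuq); last by apply: icl => //; have := r_gt0 qn; rewrite -/q; lra.
  (* Were [u] smaller than [q], its own chain would contain [q]. It lies in [L1], as no head in [L2]
     is near [v], so it precedes the chain headed by [q], which by [ci_first] is the first one
     through [q]. *)
  exfalso; have : u \in map (head 0%N) L by rewrite (perm_mem ih).
  case/mapP => cu cuL eu; have qcu : q \in cu.
    by apply: icl => //; rewrite -eu ?(near_sym qn un) //; have := r_gt0 un; lra.
  have cu1 : cu \in L1.
    move: cuL; rewrite EL mem_cat inE => /or3P[//|/eqP e|c2].
      by move: uq; rewrite eu e eqxx.
    by move/allP: far => /(_ _ c2); rewrite -eu nu.
  have : head [::] [seq c <- L | q \in c] \in L1.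
    rewrite EL filter_cat; have : cu \in [seq c <- L1 | q \in c] by rewrite mem_filter qcu.
    case E : [seq c <- L1 | q \in c] => [//|a s] _ /=.
    have ain : a \in [seq c <- L1 | q \in c] by rewrite E inE eqxx.
    by move: ain; rewrite mem_filter => /andP[].
  have := ifst q pQ; move: (head [::] _) => c' hc' c'L1.
  move: uheads; rewrite EL map_cat cat_uniq => /and3P[_ /hasPn h _].
  have := h q; rewrite /= inE eqxx => /(_ isT).
  by move/negP; case; rewrite -hc'; apply: map_f.
- move=> c; rewrite memL' => /orP[/eqP->|/ich //].
  rewrite pE /= np /=; have [_ /(_ np) ->] := hv _ (headQ p pL); rewrite /=.
  by have := ich p pL; rewrite pE.
Qed.

Lemma build_chainsP l : uniq l -> all (gtn n) l -> separated l -> pairwise (fun u v => r v <= r u) l ->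
  chain_inv l (build_chains near l).
Proof.
rewrite /build_chains; elim/last_ind: l => [|l v IH] ul ln sl pl; first by split.
move: ul ln pl; rewrite rcons_uniq all_rcons pairwise_rcons => /andP[vl ul] /andP[vn ln] /andP[pv pl].
have sub : {subset l <= rcons l v} by move=> y yl; rewrite mem_rcons inE yl orbT.
have sl' : separated l by move=> a b al bl; apply: sl; apply: sub.
rewrite foldl_rcons; apply: chain_inv_insert => //; first exact: IH.
move=> u ul'; have ruv : r v <= r u by move/allP: pv; apply.
split=> // nuv; have uv : u != v by apply: contraNneq vl => <-.
have vr : v \in rcons l v by rewrite mem_rcons inE eqxx.
have := sl u v (sub u ul') vr uv nuv; have := r_gt0 vn; have := allP ln _ ul' => /r_gt0.
by move=> a b /orP[|//]; lra.
Qed.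

(** Induction up the chain: from [t] to the next larger [b] the distance is at most
    [2 r t + (r b + 2 r t)], and [4 r t < r b]. *)
Lemma chain_serve Q L c u x : chain_inv Q L -> all (gtn n) Q -> c \in L -> u \in c -> (x < n)%N ->
  d x (head 0%N c) <= 2%:R * r (head 0%N c) -> d x u <= 2%:R * r u.
Proof.
move=> iv Qn cL uc xn hx; have := ci_chain iv cL.
have cn : forall y, y \in c -> (y < n)%N by move=> y yc; apply: (allP Qn); exact: (ci_sub iv cL yc).
case: c cL uc hx cn => // t c _ uc hx cn /=; elim: c t uc hx cn => [|b c IH] t uc hx cn /=.
  by move: uc; rewrite inE => /eqP ->.
move=> /andP[/andP[/andP[h1 h2] h3] hc]; move: uc; rewrite inE => /orP[/eqP->//|uc].
have tn : (t < n)%N by apply: cn; rewrite inE eqxx.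
have bn : (b < n)%N by apply: cn; rewrite !inE eqxx orbT.
apply: (IH b) => //; last by move=> y yc; apply: cn; rewrite inE yc orbT.
by have := d_tri xn tn bn; rewrite (d_sym tn bn); move: hx => /=; lra.
Qed.

End Metric.

(** * Flows and their decomposition into paths *)

(* A node [(i, s)] records the last bought item (0 for none) and the money spent;
   the edge [(i, s, k)] buys item [k], or ends the path if [k = 0]. *)
Definition node : eqType := (nat * rat)%type.
Definition edge : eqType := (nat * rat * nat)%type.

Definition nodes (m : nat) (sums : seq rat) : seq node :=
  flatten [seq [seq (i, s) | s <- sums] | i <- iota 0 m.+1].
Definition arc_ok (c sums : seq rat) (a : edge) : bool :=
  (a.2 == 0%N) || ((a.1.1 < a.2)%N && (a.1.2 + nth 0 c a.2 \in sums)).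
Definition arcs (m : nat) (c sums : seq rat) : seq edge :=
  [seq a <- flatten [seq [seq (v, k) | k <- iota 0 m.+1] | v <- nodes m sums] | arc_ok c sums a].
Definition arc_end (c : seq rat) (a : edge) : node := (a.2, a.1.2 + nth 0 c a.2).
Definition into (c : seq rat) (v : node) (a : edge) : bool := (a.2 != 0%N) && (arc_end c a == v).
Definition outof (v : node) (a : edge) : bool := a.1 == v.
(** The arcs entering the block of chains through [u]. A path whose items meet this block in one run
    has exactly one such arc if it serves [u] and none otherwise. *)
Definition crossing (ch : seq (seq nat)) (u : nat) (a : edge) : bool :=
  [&& a.2 != 0%N, u \in nth [::] ch a.2 & u \notin nth [::] ch a.1.1].
Definition source : node := (0%N, 0).

Fixpoint path_arcs (c : seq rat) (v : node) (ps : seq nat) : seq edge :=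
  if ps is k :: ps' then (v, k) :: path_arcs c (arc_end c (v, k)) ps' else [:: (v, 0%N)].

Definition candidates (fl : seq (edge * rat)) (v : node) : seq (edge * rat) :=
  [seq p <- fl | (p.1.1 == v) && (0 < p.2)].
(** The walk is stored backwards. Once its head is an ending arc it is a fixed point, so a fixed
    number of rounds can be run. *)
Definition extend (c : seq rat) (fl : seq (edge * rat)) (acc : seq edge) : seq edge :=
  if ~~ nilp acc && ((head (source, 0%N) acc).2 == 0%N) then acc else
  match candidates fl (if nilp acc then source else arc_end c (head (source, 0%N) acc)) with
  | p :: _ => p.1 :: acc
  | [::] => acc
  end.
Definition walk (m : nat) (c : seq rat) (fl : seq (edge * rat)) : seq edge :=
  iter m.+1 (extend c fl) [::].
Definition bottleneck (fl : seq (edge * rat)) (acc : seq edge) : rat :=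
  head 0 [seq t <- [seq p.2 | p <- [seq p <- fl | p.1 \in acc]] |
     all (fun t' => t <= t') [seq p.2 | p <- [seq p <- fl | p.1 \in acc]]].
Definition subtract (fl : seq (edge * rat)) (acc : seq edge) : seq (edge * rat) :=
  [seq (p.1, if p.1 \in acc then p.2 - bottleneck fl acc else p.2) | p <- fl].
Definition peel (m : nat) (c : seq rat) (st : seq (edge * rat) * seq (seq edge * rat)) :=
  if nilp (walk m c st.1) then st
  else (subtract st.1 (walk m c st.1), (walk m c st.1, bottleneck st.1 (walk m c st.1)) :: st.2).
Definition decompose (m : nat) (c : seq rat) (fl : seq (edge * rat)) : seq (seq edge * rat) :=
  (iter (size fl) (peel m c) (fl, [::])).2.

Lemma uniq_key_inj (S T : eqType) (f : S -> T) s p q : uniq (map f s) -> p \in s -> q \in s -> f p = f q -> p = q.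
Proof.
elim: s => //= a s IH /andP[/mapP h us]; rewrite !inE => /orP[/eqP->|ps] /orP[/eqP->|qs] e //.
- by case: h; exists q.
- by case: h; exists p.
- exact: IH.
Qed.

(** * Paths and path decomposition *)

Section Flow.
Variables (m : nat) (c sums : seq rat).
Hypothesis sums_uniq : uniq sums.
Local Notation A := (arcs m c sums).

Lemma nodesE v : (v \in nodes m sums) = (v.1 <= m)%N && (v.2 \in sums).
Proof.
case: v => i s; apply/flattenP/andP => [[l /mapP[j]]|[im ss]].
  by rewrite mem_iota => jm -> /mapP[s' s's [-> ->]].
exists [seq (i, s) | s <- sums]; last exact: (map_f (pair i)).
by apply/mapP; exists i; rewrite ?mem_iota.
Qed.

Lemma nodes_uniq : uniq (nodes m sums).
Proof.
apply: (@allpairs_uniq _ _ _ (fun i s => (i, s))); rewrite ?iota_uniq //.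
by move=> [a b] [a' b'] _ _ [-> ->].
Qed.

Lemma arcsE a : (a \in A) = [&& (a.1.1 <= m)%N, a.1.2 \in sums, (a.2 <= m)%N & arc_ok c sums a].
Proof.
rewrite mem_filter andbC; case: a => v k.
have -> : ((v, k) \in flatten [seq [seq (v, k) | k <- iota 0 m.+1] | v <- nodes m sums]) =
    (v \in nodes m sums) && (k <= m)%N.
  apply/flattenP/andP => [[l /mapP[w wn ->] /mapP[j]]|[vn km]].
    by rewrite mem_iota => jm [-> ->].
  exists [seq (v, k) | k <- iota 0 m.+1]; last by apply: (map_f (pair v)); rewrite mem_iota.
  by apply/mapP; exists v.
by rewrite nodesE -!andbA.
Qed.

Lemma arcs_uniq : uniq A.
Proof.
apply: filter_uniq; apply: (@allpairs_uniq _ _ _ (fun v k => (v, k))); rewrite ?iota_uniq ?nodes_uniq //.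
by move=> [a b] [a' b'] _ _ [-> ->].
Qed.

Fixpoint path_ok (v : node) (ps : seq nat) : bool :=
  if ps is k :: ps' then
    [&& (v.1 < k <= m)%N, v.2 + nth 0 c k \in sums & path_ok (arc_end c (v, k)) ps']
  else true.

Lemma path_arcs_sub v ps : path_ok v ps -> (v.1 <= m)%N -> v.2 \in sums -> {subset path_arcs c v ps <= A}.
Proof.
elim: ps v => [|k ps IH] v /=.
  by move=> _ vm vs a; rewrite inE => /eqP->; rewrite arcsE vm vs /arc_ok eqxx.
case/and3P=> /andP[vk km] sk ok vm vs a; rewrite inE => /orP[/eqP->|].
  by rewrite arcsE /arc_ok /= vm vs km vk sk orbT.
exact: IH.
Qed.

Lemma path_arcs_src v ps a : path_ok v ps -> a \in path_arcs c v ps -> (v.1 <= a.1.1)%N.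
Proof.
elim: ps v => [|k ps IH] v /=; first by move=> _; rewrite inE => /eqP->.
case/and3P=> /andP[vk _] _ ok; rewrite inE => /orP[/eqP->//|/(IH _ ok) /=].
by apply: leq_trans; apply: ltnW.
Qed.

Lemma path_arcs_uniq v ps : path_ok v ps -> uniq (path_arcs c v ps).
Proof.
elim: ps v => [|k ps IH] v //= /and3P[/andP[vk _] _ ok]; rewrite IH // andbT.
by apply/negP => /(path_arcs_src ok) /=; rewrite leqNgt vk.
Qed.

(** The ending arc counts as leaving the last node, so the only imbalance is the unit that starts at
    [v0]. *)
Lemma path_conserve v0 ps v : path_ok v0 ps ->
  (count (into c v) (path_arcs c v0 ps) + (v == v0) = count (outof v) (path_arcs c v0 ps))%N.
Proof.
elim: ps v0 => [|k ps IH] v0 /=; first by rewrite /into /outof /= eq_sym !addn0 add0n.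
case/and3P=> /andP[vk _] _ ok; rewrite -IH // /into /outof /=.
have -> : (k != 0)%N by rewrite -lt0n (leq_ltn_trans _ vk).
by rewrite /= [v0 == v]eq_sym [v == arc_end _ _]eq_sym; lia.
Qed.

Lemma path_crossing ch u v0 ps : path_ok v0 ps ->
  count (crossing ch u) (path_arcs c v0 ps) =
  rises (u \in nth [::] ch v0.1) [seq u \in nth [::] ch k | k <- ps].
Proof.
elim: ps v0 => [|k ps IH] v0 //= /and3P[/andP[vk _] _ ok]; rewrite IH // /crossing /=.
have -> : (k != 0)%N by rewrite -lt0n (leq_ltn_trans _ vk).
by rewrite /= andbC.
Qed.

Lemma sum_count_mem (K : pzSemiRingType) (s l : seq edge) (Q : pred edge) : uniq s -> {subset l <= s} ->
  \sum_(a <- s | Q a) (count_mem a l)%:R = (count Q l)%:R :> K.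
Proof.
move=> us; elim: l => [|b l IH] sub; first by rewrite big1.
rewrite /= natrD -IH; last by move=> a al; apply: sub; rewrite inE al orbT.
have bs : b \in s by apply: sub; rewrite inE eqxx.
transitivity (\sum_(a <- s | Q a) (((b == a) : nat)%:R + (count_mem a l)%:R) : K).
  by apply: eq_bigr => a _; rewrite natrD.
rewrite big_split /=; congr (_ + _); rewrite (big_rem b bs) /= eqxx.
rewrite big_seq_cond big1 ?addr0; first by case: (Q b).
move=> a /andP[]; rewrite mem_rem_uniq // inE => /andP[ab _] _.
by rewrite eq_sym (negPf ab).
Qed.

Definition conserved (fl : seq (edge * rat)) (h : rat) := forall v, v \in nodes m sums ->
  \sum_(p <- fl | into c v p.1) p.2 + (v == source)%:R * h = \sum_(p <- fl | outof v p.1) p.2.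

Definition nonneg_flow (fl : seq (edge * rat)) := map fst fl = A /\ forall p, p \in fl -> 0 <= p.2.

Lemma nonneg_sum (fl : seq (edge * rat)) (Q : pred edge) : (forall p, p \in fl -> 0 <= p.2) ->
  0 <= \sum_(p <- fl | Q p.1) p.2.
Proof. by move=> h; rewrite big_seq_cond sumr_ge0 // => p /andP[/h]. Qed.

Lemma sum_gt0_has (fl : seq (edge * rat)) (Q : pred edge) :
  0 < \sum_(p <- fl | Q p.1) p.2 -> has (fun p => Q p.1 && (0 < p.2)) fl.
Proof.
apply: contraLR => /hasPn h; rewrite -leNgt big_seq_cond; apply: sumr_le0 => p /andP[pf qp].
by have := h p pf; rewrite qp /= -leNgt.
Qed.

Lemma sum_ge_mem (fl : seq (edge * rat)) (Q : pred edge) p : (forall p, p \in fl -> 0 <= p.2) ->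
  p \in fl -> Q p.1 -> p.2 <= \sum_(p <- fl | Q p.1) p.2.
Proof.
move=> h pf qp; rewrite (big_rem p pf) /= qp lerDl nonneg_sum // => q /mem_rem; exact: h.
Qed.

(** Forward form of [walk], whose accumulator grows backwards; it suits induction along the path. *)
Fixpoint walk_from (fuel : nat) (fl : seq (edge * rat)) (v : node) : seq edge :=
  if fuel is f.+1 then
    match candidates fl v with
    | p :: _ => if p.1.2 == 0%N then [:: p.1] else p.1 :: walk_from f fl (arc_end c p.1)
    | [::] => [::]
    end
  else [::].

Lemma walk_fromE fuel fl acc : ~~ (~~ nilp acc && ((head (source, 0%N) acc).2 == 0%N)) ->
  iter fuel (extend c fl) acc =
  catrev (walk_from fuel fl (if nilp acc then source else arc_end c (head (source, 0%N) acc))) acc.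
Proof.
elim: fuel acc => // fuel IH acc ns; rewrite iterSr /=.
rewrite {2}/extend (negPf ns); case E : candidates => [|p l].
  by rewrite iter_fix // /extend (negPf ns) E.
case: eqP => p0; first by rewrite iter_fix // /extend /= p0.
by rewrite IH //=; apply/eqP.
Qed.

(** Positive outflow supplies an arc with positive flow, whose end then has positive inflow and
    hence positive outflow. Items increase strictly along arcs, so the fuel suffices to reach an
    ending arc. *)
Lemma walk_fromP fl h v fuel : nonneg_flow fl -> conserved fl h -> 0 <= h ->
  v \in nodes m sums -> 0 < \sum_(p <- fl | outof v p.1) p.2 -> (m < fuel + v.1)%N ->
  exists ps, [/\ walk_from fuel fl v = path_arcs c v ps, path_ok v ps
    & forall a, a \in path_arcs c v ps -> exists2 x, (a, x) \in fl & 0 < x].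
Proof.
move=> [keys nn] cons h0; elim: fuel v => [|fuel IH] v vn pos hm.
  by move: vn; rewrite nodesE add0n in hm *; rewrite leqNgt hm.
have := sum_gt0_has pos; rewrite /= has_filter -/(candidates fl v).
case E : candidates => [//|[a x] l] _ /=.
have : (a, x) \in candidates fl v by rewrite E inE eqxx.
rewrite mem_filter /= => /andP[/andP[/eqP av x0] axfl].
have aA : a \in A by rewrite -keys (map_f fst axfl).
case: eqP => ak.
  exists [::]; rewrite /= -av; split=> //; first by case: (a) ak => w k /= ->.
  by move=> b; rewrite inE => /eqP->; exists x => //; case: (a) ak axfl => w k /= ->.
have k0 : (a.2 != 0)%N by apply/eqP.
move: (aA); rewrite arcsE /arc_ok (negPf k0) /= => /and4P[am as_ km /andP[ik sk]].
have v'n : arc_end c a \in nodes m sums by rewrite nodesE /= km sk.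
have pos' : 0 < \sum_(p <- fl | outof (arc_end c a) p.1) p.2.
  rewrite -cons // ltr_pwDl ?mulr_ge0 ?ler0n //.
  apply: lt_le_trans x0 _.
  by apply: (@sum_ge_mem fl (into c (arc_end c a)) (a, x)); rewrite // /into k0 eqxx.
have [|ps [e ok hps]] := IH _ v'n pos'.
  by rewrite /= in hm ik *; rewrite av in ik; lia.
have ea : a = (v, a.2) by rewrite -av; case: (a).
exists (a.2 :: ps); rewrite /= e -!ea; split=> //.
  by rewrite ok -av ik km sk.
by move=> b; rewrite inE => /orP[/eqP->|/hps //]; exists x.
Qed.

Lemma walkP fl h : nonneg_flow fl -> conserved fl h -> 0 <= h -> 0 \in sums ->
  if h == 0 then walk m c fl = [::] else
  exists ps, [/\ walk m c fl = rev (path_arcs c source ps), path_ok source ps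
    & forall a, a \in path_arcs c source ps -> exists2 x, (a, x) \in fl & 0 < x].
Proof.
move=> nf cons h0 s0; have src : source \in nodes m sums by rewrite nodesE.
rewrite /walk walk_fromE //= -/(rev _).
(* With value 0, flow out of the source would need flow into it, which only an arc buying item 0
   could carry. *)
case: eqP => hh.
  rewrite /=; case E : candidates => [//|p l].
  have : p \in candidates fl source by rewrite E inE eqxx.
  rewrite mem_filter => /andP[/andP[/eqP ps p0] pf]; have [_ nn] := nf.
  have := cons _ src; rewrite hh eqxx mulr0 addr0 => e.
  have : 0 < \sum_(p <- fl | into c source p.1) p.2.
    rewrite e; apply: lt_le_trans p0 _; apply: (@sum_ge_mem fl (outof source)) => //.
    by rewrite /outof ps.
  move/sum_gt0_has/hasP => [q _ /andP[/andP[q0 /eqP e'] _]].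
  have e0 : q.1.2 = 0%N := congr1 fst e'.
  by rewrite e0 in q0.
have pos : 0 < \sum_(p <- fl | outof source p.1) p.2.
  rewrite -cons // eqxx mul1r ltr_wpDl ?nonneg_sum //; first by case: nf.
  by rewrite lt_neqAle h0 andbT eq_sym; apply/eqP.
have [|ps [e ok hps]] := walk_fromP (fuel := m.+1) nf cons h0 src pos; first by rewrite addn0.
exists ps; split=> //; by rewrite -[LHS]/(rev (walk_from m.+1 fl source)) e.
Qed.

Lemma bottleneckP fl acc : (forall p, p \in fl -> 0 <= p.2) ->
  (exists2 p, p \in fl & p.1 \in acc) ->
  [/\ 0 <= bottleneck fl acc, forall p, p \in fl -> p.1 \in acc -> bottleneck fl acc <= p.2
    & exists p, [/\ p \in fl, p.1 \in acc & p.2 = bottleneck fl acc]].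
Proof.
move=> nn [p0 p0f p0a]; rewrite /bottleneck.
set q := [seq p.2 | p <- [seq p <- fl | p.1 \in acc]].
have qP t : t \in q -> exists p, [/\ p \in fl, p.1 \in acc & p.2 = t].
  by case/mapP => p; rewrite mem_filter => /andP[pa pf] ->; exists p.
have [t tq tmin] : exists2 t, t \in q & all (fun t' => t <= t') q.
  have : p0.2 \in q by apply: map_f; rewrite mem_filter p0a.
  elim: (q) (p0.2) => // a s IH z; rewrite inE => _.
  case: s IH => [|b s] IH; first by exists a; rewrite ?mem_head //= lexx.
  have [t ts tmin] := IH b (mem_head _ _).
  case: (leP a t) => at_; [exists a|exists t].
  - exact: mem_head.
  - rewrite /= lexx /=; apply: (@sub_all _ _ _ _ _ tmin) => y; exact: le_trans.
  - by rewrite inE ts orbT.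
  - by rewrite /= (ltW at_).
have : head 0 [seq t <- q | all (fun t' => t <= t') q] \in [seq t <- q | all (fun t' => t <= t') q].
  have : t \in [seq t <- q | all (fun t' => t <= t') q] by rewrite mem_filter tmin.
  by case: [seq t <- q | _] => //= a l _; rewrite mem_head.
rewrite mem_filter => /andP[/allP hmin hq]; have [p [pf pa e]] := qP _ hq.
split; [by rewrite -e nn| |by exists p].
by move=> p' p'f p'a; apply: hmin; apply: map_f; rewrite mem_filter p'a.
Qed.

Lemma sum_subtract fl acc (Q : pred edge) : map fst fl = A -> uniq acc -> {subset acc <= A} ->
  \sum_(p <- subtract fl acc | Q p.1) p.2 =
  \sum_(p <- fl | Q p.1) p.2 - bottleneck fl acc * (count Q acc)%:R.
Proof.
move=> keys ua sub; rewrite big_map /=.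
rewrite -(@sum_count_mem _ A acc Q arcs_uniq sub) -keys big_map mulr_sumr -sumrB.
apply: eq_bigr => p _; rewrite count_uniq_mem //.
by case: ifP; rewrite ?mulr1 ?mulr0 ?subr0.
Qed.

(** Induction on the item of the tail: arcs increase the item, so all arcs into a node are already
    known to be empty. *)
Lemma flow_vanish fl : nonneg_flow fl -> conserved fl 0 -> forall p, p \in fl -> p.2 = 0.
Proof.
move=> [keys nn] cons; suff H i : forall p, p \in fl -> (p.1.1.1 < i)%N -> p.2 = 0.
  by move=> p pf; apply: (H p.1.1.1.+1).
elim: i => // i IH p pf; rewrite ltnS => hi.
have pA : p.1 \in A by rewrite -keys map_f.
have vn : p.1.1 \in nodes m sums by move: pA; rewrite arcsE nodesE => /and4P[-> ->].
have e := cons _ vn; rewrite mulr0 addr0 in e.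
apply/eqP; rewrite eq_le nn // andbT.
have -> : (0 : rat) = \sum_(p0 <- fl | into c p.1.1 p0.1) p0.2.
  rewrite big_seq_cond big1 // => q /andP[qf /andP[q0 /eqP qe]]; apply: IH => //.
  have qA : q.1 \in A by rewrite -keys map_f.
  move: qA; rewrite arcsE /arc_ok (negPf q0) /= => /and4P[_ _ _ /andP[lt _]].
  by apply: leq_trans lt _; rewrite (congr1 fst qe : q.1.2 = _).
by rewrite e; apply: (@sum_ge_mem fl (outof p.1.1)) => //; rewrite /outof eqxx.
Qed.

(** [pl_pos] ensures that [size fl0] rounds are enough: a round either finds value 0 and idles, or
    empties at least one arc that carried flow. *)
Record peeled (fl0 : seq (edge * rat)) (h0 : rat) (k : nat)
    (st : seq (edge * rat) * seq (seq edge * rat)) (h : rat) : Prop := Peeled {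
  pl_nonneg : nonneg_flow st.1;
  pl_cons : conserved st.1 h;
  pl_h : 0 <= h /\ h + \sum_(o <- st.2) o.2 = h0;
  pl_paths : forall o, o \in st.2 -> 0 <= o.2 /\ exists ps, o.1 = rev (path_arcs c source ps) /\ path_ok source ps;
  pl_sum : forall Q : pred edge, \sum_(p <- st.1 | Q p.1) p.2 + \sum_(o <- st.2) o.2 * (count Q o.1)%:R
     = \sum_(p <- fl0 | Q p.1) p.2;
  pl_pos : h = 0 \/ (count (fun p => 0 < p.2)%R st.1 + k <= size fl0)%N
}.

Lemma peelP fl0 h0 k st h : 0 \in sums -> peeled fl0 h0 k st h ->
  exists h', peeled fl0 h0 k.+1 (peel m c st) h'.
Proof.
move=> s0 [nf cons [h0' hs] paths sums_ pos]; have [keys nn] := nf.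
have := walkP nf cons h0' s0; rewrite /peel; case: eqP => hh.
  by move=> -> /=; exists h; split=> //; left.
move=> [ps [-> ok hps]]; set acc := rev _.
have -> : nilp acc = false by rewrite /acc /nilp size_rev; case: (ps).
set t := bottleneck st.1 acc.
have ua : uniq acc by rewrite rev_uniq path_arcs_uniq.
have sub : {subset acc <= A}.
  by move=> a; rewrite mem_rev; apply: path_arcs_sub.
have cnt Q : count Q acc = count Q (path_arcs c source ps) by rewrite count_rev.
have hps' a : a \in acc -> exists2 x, (a, x) \in st.1 & 0 < x by rewrite mem_rev; apply: hps.
have srcacc : exists2 p, p \in st.1 & p.1 \in acc.
  have : head (source, 0%N) (path_arcs c source ps) \in acc by rewrite mem_rev; case: (ps) => /= *; rewrite mem_head.
  by move=> ha; have [x xf _] := hps' _ ha; exists (head (source, 0%N) (path_arcs c source ps), x).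
have [t0 tmin [p1 [p1f p1a p1t]]] := bottleneckP nn srcacc; rewrite -/t in t0 tmin p1t.
have key_inj p q : p \in st.1 -> q \in st.1 -> p.1 = q.1 -> p = q.
  have um : uniq (map fst st.1) by rewrite keys arcs_uniq.
  exact: uniq_key_inj um.
have tpos : 0 < t.
  have [x xf x0] := hps' _ p1a; rewrite -p1t.
  by have -> : p1 = (p1.1, x) by apply: key_inj.
have cons' : conserved (subtract st.1 acc) (h - t).
  move=> v vn; rewrite !sum_subtract // -/t !cnt -path_conserve // natrD mulrDr -(cons v vn).
  by ring.
(* No arc enters the source, so conservation there identifies [h - t] with the outflow after
   subtraction, which is nonnegative. *)
have th : t <= h.
  have src : source \in nodes m sums by rewrite nodesE.
  have e := cons' _ src; rewrite eqxx mul1r in e.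
  have into0 fl' : \sum_(p <- fl' | into c source p.1) p.2 = 0 :> rat.
    rewrite big1 // => p /andP[p0 /eqP e']; case/negP: p0; apply/eqP; exact: (congr1 fst e').
  rewrite -subr_ge0; move: e; rewrite into0 add0r => ->.
  apply: nonneg_sum => p /mapP[q qf ->] /=; case: ifP => qa; last exact: nn.
  by rewrite subr_ge0 tmin.
exists (h - t); split=> //=.
- split; first by rewrite /subtract -map_comp -[RHS]keys; apply: eq_map.
  move=> p /mapP[q qf ->] /=; case: ifP => qa; last exact: nn.
  by rewrite subr_ge0 tmin.
- by rewrite subr_ge0 th big_cons /= addrA subrK.
- move=> o; rewrite inE => /orP[/eqP->|/paths //]; split=> //.
  by exists ps.
- by move=> Q; rewrite big_cons /= sum_subtract // -/t -(sums_ Q); ring.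
right; case: pos => // pos; rewrite addnS; apply: leq_trans pos.
rewrite -addSn leq_add2r /subtract count_map -/t; clear cons' th; clearbody t.
have : p1 \in st.1 := p1f.
elim: (st.1) tmin t0 => // p fl IH tmin t0; rewrite inE /= => /orP[/eqP e|p1fl].
  rewrite -e p1a p1t subrr ltxx add0n tpos add1n ltnS.
  apply: sub_count => q /=; case: ifP => // _ hq; apply: lt_le_trans hq _.
  by rewrite lerBlDr lerDl.
have tmin' (q : edge * rat) : q \in fl -> q.1 \in acc -> t <= q.2.
  by move=> qf; apply: tmin; rewrite inE qf orbT.
have := IH tmin' t0 p1fl.
rewrite /= -addnS; apply: leq_add.
case: ifP => // _; have : (0 < p.2 - t) -> (0 < p.2).
  by move=> hq; apply: lt_le_trans hq _; rewrite lerBlDr lerDl.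
by case: (0 < p.2 - t) => //= ->.
Qed.

End Flow.

(* Columns: the total flow (the right-hand side of a homogenised system), the arcs, and
   one slack variable for each representative. *)
Definition node_row (c : seq rat) (As : seq edge) (Rs : seq nat) (v : node) : seq int :=
  (if v == source then 1 else 0) ::
  [seq (if into c v a then 1 else 0) + (if outof v a then -1 else 0) | a <- As] ++ [seq 0 | u <- Rs].
(** The demand of [u], an inequality, multiplied by the denominator of its probability to have
    integral coefficients and turned into an equation by the slack. *)
Definition rep_row (ch : seq (seq nat)) (p : seq rat) (As : seq edge) (Rs : seq nat) (u : nat) : seq int :=
  - numq (nth 0 p u) ::
  [seq (if crossing ch u a then denq (nth 0 p u) else 0) | a <- As] ++ [seq (if u == w then -1 else 0) | w <- Rs].
Definition flow_matrix (m : nat) (c sums : seq rat) (ch : seq (seq nat)) (p : seq rat) (Rs : seq nat) : seq (seq int) :=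
  [seq node_row c (arcs m c sums) Rs v | v <- nodes m sums] ++
  [seq rep_row ch p (arcs m c sums) Rs u | u <- Rs].
Definition flow_width (As : seq edge) (Rs : seq nat) : nat := (size As + size Rs).+1.
Definition arc0 : edge := (source, 0%N).
Definition flow_of (As : seq edge) (x : seq rat) : seq (edge * rat) :=
  mkseq (fun i => (nth arc0 As i, nth 0 x i.+1)) (size As).

Lemma row_dot (K : realFieldType) (As : seq edge) (Rs : seq nat) (hd : int) (f : edge -> int) (g : nat -> int)
    (x : nat -> K) :
  \sum_(0 <= j < flow_width As Rs) (nth 0 (hd :: map f As ++ map g Rs) j)%:~R * x j =
  hd%:~R * x 0%N + \sum_(0 <= i < size As) (f (nth arc0 As i))%:~R * x i.+1
   + \sum_(0 <= i < size Rs) (g (nth 0%N Rs i))%:~R * x (size As + i).+1.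
Proof.
rewrite /flow_width big_nat_recl //= -addrA; congr (_ + _).
rewrite (@big_cat_nat _ _ _ (size As)) ?leq_addr //=; congr (_ + _).
  by apply: eq_big_nat => i /= hi; rewrite nth_cat size_map hi (nth_map arc0).
rewrite -{1}[size As]add0n big_addn addKn; apply: eq_big_nat => i /= hi.
by rewrite nth_cat size_map ltnNge leq_addl /= addnK (nth_map 0%N) // addnC.
Qed.

(** * Flow solutions and distributions over paths *)

Section FlowSystem.
Variables (m : nat) (c sums : seq rat) (ch : seq (seq nat)) (p : seq rat) (Rs : seq nat).
Hypothesis sums_uniq : uniq sums.
Hypothesis sums0 : 0 \in sums.
Hypothesis Rs_uniq : uniq Rs.
Hypothesis ch0 : nth [::] ch 0 = [::].
Local Notation As := (arcs m c sums).
Local Notation M := (flow_matrix m c sums ch p Rs).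
Local Notation W := (flow_width As Rs).

Lemma decomposeP fl h : nonneg_flow m c sums fl -> conserved m c sums fl h -> 0 <= h ->
  let out := decompose m c fl in
  [/\ forall o, o \in out -> 0 <= o.2 /\ exists ps, o.1 = rev (path_arcs c source ps) /\ path_ok m c sums source ps,
      \sum_(o <- out) o.2 = h
    & forall Q : pred edge, \sum_(o <- out) o.2 * (count Q o.1)%:R = \sum_(q <- fl | Q q.1) q.2].
Proof.
move=> nf cons h0 out.
have H k : exists h', peeled m c sums fl h k (iter k (peel m c) (fl, [::])) h'.
  elim: k => [|k [h' IH]]; last by rewrite iterS; apply: peelP IH.
  exists h; split=> //=.
  - by rewrite big_nil addr0.
  - by move=> Q; rewrite big_nil addr0.
  - by right; rewrite addn0 count_size.
have [h' [nf' cons' [h'0 hs] paths sumsQ pos]] := H (size fl).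
rewrite -/(decompose m c fl) -/out in hs paths sumsQ.
move: nf' cons' sumsQ pos; set fl' := (iter _ _ _).1 => nf' cons' sumsQ pos.
have h'E : h' = 0.
  case: pos => // cnt; apply/eqP; case: eqP => // /eqP hn.
  have src : source \in nodes m sums by rewrite nodesE.
  have h'pos : 0 < h' by rewrite lt_neqAle eq_sym hn.
  have : 0 < \sum_(q <- fl' | outof source q.1) q.2.
    rewrite -cons' // eqxx mul1r ltr_wpDl ?(nonneg_sum (fl := fl')) //; by case: nf'.
  move/(sum_gt0_has (fl := fl')); rewrite has_count => hc.
  have : (0 < count (fun q : edge * rat => (0 < q.2)%R) fl')%N.
    by apply: leq_trans hc _; apply: sub_count => q /andP[].
  by move=> cpos; have := leq_add cpos (leqnn (size fl)); rewrite add1n ltnNge cnt.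
rewrite h'E in cons'; have van := flow_vanish nf' cons'.
split=> //; first by rewrite -hs h'E add0r.
by move=> Q; rewrite -sumsQ [X in _ = X + _]big_seq_cond [X in _ = X + _]big1 ?add0r // => q /andP[/van].
Qed.

Lemma flow_of_sum (x : seq rat) (Q : pred edge) :
  \sum_(q <- flow_of As x | Q q.1) q.2 = \sum_(0 <= i < size As) (Q (nth arc0 As i))%:R * nth 0 x i.+1.
Proof.
rewrite big_mkcond big_map /index_iota subn0; apply: eq_bigr => i _ /=.
by case: (Q _); rewrite ?mul1r ?mul0r.
Qed.

Lemma flow_sound x : solve W M = Some x ->
  [/\ 0 < nth 0 x 0, nonneg_flow m c sums (flow_of As x), conserved m c sums (flow_of As x) (nth 0 x 0)
    & forall u, u \in Rs -> nth 0 p u * nth 0 x 0 <= \sum_(q <- flow_of As x | crossing ch u q.1) q.2].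
Proof.
move=> /(solve_sound (ltn0Sn _)) [sz nn x0 rows]; split=> //.
- split; first by rewrite /flow_of /mkseq -map_comp; exact: mkseq_nth.
  by move=> q /mapP[i _ ->]; apply: nn.
- move=> v vn; have := rows (node_row c As Rs v); rewrite mem_cat map_f // => /(_ isT).
  rewrite row_dot [X in _ + X]big1 ?addr0 => [|i _]; last by rewrite mul0r.
  rewrite !flow_of_sum => e; apply/eqP; rewrite -subr_eq0 -[X in _ == X]e; apply/eqP.
  rewrite addrC addrA -sumrN -big_split /= addrC; congr (_ + _); first by case: (v == source).
  by apply: eq_bigr => i _; case: (into _ _ _); case: (outof _ _); rewrite /= ?rmorphD ?rmorphN /=; ring.
move=> u uR; have := rows (rep_row ch p As Rs u).
rewrite mem_cat; have -> : rep_row ch p As Rs u \in [seq rep_row ch p As Rs u | u <- Rs] by apply: map_f.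
rewrite orbT => /(_ isT); rewrite row_dot flow_of_sum.
set S := \sum_(0 <= i < size Rs) _; have S0 : S <= 0.
  apply: sumr_le0 => i _; case: eqP => _; rewrite ?mul0r //.
  by rewrite rmorphN mulN1r oppr_le0.
have d0 : 0 < (denq (nth 0 p u))%:~R :> rat by rewrite ltr0z denq_gt0.
rewrite -{3}[nth 0 p u]divq_num_den => e.
rewrite mulrAC ler_pdivrMr // mulr_suml.
have -> : \sum_(0 <= i < size As) (crossing ch u (nth arc0 As i))%:R * nth 0 x i.+1 * (denq (nth 0 p u))%:~R =
  \sum_(0 <= i < size As) (if crossing ch u (nth arc0 As i) then denq (nth 0 p u) else 0)%:~R * nth 0 x i.+1.
  by apply: eq_bigr => i _; case: ifP => _; rewrite ?mul0r ?mul1r // mulrC.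
by move: e S0; rewrite rmorphN /=; move: (\sum_(0 <= i < size As) _) S => S1 S2; lra.
Qed.

(** The expected number of uses of each arc by a random path, with total 1 in column 0, is a
    nonnegative solution. The slacks are nonnegative because a path that meets the block of [u]
    crosses into it at least once. *)
Lemma flow_complete (K : realFieldType) (T : finType) (mu : T -> K) (ps : T -> seq nat) :
  (forall t, 0 <= mu t) -> \sum_t mu t = 1 -> (forall t, mu t != 0 -> path_ok m c sums source (ps t)) ->
  (forall u, u \in Rs -> ratr (nth 0 p u) <= \sum_(t | has (fun k => u \in nth [::] ch k) (ps t)) mu t) ->
  solve W M != None.
Proof.
move=> mu0 mu1 ok cov; apply/negP => /eqP none.
pose z (a : edge) : K := \sum_t mu t * (count_mem a (path_arcs c source (ps t)))%:R.
have z0 a : 0 <= z a by apply: sumr_ge0 => t _; rewrite mulr_ge0 ?ler0n.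
have zsum (Q : pred edge) : \sum_(a <- As) (Q a)%:R * z a = \sum_t mu t * (count Q (path_arcs c source (ps t)))%:R.
  transitivity (\sum_(a <- As | Q a) z a).
    by rewrite [RHS]big_mkcond; apply: eq_bigr => a _; case: (Q a); rewrite ?mul1r ?mul0r.
  rewrite exchange_big /=; apply: eq_bigr => t _; rewrite -mulr_sumr.
  case: (eqVneq (mu t) 0) => [->|/ok okt]; first by rewrite !mul0r.
  rewrite sum_count_mem //; first exact: arcs_uniq.
  by apply: path_arcs_sub.
pose slack u : K := (denq (nth 0 p u))%:~R * (\sum_t mu t * (count (crossing ch u) (path_arcs c source (ps t)))%:R)
   - (numq (nth 0 p u))%:~R.
pose x (i : nat) : K := if i is j.+1 then
   (if (j < size As)%N then z (nth arc0 As j)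
   else if (j - size As < size Rs)%N then slack (nth 0%N Rs (j - size As)) else 0) else 1.
have asum (f : edge -> int) : \sum_(0 <= i < size As) (f (nth arc0 As i))%:~R * x i.+1 = \sum_(a <- As) (f a)%:~R * z a.
  by rewrite [RHS](big_nth arc0); apply: eq_big_nat => i /= hi; rewrite /x hi.
have rsum (g : nat -> int) : \sum_(0 <= i < size Rs) (g (nth 0%N Rs i))%:~R * x (size As + i).+1 = \sum_(w <- Rs) (g w)%:~R * slack w.
  by rewrite [RHS](big_nth 0%N); apply: eq_big_nat => i /= hi; rewrite /x ltnNge leq_addr /= addKn hi.
have rowE hd (f : edge -> int) (g : nat -> int) :
    \sum_(0 <= j < W) (nth 0 (hd :: map f As ++ map g Rs) j)%:~R * x j =
    hd%:~R + \sum_(a <- As) (f a)%:~R * z a + \sum_(w <- Rs) (g w)%:~R * slack w.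
  by rewrite row_dot asum rsum mulr1.
have slack0 u : u \in Rs -> 0 <= slack u.
  move=> uR; rewrite /slack subr_ge0 -ler_pdivrMl ?ltr0z ?denq_gt0 // mulrC.
  apply: le_trans (cov u uR) _; rewrite big_mkcond; apply: ler_sum => t _.
  case: ifP => h; last by rewrite mulr_ge0.
  case: (eqVneq (mu t) 0) => [->|/ok okt]; first by rewrite mul0r.
  rewrite (path_crossing _ _ okt) /= ch0 in_nil ler_peMr // ler1n rises_has has_map.
  by case/hasP: h => k kp uk; apply/hasP; exists k.
have x0 j : 0 <= x j.
  case: j => [|j] /=; first exact: ler01.
  case: ltnP => h; first exact: z0.
  by case: ltnP => h' //; apply: slack0; apply: mem_nth.
suff rows a : a \in M -> \sum_(0 <= j < W) (nth 0 a j)%:~R * x j = 0.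
  by have /eqP := solve_complete (ltn0Sn _) none x0 rows; rewrite oner_eq0.
rewrite mem_cat => /orP[/mapP[v vn ->]|/mapP[u uR ->]]; rewrite rowE.
  rewrite [X in _ + X]big1 ?addr0 => [|i _]; last by rewrite mul0r.
  rewrite (eq_bigr (fun a => (into c v a)%:R * z a - (outof v a)%:R * z a)) => [|b _]; last first.
    by case: (into _ _ _); case: (outof _ _); rewrite /= ?rmorphD ?rmorphN /=; ring.
  rewrite sumrB !zsum -sumrB.
  have -> : (if v == source then 1 else 0)%:~R = (v == source)%:R * \sum_t mu t :> K.
    by rewrite mu1 mulr1; case: (v == source).
  rewrite mulr_sumr -big_split big1 //= => t _.
  case: (eqVneq (mu t) 0) => [->|/ok okt]; first by rewrite !mul0r mulr0 subr0 addr0.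
  by rewrite -(path_conserve sums_uniq v okt) natrD [v == source]eq_sym; ring.
rewrite (eq_bigr (fun a => (denq (nth 0 p u))%:~R * ((crossing ch u a)%:R * z a))) => [|b _]; last first.
  by case: (crossing _ _ _); rewrite ?mul1r ?mul0r ?mulr0.
rewrite -mulr_sumr zsum.
have -> : \sum_(w <- Rs) (if u == w then -1 else 0)%:~R * slack w = - slack u.
  rewrite (big_rem u uR) /= eqxx rmorphN mulN1r big_seq big1 ?addr0 // => w.
  by rewrite mem_rem_uniq // inE eq_sym => /andP[/negPf -> _]; rewrite mul0r.
by rewrite /slack rmorphN /=; ring.
Qed.

End FlowSystem.

(** * The rounding algorithm *)

Definition near_l (dm : seq (seq rat)) (rad : seq rat) (u v : nat) : bool :=
  near (fun u v => ent dm u v) (fun u => nth 0 rad u) u v.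
Definition reps (dm : seq (seq rat)) (rad prob : seq rat) : seq nat :=
  select (near_l dm rad) (fun u => nth 0 rad u) (sort_desc (fun u => nth 0 prob u) (iota 0 (size rad))).
Definition chains (dm : seq (seq rat)) (rad : seq rat) (Rs : seq nat) : seq (seq nat) :=
  build_chains (near_l dm rad) (sort_desc (fun u => nth 0 rad u) Rs).
Definition cheapest (dm : seq (seq rat)) (rad wts : seq rat) (v : nat) : nat :=
  head 0%N [seq u <- iota 0 (size rad) | (ent dm v u <= nth 0 rad v) &&
    all (fun u' => ~~ (ent dm v u' <= nth 0 rad v) || (nth 0 wts u <= nth 0 wts u')) (iota 0 (size rad))].
(** Entry 0 is a placeholder for buying nothing, so items are numbered from 1, as in [[::] :: L]. *)
Definition costs (dm : seq (seq rat)) (rad wts : seq rat) (L : seq (seq nat)) : seq rat :=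
  0 :: [seq nth 0 wts (cheapest dm rad wts (head 0%N c)) | c <- L].
Definition nub_step (acc : seq rat) (a : rat) : seq rat := if a \in acc then acc else a :: acc.
(** Duplicates are removed at every stage; otherwise the list would double with each item, even for
    poly-bounded weights. *)
Definition sum_step (acc : seq rat) (w : rat) : seq rat := foldl nub_step acc [seq s + w | s <- acc].
Definition all_sums (cs : seq rat) : seq rat := foldl sum_step [:: 0] cs.
Definition sums_upto (B : rat) (cs : seq rat) : seq rat := [seq s <- all_sums cs | s <= B].
Definition opened (dm : seq (seq rat)) (rad wts : seq rat) (L : seq (seq nat)) (acc : seq edge) : seq bool :=
  mkseq (fun u => u \in [seq cheapest dm rad wts (head 0%N (nth [::] ([::] :: L) a.2)) | a <- [seq a <- acc | a.2 != 0%N]])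
    (size rad).
Definition answer_of (dm : seq (seq rat)) (rad wts : seq rat) (L : seq (seq nat)) (As : seq edge) (c x : seq rat) :
    seq (seq bool * rat) :=
  [seq (opened dm rad wts L o.1, o.2 * (nth 0 x 0)^-1) | o <- decompose (size L) c (flow_of As x)].
Definition round_flow (dm : seq (seq rat)) (rad prob wts : seq rat) (Rs : seq nat) (L : seq (seq nat)) (c sums : seq rat) :
    option (seq (seq bool * rat)) :=
  match solve (flow_width (arcs (size L) c sums) Rs) (flow_matrix (size L) c sums ([::] :: L) prob Rs) with
  | Some x => Some (answer_of dm rad wts L (arcs (size L) c sums) c x)
  | None => None
  end.
Definition lottery (dm : seq (seq rat)) (rad prob wts : seq rat) (B : rat) : option (seq (seq bool * rat)) :=
  let Rs := reps dm rad prob in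
  let L := chains dm rad Rs in
  let c := costs dm rad wts L in
  round_flow dm rad prob wts Rs L c (sums_upto B (behead c)).

Lemma nub_stepE acc s x : (x \in foldl nub_step acc s) = (x \in acc) || (x \in s).
Proof.
elim: s acc => [|a s IH] acc /=; first by rewrite orbF.
rewrite IH inE /nub_step; case: ifP => h; last by rewrite inE; case: (x == a); case: (x \in acc).
by case: eqP => // ->; rewrite h.
Qed.

Lemma nub_step_uniq acc s : uniq acc -> uniq (foldl nub_step acc s).
Proof.
elim: s acc => //= a s IH acc ua; apply: IH; rewrite /nub_step; case: ifP => //= h.
by rewrite h.
Qed.

Lemma all_sums_uniq cs : uniq (all_sums cs).
Proof.
rewrite /all_sums; elim/last_ind: cs => // cs a IH; rewrite foldl_rcons.
exact: nub_step_uniq.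
Qed.

Lemma all_sums_sub cs (l : seq nat) (b : nat -> rat) (Q : pred nat) : cs = map b l ->
  \sum_(k <- l | Q k) b k \in all_sums cs.
Proof.
move=> ->; rewrite /all_sums; elim/last_ind: l => [|l k IH]; first by rewrite big_nil.
rewrite map_rcons foldl_rcons big_rcons /sum_step nub_stepE; case: (Q k) => /=.
  by rewrite (map_f (fun s => s + b k)) ?orbT.
by rewrite ?addr0 IH.
Qed.

Lemma all_sums0 cs : 0 \in all_sums cs.
Proof.
rewrite /all_sums; elim/last_ind: cs => // cs a IH.
by rewrite foldl_rcons /sum_step nub_stepE IH.
Qed.

(** * From center sets to paths and back *)

Section Rounding.
Variables (n : nat) (dm : seq (seq rat)) (rad prob wts : seq rat) (B : rat).
Local Notation d := (fun u v => ent dm u v).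
Local Notation r := (fun u => nth 0 rad u).
Local Notation p := (fun u => nth 0 prob u).
Local Notation w := (fun u => nth 0 wts u).
Hypothesis size_rad : size rad = n.
Hypothesis d_refl : forall u, (u < n)%N -> d u u = 0.
Hypothesis d_sym : forall u v, (u < n)%N -> (v < n)%N -> d u v = d v u.
Hypothesis d_tri : forall u v w, (u < n)%N -> (v < n)%N -> (w < n)%N -> d u w <= d u v + d v w.
Hypothesis r_gt0 : forall u, (u < n)%N -> 0 < r u.
Hypothesis w_ge0 : forall u, 0 <= w u.
Hypothesis B_ge0 : 0 <= B.

Let Rs := reps dm rad prob.
Let L := chains dm rad Rs.
Let c := costs dm rad wts L.
Let sums := sums_upto B (behead c).
Let m := size L.
Let ch := [::] :: L.
Let hd k := head 0%N (nth [::] ch k).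
Let cen k := cheapest dm rad wts (hd k).

Lemma repsP : [/\ uniq Rs, all (gtn n) Rs, separated d r Rs
  & forall v, (v < n)%N -> exists u, [/\ u \in Rs, near d r u v, r u <= 4%:R * r v & p v <= p u]].
Proof.
have perm := sort_desc_perm p (iota 0 n).
have all_n : all (gtn n) (sort_desc p (iota 0 n)).
  by rewrite (perm_all _ perm); apply/allP => v; rewrite mem_iota.
have [|h1 h2 h3 h4] := selectP d_refl d_sym r_gt0 _ all_n (sort_desc_pairwise p (iota 0 n)).
  by rewrite (perm_uniq perm) iota_uniq.
rewrite /Rs /reps size_rad; split=> //.
  by apply/allP => v /h2; move/allP: all_n; apply.
by move=> v vn; apply: h4; rewrite (perm_mem perm) mem_iota.
Qed.

Lemma chainsP : chain_inv d r (sort_desc r Rs) L /\ all (gtn n) (sort_desc r Rs).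
Proof.
have [h1 h2 h3 _] := repsP; have perm := sort_desc_perm r Rs.
have all_n : all (gtn n) (sort_desc r Rs) by rewrite (perm_all _ perm).
split=> //; rewrite /L /chains; apply: (build_chainsP (n := n)) => //.
- by rewrite (perm_uniq perm).
- by move=> u v; rewrite !(perm_mem perm); apply: h3.
- exact: sort_desc_pairwise.
Qed.

Lemma chain_mem k : (0 < k <= m)%N -> nth [::] ch k \in L.
Proof. by case: k => //= k km; rewrite mem_nth. Qed.

Lemma hd_reps k : (0 < k <= m)%N -> hd k \in Rs.
Proof.
move=> /chain_mem kL; have [iv _] := chainsP.
by rewrite -(perm_mem (sort_desc_perm r Rs)) -(perm_mem (ci_heads iv)); apply: (map_f (head 0%N)).
Qed.

Lemma hd_lt k : (0 < k <= m)%N -> (hd k < n)%N.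
Proof. by move/hd_reps; have [_ h _ _] := repsP; move/allP: h; apply. Qed.

Lemma hd_inj k k' : (0 < k <= m)%N -> (0 < k' <= m)%N -> hd k = hd k' -> k = k'.
Proof.
have [iv _] := chainsP; have [ur _ _ _] := repsP.
have uh : uniq (map (head 0%N) L) by rewrite (perm_uniq (ci_heads iv)) (perm_uniq (sort_desc_perm r Rs)).
case: k k' => [|k] [|k'] // km k'm; rewrite /hd /=.
rewrite -!(nth_map [::] 0%N (head 0%N)) // => e; congr _.+1.
by apply/eqP; rewrite -(nth_uniq 0%N _ _ uh) ?size_map // e.
Qed.

Lemma cheapestP v : (v < n)%N -> let u := cheapest dm rad wts v in
  [/\ (u < n)%N, d v u <= r v & forall u', (u' < n)%N -> d v u' <= r v -> w u <= w u'].
Proof.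
move=> vn; cbv zeta; rewrite /cheapest; set s := [seq u <- iota 0 (size rad) | _]; set u := head 0%N s.
have [t ts] : exists t, t \in s.
  have P0 : ent dm v (Ordinal vn) <= r v by rewrite (d_refl vn) ltW ?r_gt0.
  pose t := [arg min_(t < Ordinal vn | ent dm v (t : 'I_n) <= r v) w (t : 'I_n)]%O.
  exists (val t); rewrite mem_filter mem_iota size_rad /= ltn_ord andbT.
  rewrite /t; case: Order.TotalTheory.arg_minP => //= i -> hi /=.
  apply/allP => u'; rewrite mem_iota => /= u'n; case: (boolP (_ <= _)) => //= h.
  by rewrite (hi (Ordinal u'n)).
have : u \in s by rewrite /u; case: (s) ts => //= a l _; rewrite mem_head.
rewrite mem_filter mem_iota size_rad /= => /andP[/andP[h1 /allP h2] un]; split=> // u' u'n h.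
by have := h2 u'; rewrite mem_iota h /=; apply.
Qed.

Lemma cost_cen k : (0 < k <= m)%N -> nth 0 c k = w (cen k).
Proof. by case: k => //= k km; rewrite (nth_map [::]). Qed.

Lemma cost_ge0 k : 0 <= nth 0 c k.
Proof.
case: k => [|k] //=; case: (ltnP k m) => h; first by rewrite (nth_map [::]).
by rewrite nth_default ?size_map.
Qed.

Lemma sums_uniq : uniq sums. Proof. exact/filter_uniq/all_sums_uniq. Qed.
Lemma sums0 : 0 \in sums. Proof. by rewrite mem_filter B_ge0 all_sums0. Qed.

Lemma behead_c : behead c = [seq nth 0 c k | k <- iota 1 m].
Proof.
apply: (@eq_from_nth _ 0); rewrite ?size_map ?size_iota //= => i im.
by rewrite (nth_map 0%N) ?size_iota // nth_iota //= (nth_map [::]).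
Qed.

Lemma sums_sub (Q : pred nat) : \sum_(k <- iota 1 m | Q k) nth 0 c k <= B ->
  \sum_(k <- iota 1 m | Q k) nth 0 c k \in sums.
Proof. by move=> le; rewrite mem_filter le; apply: all_sums_sub behead_c. Qed.

(** Costs are nonnegative, so each partial sum along the selection is itself a subset sum within the
    budget, hence a node of the graph. *)
Lemma path_ok_filter (Q : pred nat) : \sum_(k <- iota 1 m | Q k) nth 0 c k <= B ->
  path_ok m c sums source [seq k <- iota 1 m | Q k].
Proof.
move=> le; suff H j i s : (i + j = m)%N -> s = \sum_(k <- iota 1 i | Q k) nth 0 c k ->
    forall i0, (i0 <= i)%N -> path_ok m c sums (i0, s) [seq k <- iota i.+1 j | Q k].
  by apply: (H m 0%N 0); rewrite ?big_nil.
elim: j i s => [|j IH] i s ij es i0 i0i //=.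
have iota_i : iota 1 i.+1 = rcons (iota 1 i) i.+1 by have := iotaD 1 i 1; rewrite addn1 add1n -cats1 => ->.
case: ifP => Qi; last first.
  by apply: (IH i.+1) => //; rewrite ?addSnnS // ?iota_i ?big_rcons /= ?Qi ?addr0 // ltnW.
have e : s + nth 0 c i.+1 = \sum_(k <- iota 1 i.+1 | Q k) nth 0 c k by rewrite iota_i big_rcons /= Qi es.
have ij' : (i.+1 + j = m)%N by rewrite addSnnS.
have im : (i.+1 <= m)%N by rewrite -ij' leq_addr.
rewrite /= ltnS i0i im /=; apply/andP; split; last first.
  exact: (IH i.+1 _ ij' e i.+1 (leqnn _)).
have split_m : iota 1 m = iota 1 i.+1 ++ iota i.+2 j by rewrite -ij -addSnnS iotaD add1n.
have e2 : s + nth 0 c i.+1 = \sum_(k <- iota 1 m | Q k && (k <= i.+1)%N) nth 0 c k.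
  rewrite e split_m big_cat [X in _ = _ + X]big1_seq ?addr0 => [|k]; last first.
    by rewrite mem_iota => /andP[/andP[_ h1] /andP[h2 _]]; move: h1; rewrite leqNgt h2.
  rewrite big_seq_cond [RHS]big_seq_cond; apply: eq_bigl => k; rewrite mem_iota.
  by case: (boolP (0 < k < _)%N) => //= /andP[_]; rewrite add1n ltnS => ->; rewrite andbT.
rewrite e2; apply: sums_sub; apply: le_trans le.
by rewrite big_mkcondr /=; apply: ler_sum => k _; case: ifP => // _; apply: cost_ge0.
Qed.

(* [near_cover] and the separation of the radii make [k] unique for a given [s]. *)
Definition hits (s k : nat) : bool := (d (hd k) s <= r (hd k)) &&
  all (fun k' => ~~ (d (hd k') s <= r (hd k')) || (r (hd k) <= r (hd k'))) (iota 1 m).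
Definition items (S : {set 'I_n}) : seq nat := [seq k <- iota 1 m | [exists s in S, hits (s : 'I_n) k]].

Lemma hits_uniq s k k' : (s < n)%N -> (0 < k <= m)%N -> (0 < k' <= m)%N -> hits s k -> hits s k' -> k = k'.
Proof.
move=> sn km k'm /andP[h1 /allP h2] /andP[h3 /allP h4]; apply: hd_inj => //.
apply/eqP; apply: contraT => ne; have [_ _ sep _] := repsP.
have i1 : k' \in iota 1 m by rewrite mem_iota add1n ltnS.
have i2 : k \in iota 1 m by rewrite mem_iota add1n ltnS.
have nr := near_cover d_sym d_tri r_gt0 (hd_lt km) (hd_lt k'm) sn h1 h3.
have := sep _ _ (hd_reps km) (hd_reps k'm) ne nr.
have := h2 _ i1; have := h4 _ i2; rewrite h1 h3 /= => a b.
have := r_gt0 (hd_lt km); have := r_gt0 (hd_lt k'm) => /= e f /orP[]; lra.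
Qed.

(** A point that hits [k] lies in the ball of the head, so it costs at least as much as the cheapest
    point there; and by [hits_uniq] each point pays for one item only. *)
Lemma items_cost (S : {set 'I_n}) : \sum_(k <- iota 1 m | [exists s in S, hits (s : 'I_n) k]) nth 0 c k <= \sum_(s in S) w s.
Proof.
apply: (@le_trans _ _ (\sum_(k <- iota 1 m) \sum_(s in S | hits (s : 'I_n) k) w s)).
  rewrite big_mkcond big_seq [leRHS]big_seq; apply: ler_sum => k; rewrite mem_iota add1n ltnS => km.
  case: ifP => [/exists_inP[s sS hs]|_]; last by apply: sumr_ge0.
  rewrite (bigD1 s) ?sS //= cost_cen //; apply: ler_wpDr; first by apply: sumr_ge0.
  have [_ _ h] := cheapestP (hd_lt km); apply: h => //; by case/andP: hs.
rewrite (exchange_big_dep (mem S)) /=; last by move=> k s _ /andP[].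
apply: ler_sum => s sS.
under eq_bigl do rewrite sS.
case: (boolP (has (hits s) (iota 1 m))) => [/hasP[k kI hk]|/hasPn no]; last first.
  by rewrite big_seq_cond big1 // => k /andP[/no /negPf ->].
have km : (0 < k <= m)%N by move: kI; rewrite mem_iota add1n ltnS.
rewrite (big_rem k kI) /= hk big_seq_cond big1 ?addr0 // => k' /andP[].
rewrite mem_rem_uniq ?iota_uniq // inE mem_iota add1n ltnS => /andP[/eqP ne k'm] hk'.
by case: ne; apply: hits_uniq hk' hk.
Qed.

(** The smallest ball containing [s] has a head near [u] and no larger than it, so [ci_closed] puts
    [u] into the chain of that head. *)
Lemma items_cover (S : {set 'I_n}) u : u \in Rs -> (exists2 s : 'I_n, s \in S & d u s <= r u) ->
  has (fun k => u \in nth [::] ch k) (items S).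
Proof.
move=> uR [s sS us]; have [iv _] := chainsP.
have un : (u < n)%N by have [_ h _ _] := repsP; move/allP: h; apply.
have : u \in map (head 0%N) L by rewrite (perm_mem (ci_heads iv)) (perm_mem (sort_desc_perm r Rs)).
case/(nthP 0%N) => i; rewrite size_map => im; rewrite (nth_map [::]) // => eu.
have P0 : d (hd (Ordinal im).+1) s <= r (hd (Ordinal im).+1) by rewrite /hd /= eu.
pose k := [arg min_(k < Ordinal im | d (hd (k : 'I_m).+1) s <= r (hd k.+1)) r (hd k.+1)]%O.
have [hk1 hk2] : d (hd (val k).+1) s <= r (hd (val k).+1) /\ forall k' : 'I_m, d (hd (val k').+1) s <= r (hd (val k').+1) ->
    r (hd (val k).+1) <= r (hd (val k').+1).
  by rewrite /k; case: Order.TotalTheory.arg_minP.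
have km : (0 < (val k).+1 <= m)%N by rewrite /= ltn_ord.
apply/hasP; exists (val k).+1.
  rewrite mem_filter mem_iota add1n ltnS km andbT; apply/exists_inP; exists s => //.
  rewrite /hits hk1; apply/allP => -[|k']; rewrite mem_iota // add1n => /= k'm.
  case: (boolP (_ <= _)) => //= h; exact: (hk2 (Ordinal (k'm : (k' < m)%N))).
apply: (ci_closed iv (chain_mem km)); rewrite ?(perm_mem (sort_desc_perm r Rs)) //.
  exact: (near_cover d_sym d_tri r_gt0 un (hd_lt km) (ltn_ord s) us hk1).
by have := hk2 (Ordinal im) P0; rewrite {2}/hd /= eu.
Qed.

Lemma ch0 : nth [::] ch 0 = [::]. Proof. by []. Qed.
Lemma Rs_uniq : uniq Rs. Proof. by have [] := repsP. Qed.

Lemma lottery_none (K : realFieldType) (mu : {set 'I_n} -> K) :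
  lottery dm rad prob wts B = None -> (forall S, 0 <= mu S) ->
  (forall S, mu S != 0 -> \sum_(s in S) w s <= B) -> \sum_S mu S = 1 ->
  ~ (forall u : 'I_n, ratr (p u) <= \sum_(S : {set 'I_n} | [exists s in S, d u (s : 'I_n) <= r u]) mu S).
Proof.
rewrite /lottery -/Rs -/L -/c -/sums /round_flow -/m -/ch => none mu0 muF mu1 cov.
have := @flow_complete m c sums ch prob Rs sums_uniq sums0 Rs_uniq ch0 K _ mu items mu0 mu1.
move: none; case: (solve _ _) => // _ h.
suff : (None : option (seq rat)) != None by rewrite eqxx.
apply: h => [S /muF le|u uR].
  by apply: path_ok_filter; apply: le_trans le; apply: items_cost.
have un : (u < n)%N by have [_ h' _ _] := repsP; move/allP: h'; apply.
apply: le_trans (cov (Ordinal un)) _.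
rewrite big_mkcond [leRHS]big_mkcond; apply: ler_sum => S _; case: ifP => [/exists_inP[s sS hs]|_].
  by rewrite items_cover //; exists s.
by case: ifP.
Qed.

Lemma path_ok_total v ps : path_ok m c sums v ps -> v.2 \in sums -> v.2 + \sum_(k <- ps) nth 0 c k \in sums.
Proof.
elim: ps v => [|k ps IH] v /=; first by rewrite big_nil addr0.
by case/and3P=> _ sk ok _; rewrite big_cons addrA; apply: (IH (arc_end c (v, k))).
Qed.

Lemma path_ok_items v ps : path_ok m c sums v ps -> path ltn v.1 ps /\ all (fun k => (0 < k <= m)%N) ps.
Proof.
elim: ps v => [|k ps IH] v //= /and3P[/andP[vk km] _ ok]; have [h1 h2] := IH _ ok.
by rewrite vk h1 km h2 andbT (leq_ltn_trans _ vk).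
Qed.

Lemma path_ok_subseq ps : path_ok m c sums source ps -> subseq ps (iota 0 m.+1).
Proof.
move/path_ok_items => [h1 /allP h2].
suff -> : ps = [seq k <- iota 0 m.+1 | k \in ps] by apply: filter_subseq.
apply: (irr_sorted_eq ltn_trans ltnn).
- exact: path_sorted h1.
- by apply: sorted_filter; [exact: ltn_trans|exact: iota_ltn_sorted].
move=> k; rewrite mem_filter mem_iota /= ltnS; case: (boolP (k \in ps)) => //= /h2 /andP[_ ->].
by [].
Qed.

(** The items of a path are a subsequence of all items, among which the chains through [u] form one
    block. Flow across the arcs into the block therefore never overcounts the probability of serving
    [u]. *)
Lemma crossing_le1 u ps : path_ok m c sums source ps ->
  (count (crossing ch u) (path_arcs c source ps) <= has (fun k => u \in nth [::] ch k) ps)%N.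
Proof.
move=> ok; rewrite (path_crossing _ _ ok) ch0 in_nil.
have -> : has (fun k => u \in nth [::] ch k) ps = has id [seq u \in nth [::] ch k | k <- ps] by rewrite has_map.
rewrite -rises_has; have [iv _] := chainsP.
suff : (rises false [seq u \in nth [::] ch k | k <- ps] <= 1)%N by case: (rises _ _) => // -[].
have sub : subseq [seq u \in nth [::] ch k | k <- ps] [seq u \in nth [::] ch k | k <- iota 0 m.+1].
  by apply: map_subseq; apply: path_ok_subseq.
apply: leq_trans (rises_subseq _ sub) _; apply: leq_trans (ci_rises iv u).
suff -> : [seq u \in nth [::] ch k | k <- iota 0 m.+1] = [seq u \in x | x <- ch] by [].
by rewrite -[in RHS](mkseq_nth [::] ch) /mkseq -map_comp.
Qed.

Lemma path_arcs_items ps : path_ok m c sums source ps ->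
  [seq a.2 | a <- [seq a <- path_arcs c source ps | a.2 != 0%N]] = ps.
Proof.
move/path_ok_items => [_]; elim: ps (source) => [|k ps IH] v //= /andP[/andP[k0 _] h].
by rewrite -lt0n k0 /= IH.
Qed.

Lemma lottery_some l : lottery dm rad prob wts B = Some l ->
  [/\ forall q, q \in l -> 0 <= q.2 /\ \sum_(u < n | nth false q.1 u) w u <= B,
      \sum_(q <- l) q.2 = 1
    & forall v : 'I_n, p v <= \sum_(q <- l | [exists s : 'I_n, nth false q.1 s && (d v s <= 14%:R * r v)]) q.2].
Proof.
rewrite /lottery -/Rs -/L -/c -/sums /round_flow -/m -/ch.
case E : solve => [x|//] [<-]; have [h0 nf cons cov] := flow_sound E.
have [paths total sumQ] := decomposeP sums_uniq sums0 nf cons (ltW h0).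
have hn : nth 0 x 0 != 0 by rewrite gt_eqF.
have openedE ps (u : 'I_n) : path_ok m c sums source ps ->
    nth false (opened dm rad wts L (rev (path_arcs c source ps))) u = (val u \in map cen ps).
  move=> ok; rewrite /opened size_rad nth_mkseq //.
  by rewrite -[in RHS](path_arcs_items ok) -map_comp filter_rev map_rev mem_rev.
split.
- move=> q /mapP[o oin ->] /=; have [o0 [ps [-> ok]]] := paths o oin.
  split; first by rewrite mulr_ge0 // invr_ge0 ltW.
  have tot : \sum_(k <- ps) nth 0 c k \in sums by have := path_ok_total ok sums0; rewrite add0r.
  move: tot; rewrite mem_filter => /andP[tot _]; apply: le_trans tot.
  rewrite (eq_bigl _ _ (fun u => openedE ps u ok)).
  have [_ kall] := path_ok_items ok.
  rewrite [leRHS](eq_big_seq (fun k => w (cen k))); last by move=> k /(allP kall); apply: cost_cen.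
  (* Different chains may open the same point, so the weight of the opened set is only bounded by
     the total cost of the items. *)
  elim: (ps) => [|k ps' IH]; first by rewrite big_pred0 // big_nil.
  rewrite big_cons; apply: (@le_trans _ _ (\sum_(u < n | val u == cen k) w u + \sum_(u < n | val u \in map cen ps') w u)).
    rewrite [leLHS]big_mkcond [X in _ <= X + _]big_mkcond [X in _ <= _ + X]big_mkcond -big_split /=; apply: ler_sum => u _; rewrite /= inE.
    by case: (_ == _); case: (_ \in _); rewrite /= ?addr0 ?add0r ?lerDl ?w_ge0.
  apply: lerD IH; case: (ltnP (cen k) n) => h.
    by rewrite (big_pred1 (Ordinal h)).
  rewrite big_pred0 ?w_ge0 // => u; apply/eqP => e; by have := ltn_ord u; rewrite e ltnNge h.
- by rewrite big_map /= -mulr_suml total mulfV.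
move=> v; have [_ _ _ /(_ v (ltn_ord v)) [u [uR nuv ruv puv]]] := repsP.
have un : (u < n)%N by have [_ h' _ _] := repsP; move/allP: h'; apply.
have [iv Qn] := chainsP.
apply: le_trans puv _; have := cov u uR; rewrite -sumQ -ler_pdivlMr // => /le_trans; apply.
rewrite /answer_of big_map mulr_suml big_mkcond [leRHS]big_mkcond /=.
rewrite big_seq [leRHS]big_seq; apply: ler_sum => o oin; have [o0 [ps [eo ok]]] := paths o oin.
have i0 : 0 <= (nth 0 x 0)^-1 by rewrite invr_ge0 ltW.
rewrite eo count_rev; have := crossing_le1 u ok.
case: hasP => [[k kps uk]|_]; last first.
  by rewrite leqn0 => /eqP ->; rewrite mulr0 mul0r; case: ifP => // _; rewrite mulr_ge0.
move=> cle; have km : (0 < k <= m)%N by have [_ /allP] := path_ok_items ok; apply.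
have [cn hc _] := cheapestP (hd_lt km); rewrite -/(cen k) in cn hc.
have hk := hd_lt km; have rk := r_gt0 hk.
have served : d (Ordinal cn) u <= 2%:R * r u.
  apply: (chain_serve d_sym d_tri iv Qn (chain_mem km) uk cn).
  by rewrite -/(hd k) (d_sym cn hk); move: hc => /=; lra.
have ex : [exists s : 'I_n, nth false (opened dm rad wts L (rev (path_arcs c source ps))) s && (d v s <= 14%:R * r v)].
  apply/existsP; exists (Ordinal cn); rewrite openedE //; apply/andP; split; first exact: map_f.
  (* The constant: [d v u + d u cen <= (r u + 2 r v) + 2 r u] with [r u <= 4 r v]. *)
  have := d_tri (ltn_ord v) un cn; rewrite (d_sym un cn) (d_sym (ltn_ord v) un).
  by move: served ruv nuv; rewrite /near => s1 s2 /andP[s3 s4]; lra.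
rewrite ex ler_wpM2r // ler_piMr //.
by rewrite -[1]/(1%:R) ler_nat (leq_trans cle).
Qed.

End Rounding.

(** * Running time *)

Lemma pt_near_l {X} {EX : enc X} (D : X -> Prop) (dm : X -> seq (seq rat)) (rad : X -> seq rat) (u v : X -> nat) :
  pt D dm -> pt D rad -> pt D u -> pt D v -> pt D (fun x => near_l (dm x) (rad x) (u x) (v x)).
Proof. by apply: (pt_app4 (f := near_l)); rewrite /near_l /near /ent; pt_auto. Qed.

Lemma pt_sort_desc {X} {EX : enc X} (D : X -> Prop) (k : X -> seq rat) (l : X -> seq nat) :
  pt D k -> pt D l -> pt D (fun x => sort_desc (fun u => nth 0 (k x) u) (l x)).
Proof.
apply: (pt_app2 (f := fun k l => sort_desc (fun u => nth 0 k u) l)).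
apply: (@pt_foldl_free _ _ _ _ _ _ _ (fun p : seq rat * seq nat => insert_desc (fun u => nth 0 p.1 u)) (fun=> [::]) snd id).
- by pt_auto.
- by pt_auto.
- by rewrite /insert_desc; pt_auto.
- by growth.
move=> [k' l'] _ s1 s2 /= e; rewrite -/(sort_desc _ s1).
have perm := sort_desc_perm (fun u => nth 0 k' u) s1.
rewrite esize_natseq (perm_sumn perm) (perm_size perm) -esize_natseq esize_pair e.
by apply: leq_trans (esize_prefix s1 s2) _; lia.
Qed.

Lemma pt_select {X} {EX : enc X} (D : X -> Prop) (dm : X -> seq (seq rat)) (rad : X -> seq rat) (l : X -> seq nat) :
  pt D dm -> pt D rad -> pt D l ->
  pt D (fun x => select (near_l (dm x) (rad x)) (fun u => nth 0 (rad x) u) (l x)).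
Proof.
apply: (pt_app3 (f := fun dm rad l => select (near_l dm rad) (fun u => nth 0 rad u) l)).
apply: (@pt_foldl_free _ _ _ _ _ _ _ (fun p : seq (seq rat) * seq rat * seq nat =>
  select_step (near_l p.1.1 p.1.2) (fun u => nth 0 p.1.2 u)) (fun=> [::]) snd id).
- by pt_auto.
- by pt_auto.
- rewrite /select_step; apply: pt_ite; last by pt_auto.
  + apply: pt_has; first by pt_auto.
    apply: pt_andb; last by pt_auto.
    by apply: pt_near_l; pt_auto.
  + by pt_auto.
- by growth.
move=> [[dm' rad'] l'] _ s1 s2 /= e; apply: (@leq_trans (esize s1)); last first.
  by rewrite !esize_pair e; apply: leq_trans (esize_prefix s1 s2) _; lia.
elim/last_ind: s1 {s2 e} => // s1 v IH; rewrite foldl_rcons -cats1.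
move: IH; move: (foldl _ _ _) => t IH; rewrite /select_step.
generalize (esize_cat s1 [:: v]); generalize (esize_cat t [:: v]); rewrite esize_cons => es et.
by case: ifP => _; lia.
Qed.

Lemma pt_insert_chain {X} {EX : enc X} (D : X -> Prop) (dm : X -> seq (seq rat)) (rad : X -> seq rat)
    (L : X -> seq (seq nat)) (v : X -> nat) :
  pt D dm -> pt D rad -> pt D L -> pt D v ->
  pt D (fun x => insert_chain (near_l (dm x) (rad x)) (L x) (v x)).
Proof.
apply: (pt_app4 (f := fun dm rad L v => insert_chain (near_l dm rad) L v)).
set T := fun _ => True.
have pS : pt T (fun p : seq (seq rat) * seq rat * seq (seq nat) * nat =>
   foldl (chain_scan (near_l p.1.1.1 p.1.1.2) p.2) (false, [::]) (rev p.1.2)).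
  apply: (@pt_foldl_free _ _ _ _ _ _ _ (fun p : seq (seq rat) * seq rat * seq (seq nat) * nat =>
    chain_scan (near_l p.1.1.1 p.1.1.2) p.2) (fun=> (false, [::])) (fun p => rev p.1.2)
    (fun n => n * (n + 5) + 5)%N).
  - by pt_auto.
  - by pt_auto.
  - rewrite /chain_scan; apply: pt_ite; first by pt_auto.
      by pt_auto.
    apply: pt_ite; [apply: pt_near_l; pt_auto|by pt_auto|by pt_auto].
  - by growth.
  move=> [[[dm' rad'] L'] v'] _ s1 s2 /= e; rewrite !esize_pair.
  have : (esize s1 <= esize L')%N.
    by rewrite -(esize_rev L') e; apply: esize_prefix.
  have : (esize (foldl (chain_scan (near_l dm' rad') v') (false, [::]) s1) <= esize s1 * (esize v' + 5) + 5)%N.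
    elim/last_ind: s1 {s2 e} => [|s1 c IH]; first by rewrite /= esize_pair esize_nil /esize /=; lia.
    rewrite foldl_rcons -cats1; generalize (esize_cat s1 [:: c]); rewrite esize_cons esize_nil => es.
    move: IH; case: (foldl _ _ _) => b t; rewrite /chain_scan /= !esize_pair => IH.
    have b3 (b' : bool) : (1 <= esize b' <= 3)%N by case: b'.
    have := b3 true; have := b3 false; have := b3 b.
    by case: b IH => IH; last case: ifP => _; rewrite ?esize_pair ?esize_cons; nia.
  by move=> h1 h2; apply: leq_trans h1 _; rewrite leq_add2r; apply: leq_mul; lia.
rewrite /insert_chain; apply: pt_ite; last by pt_auto.
- exact: pt_fst.
- exact: pt_snd.
Qed.

Lemma build_chains_shape (d : nat -> nat -> rat) (r : nat -> rat) s (E : pred nat) (rel := near d r) : all E s ->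
  (size (build_chains rel s) <= size s)%N /\
  forall c, c \in build_chains rel s -> (size c <= size s)%N /\ all E c.
Proof.
rewrite /build_chains; elim/last_ind: s => // s v IH; rewrite all_rcons foldl_rcons size_rcons => /andP[Ev /IH].
move: (foldl _ _ _) => L [h1 h2].
have h3 c : c \in L -> (size c <= (size s).+1)%N /\ all E c by move=> /h2 [h ->]; split=> //; apply: leqW.
case: (insert_chainP d r L v) => [[_ ->]|[L1 [c [L2 [eL _ _ ->]]]]].
  by split=> // c; rewrite inE => /orP[/eqP->|/h3] //=; rewrite Ev.
have cL : c \in L by rewrite eL mem_cat mem_head orbT.
split; first by move: h1; rewrite eL !size_cat /=; lia.
move=> c'; rewrite mem_cat !inE => /or4P[h|/eqP->|/eqP->|h].
- by apply: h3; rewrite eL mem_cat h.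
- exact: h3.
- by have [a b] := h2 _ cL; rewrite /= Ev.
- by apply: h3; rewrite eL mem_cat inE h !orbT.
Qed.

Lemma pt_build_chains {X} {EX : enc X} (D : X -> Prop) (dm : X -> seq (seq rat)) (rad : X -> seq rat) (l : X -> seq nat) :
  pt D dm -> pt D rad -> pt D l -> pt D (fun x => build_chains (near_l (dm x) (rad x)) (l x)).
Proof.
apply: (pt_app3 (f := fun dm rad l => build_chains (near_l dm rad) l)).
apply: (@pt_foldl_free _ _ _ _ _ _ _ (fun p : seq (seq rat) * seq rat * seq nat =>
  insert_chain (near_l p.1.1 p.1.2)) (fun=> [::]) snd (fun n => n * (n * n.+1 + 1).+1 + 1)%N).
- by pt_auto.
- by pt_auto.
- by apply: pt_insert_chain; pt_auto.
- by growth.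
move=> [[dm' rad'] l'] _ s1 s2 /= e; rewrite -/(build_chains _ s1).
have hs : (esize s1 <= esize (dm', rad', l'))%N.
  by rewrite !esize_pair e; apply: leq_trans (esize_prefix s1 s2) _; lia.
move: (esize (_, _, _)) hs => n hs.
have hz : (size s1 <= n)%N by apply: leq_trans hs; exact/ltnW/size_le_esize.
have all_s : all (fun u : nat => esize u <= n)%N s1.
  by apply/allP => u us; apply: leq_trans hs; apply/ltnW/esize_mem.
have [h1 h2] := build_chains_shape (fun u v => ent dm' u v) (fun u => nth 0 rad' u) all_s.
apply: (@leq_trans (size (build_chains (near_l dm' rad') s1) * (n * n.+1 + 1).+1 + 1)%N); last first.
  by rewrite leq_add2r leq_mul2r (leq_trans h1 hz) orbT.
apply: esize_all => c /h2 [h3 /allP h4].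
apply: (@leq_trans (size c * n.+1 + 1)%N); first exact: esize_all.
by rewrite leq_add2r leq_mul2r (leq_trans h3 hz) orbT.
Qed.

Lemma pt_cheapest {X} {EX : enc X} (D : X -> Prop) (dm : X -> seq (seq rat)) (rad wts : X -> seq rat) (v : X -> nat) :
  pt D dm -> pt D rad -> pt D wts -> pt D v -> pt D (fun x => cheapest (dm x) (rad x) (wts x) (v x)).
Proof. by apply: (pt_app4 (f := cheapest)); rewrite /cheapest /ent; pt_auto. Qed.

Lemma pt_reps {X} {EX : enc X} (D : X -> Prop) (dm : X -> seq (seq rat)) (rad prob : X -> seq rat) :
  pt D dm -> pt D rad -> pt D prob -> pt D (fun x => reps (dm x) (rad x) (prob x)).
Proof.
move=> pd pr pp; apply: pt_select => //; apply: pt_sort_desc => //.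
exact/pt_iota0/pt_size_seq.
Qed.

Lemma pt_chains {X} {EX : enc X} (D : X -> Prop) (dm : X -> seq (seq rat)) (rad : X -> seq rat) (Rs : X -> seq nat) :
  pt D dm -> pt D rad -> pt D Rs -> pt D (fun x => chains (dm x) (rad x) (Rs x)).
Proof. by move=> pd pr pR; apply: pt_build_chains => //; apply: pt_sort_desc. Qed.

Lemma pt_costs {X} {EX : enc X} (D : X -> Prop) (dm : X -> seq (seq rat)) (rad wts : X -> seq rat) (L : X -> seq (seq nat)) :
  pt D dm -> pt D rad -> pt D wts -> pt D L -> pt D (fun x => costs (dm x) (rad x) (wts x) (L x)).
Proof.
apply: (pt_app4 (f := costs)); rewrite /costs; apply: pt_cons; first by pt_auto.
apply: pt_map_free; first by pt_auto.
by apply: pt_nth; [pt_auto|apply: pt_cheapest; pt_auto].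
Qed.

Lemma esize_mask {A} {EA : enc A} b (s : seq A) : (esize (mask b s) <= esize s)%N.
Proof.
elim: s b => [|a s IH] [|[] b] //=; rewrite ?esize_cons ?ltnS ?leq_add2l //.
by apply: leq_trans (IH b) _; lia.
Qed.

(** Every reachable sum is the sum of a sublist, so its size is controlled by [esize_sum_rat]
    independently of how it was reached. *)
Lemma all_sums_mask cs t : t \in all_sums cs -> exists2 b, size b = size cs & t = \sum_(a <- mask b cs) a.
Proof.
rewrite /all_sums; elim/last_ind: cs t => [|cs a IH] t.
  by rewrite inE => /eqP ->; exists [::]; rewrite ?big_nil.
rewrite foldl_rcons /sum_step nub_stepE => /orP[/IH[b sb ->]|/mapP[u /IH[b sb ->] ->]].
  by exists (rcons b false); rewrite ?size_rcons ?sb // mask_rcons // cats0.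
by exists (rcons b true); rewrite ?size_rcons ?sb // mask_rcons // big_cat big_seq1.
Qed.

Lemma pt_nub {X} {EX : enc X} (D : X -> Prop) (acc s : X -> seq rat) :
  pt D acc -> pt D s -> pt D (fun x => foldl nub_step (acc x) (s x)).
Proof.
apply: (pt_app2 (f := fun acc s => foldl nub_step acc s)).
apply: (@pt_foldl_free _ _ _ _ _ _ _ (fun p : seq rat * seq rat => nub_step) fst snd id).
- by pt_auto.
- by pt_auto.
- by rewrite /nub_step; pt_auto.
- by growth.
move=> [acc' s'] _ s1 s2 /= e; apply: (@leq_trans (esize acc' + esize s1)%N); last first.
  by rewrite esize_pair e; generalize (esize_prefix s1 s2); lia.
elim/last_ind: s1 {s2 e} => [|s1 a IH]; first by rewrite /=; lia.
rewrite foldl_rcons -cats1; move: IH; move: (foldl _ _ _) => t IH.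
generalize (esize_cat s1 [:: a]); rewrite esize_cons esize_nil => es.
by rewrite /nub_step; case: ifP => _; rewrite ?esize_cons; lia.
Qed.

(** Each sum is short in any case, but their number can be exponential for arbitrary weights; a
    polynomial bound on it is therefore a hypothesis. *)
Lemma pt_all_sums {X} {EX : enc X} (D : X -> Prop) (cs : X -> seq rat) b :
  pt D cs -> poly_growth b ->
  (forall x, D x -> forall s1 s2, cs x = s1 ++ s2 -> (size (all_sums s1) <= b (esize x))%N) ->
  pt D (fun x => all_sums (cs x)).
Proof.
move=> pc gb hb; have [k hk] := pt_size pc.
apply: (@pt_foldl_free _ _ _ _ _ _ _ (fun _ => sum_step) (fun=> [:: 0]) cs
  (fun n => b n * (16 * (n + 2) ^ k + 11).+1 + 1)%N) => //.
- by pt_auto.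
- by rewrite /sum_step; apply: pt_nub; pt_auto.
- by growth.
move=> x Dx s1 s2 e; rewrite -/(all_sums s1).
apply: leq_trans (leq_add (leq_mul (hb x Dx s1 s2 e) (leqnn _)) (leqnn 1%N)).
apply: esize_all => t /all_sums_mask[m _ ->].
apply: leq_trans (esize_sum_rat _) _; rewrite leq_add2r leq_mul2l /=.
apply: leq_trans (esize_mask m s1) _; apply: leq_trans (hk x Dx).
by rewrite e; apply: esize_prefix.
Qed.

(** * Running time of the flow system and of the decomposition *)

#[export] Instance enc_node : enc node := @enc_pair nat rat _ _.
#[export] Instance enc_edge : enc edge := @enc_pair (nat * rat) nat _ _.
#[export] Instance enc_inj_node : enc_inj node. Proof. exact: (@enc_inj_pair nat rat). Qed.
#[export] Instance enc_inj_edge : enc_inj edge. Proof. exact: (@enc_inj_pair (nat * rat) nat). Qed.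

Lemma pt_nodes {X} {EX : enc X} (D : X -> Prop) (m : X -> nat) (sums : X -> seq rat) :
  pt D m -> pt D sums -> pt D (fun x => nodes (m x) (sums x)).
Proof. by apply: (pt_app2 (f := nodes)); rewrite /nodes; pt_auto. Qed.

Lemma pt_arc_end {X} {EX : enc X} (D : X -> Prop) (c : X -> seq rat) (a : X -> edge) :
  pt D c -> pt D a -> pt D (fun x => arc_end (c x) (a x)).
Proof. by apply: (pt_app2 (f := arc_end)); rewrite /arc_end; pt_auto. Qed.

Lemma pt_arcs {X} {EX : enc X} (D : X -> Prop) (m : X -> nat) (c sums : X -> seq rat) :
  pt D m -> pt D c -> pt D sums -> pt D (fun x => arcs (m x) (c x) (sums x)).
Proof.
apply: (pt_app3 (f := arcs)); rewrite /arcs /arc_ok; apply: pt_filter.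
  apply/pt_flatten/pt_map_free; first by apply: pt_nodes; pt_auto.
  by pt_auto.
by pt_auto.
Qed.

Lemma pt_node_row {X} {EX : enc X} (D : X -> Prop) (c : X -> seq rat) (As : X -> seq edge) (Rs : X -> seq nat) (v : X -> node) :
  pt D c -> pt D As -> pt D Rs -> pt D v -> pt D (fun x => node_row (c x) (As x) (Rs x) (v x)).
Proof. by apply: (pt_app4 (f := node_row)); rewrite /node_row /into /outof /arc_end; pt_auto. Qed.

Lemma pt_rep_row {X} {EX : enc X} (D : X -> Prop) (ch : X -> seq (seq nat)) (p : X -> seq rat)
    (As : X -> seq edge) (Rs : X -> seq nat) (u : X -> nat) :
  pt D ch -> pt D p -> pt D As -> pt D Rs -> pt D u -> pt D (fun x => rep_row (ch x) (p x) (As x) (Rs x) (u x)).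
Proof.
move=> pch pp pA pR pu.
apply: (pt_app4 (f := fun q As Rs u => rep_row q.1 q.2 As Rs u) _ (pt_pair pch pp) pA pR pu).
by rewrite /rep_row /crossing; pt_auto.
Qed.

Lemma pt_lift {X A B} {EX : enc X} {EA : enc A} {EB : enc B} (D : X -> Prop) (f : X -> A) :
  pt D f -> pt (fun y : X * B => D y.1) (fun y => f y.1).
Proof. by move=> pf; apply: pt_comp pf _ _ => //; pt_auto. Qed.

Lemma pt_flow_matrix {X} {EX : enc X} (D : X -> Prop) (m : X -> nat) (c sums : X -> seq rat) (ch : X -> seq (seq nat))
    (p : X -> seq rat) (Rs : X -> seq nat) :
  pt D m -> pt D c -> pt D sums -> pt D ch -> pt D p -> pt D Rs ->
  pt D (fun x => flow_matrix (m x) (c x) (sums x) (ch x) (p x) (Rs x)).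
Proof.
move=> pm pc ps pch pp pR; have pA := pt_arcs pm pc ps; have pN := pt_nodes pm ps.
rewrite /flow_matrix; apply: pt_cat; apply: pt_map_free => //.
  by apply: pt_node_row; [exact: (pt_lift pc)|exact: (pt_lift pA)|exact: (pt_lift pR)|pt_auto].
by apply: pt_rep_row; [exact: (pt_lift pch)|exact: (pt_lift pp)|exact: (pt_lift pA)|exact: (pt_lift pR)|pt_auto].
Qed.

Lemma pt_flow_width {X} {EX : enc X} (D : X -> Prop) (As : X -> seq edge) (Rs : X -> seq nat) :
  pt D As -> pt D Rs -> pt D (fun x => flow_width (As x) (Rs x)).
Proof. by apply: (pt_app2 (f := flow_width)); rewrite /flow_width; pt_auto. Qed.

Lemma pt_flow_of {X} {EX : enc X} (D : X -> Prop) (As : X -> seq edge) (y : X -> seq rat) :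
  pt D As -> pt D y -> pt D (fun x => flow_of (As x) (y x)).
Proof. by apply: (pt_app2 (f := flow_of)); rewrite /flow_of; pt_auto. Qed.

Lemma pt_extend {X} {EX : enc X} (D : X -> Prop) (c : X -> seq rat) (fl : X -> seq (edge * rat)) (acc : X -> seq edge) :
  pt D c -> pt D fl -> pt D acc -> pt D (fun x => extend (c x) (fl x) (acc x)).
Proof.
apply: (pt_app3 (f := extend)); rewrite /extend.
apply: pt_ite; [by rewrite /nilp; pt_auto|by pt_auto|].
apply: (@pt_match _ _ _ _ _ _ _ (fun p : seq rat * seq (edge * rat) * seq edge => candidates p.1.2
    (if nilp p.2 then source else arc_end p.1.1 (head (source, 0%N) p.2)))
  (fun p a _ => a.1 :: p.2) (fun p => p.2)).
- rewrite /candidates; apply: pt_filter; first by pt_auto.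
  apply: pt_andb; last by pt_auto.
  apply: pt_eqop; first by pt_auto.
  apply: pt_ite; [by rewrite /nilp; pt_auto|by pt_auto|].
  by apply: pt_arc_end; pt_auto.
- by pt_auto.
- by pt_auto.
Qed.

Lemma walk_shape c (fl : seq (edge * rat)) k : let acc := iter k (extend c fl) [::] in
  (size acc <= k)%N /\ {subset acc <= map fst fl}.
Proof.
cbv zeta; elim: k => [//|k [h1 h2]]; rewrite iterS; move: (iter _ _ _) h1 h2 => acc h1 h2.
rewrite /extend; case: ifP => _; first by split=> //; apply: leqW.
case E : candidates => [|p l]; first by split=> //; apply: leqW.
split=> // a; rewrite inE => /orP[/eqP ->|/h2] //.
apply: map_f; have : p \in candidates fl (if nilp acc then source else arc_end c (head (source, 0%N) acc)).
  by rewrite E mem_head.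
by rewrite mem_filter => /andP[].
Qed.

Lemma esize_map_fst {A B} {EA : enc A} {EB : enc B} (s : seq (A * B)) : (esize (map fst s) <= esize s)%N.
Proof. by elim: s => [|[a b] s IH]; rewrite ?esize_nil //= !esize_cons esize_pair /=; lia. Qed.

Lemma esize_map_snd {A B} {EA : enc A} {EB : enc B} (s : seq (A * B)) : (esize (map snd s) <= esize s)%N.
Proof. by elim: s => [|[a b] s IH]; rewrite ?esize_nil //= !esize_cons esize_pair /=; lia. Qed.

Lemma esize_keys (acc : seq edge) (fl : seq (edge * rat)) : {subset acc <= map fst fl} ->
  (esize acc <= size acc * (esize fl).+1 + 1)%N.
Proof.
move=> sub; apply: esize_all => a /sub ain; apply: leq_trans (esize_map_fst fl).
exact/ltnW/esize_mem.
Qed.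

Lemma pt_walk {X} {EX : enc X} (D : X -> Prop) (m : X -> nat) (c : X -> seq rat) (fl : X -> seq (edge * rat)) :
  pt D m -> pt D c -> pt D fl -> pt D (fun x => walk (m x) (c x) (fl x)).
Proof.
apply: (pt_app3 (f := walk)).
apply: (@pt_iter _ _ _ _ _ (fun p : nat * seq rat * seq (edge * rat) => p.1.1.+1) (fun p => extend p.1.2 p.2)
  (fun=> [::]) (fun n => n.+1 * n.+1 + 1)%N).
- by pt_auto.
- by pt_auto.
- by apply: (@pt_sub _ _ _ _ _ (fun _ => True)) => //; apply: pt_extend; pt_auto.
- by growth.
move=> [[m' c'] fl'] _ i /= im; have [h1 h2] := walk_shape c' fl' i.
apply: leq_trans (esize_keys h2) _; rewrite leq_add2r !esize_pair esize_nat.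
by apply: leq_mul; [apply: leq_trans h1 _|]; rewrite /=; lia.
Qed.

Lemma pt_bottleneck {X} {EX : enc X} (D : X -> Prop) (fl : X -> seq (edge * rat)) (acc : X -> seq edge) :
  pt D fl -> pt D acc -> pt D (fun x => bottleneck (fl x) (acc x)).
Proof. by apply: (pt_app2 (f := bottleneck)); rewrite /bottleneck; pt_auto. Qed.

Lemma pt_subtract {X} {EX : enc X} (D : X -> Prop) (fl : X -> seq (edge * rat)) (acc : X -> seq edge) :
  pt D fl -> pt D acc -> pt D (fun x => subtract (fl x) (acc x)).
Proof.
apply: (pt_app2 (f := subtract)); rewrite /subtract; apply: pt_map_free; first by pt_auto.
apply: pt_pair; first by pt_auto.
apply: pt_ite; [by pt_auto| |by pt_auto].
apply: pt_subr; first by pt_auto.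
by apply: pt_bottleneck; pt_auto.
Qed.

Lemma pt_peel {X} {EX : enc X} (D : X -> Prop) (m : X -> nat) (c : X -> seq rat)
    (st : X -> seq (edge * rat) * seq (seq edge * rat)) :
  pt D m -> pt D c -> pt D st -> pt D (fun x => peel (m x) (c x) (st x)).
Proof.
apply: (pt_app3 (f := peel)); rewrite /peel.
have pW : pt (fun _ => True) (fun p : nat * seq rat * (seq (edge * rat) * seq (seq edge * rat)) =>
    walk p.1.1 p.1.2 p.2.1) by apply: pt_walk; pt_auto.
apply: pt_ite; [by rewrite /nilp; pt_auto|by pt_auto|].
apply: pt_pair; first by apply: pt_subtract; pt_auto.
by apply: pt_cons; [apply: pt_pair; [|apply: pt_bottleneck]; pt_auto|pt_auto].
Qed.

(* Peeling keeps the denominators of the residual flow: every residual value is a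
   multiple of [1 / den] lying between [0] and [top]. *)
Definition residual (den : nat) (top : rat) (x : rat) : Prop :=
  0 <= x <= top /\ exists z : int, x * den%:R = z%:~R.

Lemma bottleneck_residual den top fl acc : 0 <= top -> (forall p, p \in fl -> residual den top p.2) ->
  residual den top (bottleneck fl acc) /\ forall p, p \in fl -> p.1 \in acc -> bottleneck fl acc <= p.2.
Proof.
move=> top0 hf; case: (boolP (has (fun p => p.1 \in acc) fl)) => [/hasP[p0 p0f p0a]|/hasPn no].
  have [|h1 h2 [p [pf _ e]]] := @bottleneckP fl acc _ (ex_intro2 _ _ p0 p0f p0a).
    by move=> p /hf[/andP[]].
  by split=> //; rewrite -e; apply: hf.
split=> [|p0 /no /negPf -> //]; rewrite /bottleneck.
have -> : [seq p <- fl | p.1 \in acc] = [::].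
  by apply/eqP; rewrite -(negbK (_ == _)) -has_filter; apply/hasPn.
by split; [rewrite lexx top0|exists 0; rewrite mul0r].
Qed.

Lemma peel_residual m c fl den top k : 0 <= top -> (forall p, p \in fl -> residual den top p.2) ->
  let st := iter k (peel m c) (fl, [::]) in
  [/\ map fst st.1 = map fst fl, forall p, p \in st.1 -> residual den top p.2, (size st.2 <= k)%N
    & forall o, o \in st.2 -> [/\ residual den top o.2, (size o.1 <= m.+1)%N & {subset o.1 <= map fst fl}]].
Proof.
move=> top0 hf; cbv zeta; elim: k => [//|k [h1 h2 h3 h4]]; rewrite iterS.
move: (iter _ _ _) h1 h2 h3 h4 => st h1 h2 h3 h4; rewrite /peel.
case: ifP => _; first by split=> //; apply: leqW.
have [w1 w2] := walk_shape c st.1 m.+1; have [b1 b2] := bottleneck_residual (walk m c st.1) top0 h2.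
split=> //=.
- by rewrite -h1 -map_comp.
- move=> q /mapP[p pf ->] /=; case: ifP => pa; last exact: h2.
  have [/andP[p1 p2] [z ez]] := h2 _ pf; have [/andP[q1 q2] [z' ez']] := b1; have := b2 p pf pa => le.
  split; first by apply/andP; split; lra.
  by exists (z - z'); rewrite mulrBl ez ez' rmorphB.
- move=> o; rewrite inE => /orP[/eqP -> /=|/h4] //; split=> //.
  by rewrite -h1.
Qed.

Lemma esize_residual den E x : (0 < den <= 2 ^ E)%N -> residual den (2 ^ E)%N%:R x -> (esize x <= 8 * (2 * E).+1 + 11)%N.
Proof.
move=> /andP[d0 dE] [/andP[x0 xE] [z ez]].
have dn : den%:R != 0 :> rat by rewrite pnatr_eq0 -lt0n.
have -> : x = z%:~R / den%:R by rewrite -ez mulfK.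
have zE : (`|z| <= 2 ^ (2 * E))%N.
  have : `|z|%N%:R <= (2 ^ (2 * E))%N%:R :> rat.
    rewrite natr_absz intr_norm -ez normrM (ger0_norm x0) (ger0_norm (ler0n _ _)).
    rewrite mul2n -addnn expnD natrM; apply: ler_pM => //; by rewrite ler_nat.
  by rewrite ler_nat.
have lt k : (2 ^ k < 2 ^ k.+1)%N by rewrite ltn_exp2l.
apply: esize_rat_frac => //; first exact: leq_ltn_trans zE (lt _).
by apply: leq_ltn_trans dE _; rewrite ltn_exp2l //; lia.
Qed.

Lemma flow_residual (fl : seq (edge * rat)) : (forall p, p \in fl -> 0 <= p.2) -> exists den,
  (0 < den <= 2 ^ esize fl)%N /\ forall p, p \in fl -> residual den (2 ^ esize fl)%N%:R p.2.
Proof.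
move=> nn; pose (den := (\prod_(x <- map snd fl) `|denq x|)%N); exists den; split.
  have /andP[h1 h2] := prod_den_row (map snd fl); rewrite h1; apply: leq_trans h2 _.
  by rewrite leq_exp2l // esize_map_snd.
move=> p pf; have [h1 h2] := rat_lt_exp p.2.
have le2 : (2 ^ esize p.2 <= 2 ^ esize fl)%N.
  rewrite leq_exp2l //; apply: leq_trans (esize_map_snd fl); apply/ltnW/esize_mem.
  exact: map_f.
have dn : (denq p.2)%:~R != 0 :> rat by rewrite intr_eq0 denq_neq0.
split.
  rewrite nn //=; apply: (@le_trans _ _ (`|numq p.2|)%N%:R).
    rewrite natr_absz intr_norm -[leLHS]ger0_norm ?nn // -{1}[p.2]divq_num_den normf_div.
    apply: ler_piMr => //; rewrite invf_le1 ?normr_gt0 // -intr_norm -[1]/(1%:~R) ler_int.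
    by have := denq_gt0N p.2; lia.
  by rewrite ler_nat ltnW // (leq_trans h1).
have dv : (`|denq p.2| %| den)%N.
  by rewrite /den (big_rem p.2) ?map_f //= dvdn_mulr.
exists (numq p.2 * (den %/ `|denq p.2|)%N%:Z).
have dE : (`|denq p.2|%N)%:R = (denq p.2)%:~R :> rat by rewrite -[in RHS]absz_denq.
have ek : p.2 * (denq p.2)%:~R = (numq p.2)%:~R by rewrite -{1}[p.2]divq_num_den divfK.
by rewrite -{1}(divnK dv) natrM dE rmorphM /= -ek [_ * (denq p.2)%:~R]mulrC mulrA.
Qed.

Lemma pt_decompose {X} {EX : enc X} (D : X -> Prop) (m : X -> nat) (c : X -> seq rat) (fl : X -> seq (edge * rat)) :
  pt D m -> pt D c -> pt D fl -> (forall x, D x -> forall p, p \in fl x -> 0 <= p.2) ->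
  pt D (fun x => decompose (m x) (c x) (fl x)).
Proof.
move=> pm pc pf nn; have [km hm] := pt_size pm; have [kf hf] := pt_size pf.
rewrite /decompose; apply: pt_snd.
pose (M := fun n => ((n + 2) ^ km)%N); pose (F := fun n => ((n + 2) ^ kf)%N).
pose (R := fun n => (8 * (2 * F n).+1 + 11)%N).
apply: (@pt_iter _ _ _ _ _ (fun x => size (fl x)) (fun x => peel (m x) (c x)) (fun x => (fl x, [::]))
  (fun n => (F n * (F n + R n + 1).+1 + 1) + (F n * ((((M n).+1 * (F n).+1 + 1) + R n + 1)).+1 + 1) + 1)%N) => //.
- by pt_auto.
- by pt_auto.
- apply: (@pt_sub _ _ _ _ _ (fun y => D y.1)) => [y []//|].
  by apply: pt_peel; [exact: (pt_lift pm)|exact: (pt_lift pc)|pt_auto].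
- by rewrite /R /M /F; growth.
move=> x Dx i hi; have [den [hd hr]] := flow_residual (nn x Dx).
have hF : (esize (fl x) <= F (esize x))%N by apply: hf.
have hM : (m x <= M (esize x))%N by have := hm x Dx; rewrite esize_nat /M; lia.
have top0 : 0 <= (2 ^ esize (fl x))%N%:R :> rat by apply: ler0n.
have [h1 h2 h3 h4] := peel_residual (m x) (c x) i top0 hr.
have hR y : residual den (2 ^ esize (fl x))%N%:R y -> (esize y <= R (esize x))%N.
  move=> /(esize_residual hd) h; apply: leq_trans h _; rewrite /R; lia.
have hz : (size (fl x) <= F (esize x))%N by apply: leq_trans hF; apply/ltnW/size_le_esize.
move: (F _) (M _) (R _) hF hM hR hz => F' M' R' hF hM hR hz.
move: (iter _ _ _) h1 h2 h3 h4 => [g o] /= h1 h2 h3 h4; rewrite esize_pair.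
have g1 : (esize g <= F' * (F' + R' + 1).+1 + 1)%N.
  apply: leq_trans (esize_all (m := (F' + R' + 1)%N) _) _.
    move=> [e y] pg; have hy := hR _ (h2 _ pg).
    have he : (esize (e : edge) <= F')%N.
      apply: leq_trans hF; apply: leq_trans (esize_map_fst (fl x)); apply/ltnW/esize_mem.
      by rewrite -h1; apply: (map_f fst pg).
    by rewrite esize_pair; move: he hy => /=; lia.
  rewrite leq_add2r leq_mul2r -(size_map fst) h1 size_map hz; lia.
have g2 : (esize o <= F' * ((M'.+1 * F'.+1 + 1) + R' + 1).+1 + 1)%N.
  apply: leq_trans (esize_all (m := ((M'.+1 * F'.+1 + 1) + R' + 1)%N) _) _.
    move=> [a y] /h4 [/= /hR hy hs /esize_keys he]; rewrite esize_pair.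
    have : (esize a <= M'.+1 * F'.+1 + 1)%N.
      apply: leq_trans he _; rewrite leq_add2r; apply: leq_mul; last by rewrite ltnS; exact: hF.
      by apply: (leq_trans hs); rewrite ltnS; exact: hM.
    by move=> ha; rewrite addn1 ltnS; exact: leq_add ha hy.
  by rewrite leq_add2r leq_mul2r; apply/orP; right; exact: leq_trans (leq_trans h3 hi) hz.
by rewrite addn1 ltnS; exact: leq_add g1 g2.
Qed.

Lemma pt_opened {X} {EX : enc X} (D : X -> Prop) (dm : X -> seq (seq rat)) (rad wts : X -> seq rat)
    (L : X -> seq (seq nat)) (acc : X -> seq edge) :
  pt D dm -> pt D rad -> pt D wts -> pt D L -> pt D acc ->
  pt D (fun x => opened (dm x) (rad x) (wts x) (L x) (acc x)).
Proof.
move=> pd pr pw pL pa.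
apply: (pt_app4 (f := fun d w L acc => opened d.1 d.2 w L acc) _ (pt_pair pd pr) pw pL pa).
rewrite /opened; apply: pt_mkseq; first by pt_auto.
apply: pt_mem; first by pt_auto.
apply: pt_map_free; first by pt_auto.
by apply: pt_cheapest; pt_auto.
Qed.

Lemma pt_answer_of {X} {EX : enc X} (D : X -> Prop) (dm : X -> seq (seq rat)) (rad wts : X -> seq rat)
    (L : X -> seq (seq nat)) (As : X -> seq edge) (c y : X -> seq rat) :
  pt D dm -> pt D rad -> pt D wts -> pt D L -> pt D As -> pt D c -> pt D y ->
  (forall x, D x -> forall j, 0 <= nth 0 (y x) j) ->
  pt D (fun x => answer_of (dm x) (rad x) (wts x) (L x) (As x) (c x) (y x)).
Proof.
move=> pd pr pw pL pA pc py nn; rewrite /answer_of; apply: pt_map_free.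
  apply: pt_decompose => //; [exact: pt_size_seq|exact: pt_flow_of|].
  by move=> x Dx p /mapP[i _ ->]; apply: nn.
apply: pt_pair.
  by apply: pt_opened; [exact: (pt_lift pd)|exact: (pt_lift pr)|exact: (pt_lift pw)|exact: (pt_lift pL)|pt_auto].
apply: pt_mulr; first by pt_auto.
by apply: pt_invr; apply: pt_nth; [exact: (pt_lift py)|pt_auto].
Qed.

(** * The whole algorithm on lists *)

Definition raw_input := (seq (seq rat) * (seq rat * (seq rat * (seq rat * rat))))%type.
Definition raw_lottery (x : raw_input) := lottery x.1 x.2.1 x.2.2.1 x.2.2.2.1 x.2.2.2.2.
Definition bounded_weights (q : {poly nat}) (x : raw_input) : Prop :=
  exists unit : rat, forall v, exists2 k : nat, nth 0 x.2.2.2.1 v = k%:R * unit & (k <= q.[esize x])%N.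

(* The only use of poly-boundedness: distinct partial sums are distinct multiples of the unit. *)
Lemma all_sums_size cs (unit : rat) M : (forall a, a \in cs -> exists2 k : nat, a = k%:R * unit & (k <= M)%N) ->
  (size (all_sums cs) <= size cs * M + 1)%N.
Proof.
move=> h; rewrite -(size_iota 0 (size cs * M + 1)) -(size_map (fun j : nat => j%:R * unit)).
apply: uniq_leq_size; first exact: all_sums_uniq.
have H t : t \in all_sums cs -> exists2 j : nat, t = j%:R * unit & (j <= size cs * M)%N.
  rewrite /all_sums; elim/last_ind: cs h t => [|cs a IH] h t.
    by rewrite inE => /eqP ->; exists 0%N; rewrite ?mul0r.
  rewrite foldl_rcons /sum_step nub_stepE size_rcons.
  have [|k -> kM] := h a; first by rewrite mem_rcons mem_head.
  have {}IH t' : t' \in foldl sum_step [:: 0] cs -> exists2 j : nat, t' = j%:R * unit & (j <= size cs * M)%N.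
    by apply: IH => b bs; apply: h; rewrite mem_rcons inE bs orbT.
  case/orP=> [/IH [j -> jM]|/mapP[u /IH[j -> jM] ->]].
    by exists j => //; rewrite mulSn; lia.
  by exists (j + k)%N; rewrite ?natrD ?mulrDl // mulSn; lia.
move=> t /H[j -> jM]; apply/mapP; exists j => //.
by rewrite mem_iota add0n addn1 ltnS.
Qed.

Lemma pt_lottery q : pt (bounded_weights q) raw_lottery.
Proof.
set D := bounded_weights q.
have pd : pt D (fun x => x.1) by pt_auto.
have pr : pt D (fun x => x.2.1) by pt_auto.
have pp : pt D (fun x => x.2.2.1) by pt_auto.
have pw : pt D (fun x => x.2.2.2.1) by pt_auto.
have pB : pt D (fun x => x.2.2.2.2) by pt_auto.
have pR := pt_reps pd pr pp; have pL := pt_chains pd pr pR.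
have pc := pt_costs pd pr pw pL; have pb := pt_behead pc.
have [k hk] := pt_size pb.
have pS : pt D (fun x => sums_upto x.2.2.2.2
    (behead (costs x.1 x.2.1 x.2.2.2.1 (chains x.1 x.2.1 (reps x.1 x.2.1 x.2.2.1))))).
  rewrite /sums_upto; apply: pt_filter; last by pt_auto.
  apply: (@pt_all_sums _ _ _ _ (fun n => (n + 2) ^ k * q.[n] + 1)%N pb).
    by have gq := growth_poly q; growth.
  move=> x Dx s1 s2 e; have [unit hu] := Dx.
  apply: leq_trans (all_sums_size (unit := unit) (M := q.[esize x]) _) _.
    move=> a as1; have : a \in behead (costs x.1 x.2.1 x.2.2.2.1 (chains x.1 x.2.1 (reps x.1 x.2.1 x.2.2.1))).
      by rewrite e mem_cat as1.
    by move=> /mapP[c _ ->]; apply: hu.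
  rewrite leq_add2r leq_mul2r; apply/orP; right; apply: leq_trans (hk x Dx); rewrite e.
  apply: leq_trans (ltnW (size_le_esize s1)) _; exact: esize_prefix.
have pm := pt_size_seq pL; have pA := pt_arcs pm pc pS.
rewrite /raw_lottery /lottery /round_flow.
apply: (@pt_omatch _ _ _ _ _ _ _ (fun x : raw_input => let Rs := reps x.1 x.2.1 x.2.2.1 in
   let L := chains x.1 x.2.1 Rs in let c := costs x.1 x.2.1 x.2.2.2.1 L in
   let sums := sums_upto x.2.2.2.2 (behead c) in
   solve (flow_width (arcs (size L) c sums) Rs) (flow_matrix (size L) c sums ([::] :: L) x.2.2.1 Rs))
  (fun x y => let Rs := reps x.1 x.2.1 x.2.2.1 in
   let L := chains x.1 x.2.1 Rs in let c := costs x.1 x.2.1 x.2.2.2.1 L in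
   let sums := sums_upto x.2.2.2.2 (behead c) in
   Some (answer_of x.1 x.2.1 x.2.2.2.1 L (arcs (size L) c sums) c y)) (fun=> None)); last by pt_auto.
  cbv zeta; apply: pt_solve; first exact: pt_flow_width.
  by apply: pt_flow_matrix => //; apply: pt_cons => //; pt_auto.
cbv zeta; apply: pt_some; set D' := fun _ => _ /\ _.
(* The branch domain [D'] remembers that [y.2] was returned by the solver. Its entries are thus
   nonnegative, which bounds the sizes during the decomposition. *)
have sub (y : raw_input * seq rat) : D' y -> D y.1 by case.
apply: pt_answer_of.
- exact: pt_sub sub (pt_lift pd).
- exact: pt_sub sub (pt_lift pr).
- exact: pt_sub sub (pt_lift pw).
- exact: pt_sub sub (pt_lift pL).
- exact: pt_sub sub (pt_lift pA).
- exact: pt_sub sub (pt_lift pc).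
- by pt_auto.
by move=> y [_ /(solve_sound (ltn0Sn _)) []].
Qed.

Lemma lottery_bits dm rad prob wts B l o : lottery dm rad prob wts B = Some l -> o \in l -> size o.1 = size rad.
Proof.
rewrite /lottery /round_flow; case: (solve _ _) => // x [<-] /mapP[o' _ ->].
by rewrite /opened size_mkseq.
Qed.

(** * Encoding of instances and answers *)

Lemma enc_seq_map (T U : Type) (e : U -> data) (f : T -> U) s : enc_seq e (map f s) = enc_seq (e \o f) s.
Proof. by elim: s => //= a s ->. Qed.

Lemma eq_enc_seq (T : Type) (e e' : T -> data) : e =1 e' -> enc_seq e =1 enc_seq e'.
Proof. by move=> h s; elim: s => //= a s ->; rewrite h. Qed.

Definition table (T : Type) n (f : 'I_n -> T) : seq T := [seq f i | i <- enum 'I_n].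

Lemma size_table T n (f : 'I_n -> T) : size (table f) = n.
Proof. by rewrite size_map size_enum_ord. Qed.

Lemma nth_table T n (f : 'I_n -> T) x0 (v : 'I_n) : nth x0 (table f) v = f v.
Proof. by rewrite (nth_map v) ?size_enum_ord // nth_ord_enum. Qed.

(** Nested lists whose generic encoding is literally [enc_instance I], so the program on lists runs
    on instances without conversion. *)
Definition raw (I : instance) : raw_input :=
  (table (fun i => table (dist (Defs.space I) i)), (table (radius (Defs.space I)), (table (prob_demand (Defs.space I)),
    (table (weight I), budget I)))).

Lemma raw_encode I : encode (raw I) = enc_instance I.
Proof.
congr (DCons _ (DCons _ (DCons _ (DCons _ _)))); try exact: enc_seq_map.
by rewrite [LHS]enc_seq_map; apply: eq_enc_seq => i; apply: enc_seq_map.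
Qed.

Lemma ent_table n (f : 'I_n -> 'I_n -> rat) (u v : 'I_n) : ent (table (fun i => table (f i))) u v = f u v.
Proof. by rewrite /ent !nth_table. Qed.

Lemma raw_bounded q I : poly_bounded q I -> bounded_weights q (raw I).
Proof.
move=> [unit _ h]; exists unit => v /=; case: (ltnP v (npts I)) => vn.
  rewrite -[v]/(val (Ordinal vn)) nth_table; have [k e le] := h (Ordinal vn); exists k => //.
  by rewrite /esize raw_encode.
by exists 0%N; rewrite ?mul0r // nth_default // size_table.
Qed.

Lemma dist_to_le (X : finType) (M : demand_metric X) v (S : {set X}) x :
  (dist_to M v S <= x%:E)%E = [exists s in S, dist M v s <= x].
Proof.
apply/idP/idP => [|/exists_inP[s sS le]]; last by rewrite /dist_to (bigD1 s) //= ge_min lee_fin le.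
apply: contraLR; rewrite negb_exists_in => /forall_inP no; rewrite -ltNge /dist_to.
apply: (big_ind (fun y => x%:E < y)%E) => [|y z h1 h2|s sS]; first exact: ltry.
- by rewrite lt_min h1.
by rewrite lte_fin ltNge no.
Qed.

(** Several paths may open the same set, whose mass collects their weights; sums over sets are
    thereby turned back into sums over list entries. *)
Lemma sum_mass (X : finType) (l : seq ({set X} * rat)) (Q : pred {set X}) :
  \sum_(S : {set X} | Q S) mass l S = \sum_(p <- l | Q p.1) p.2.
Proof.
rewrite /mass (exchange_big_dep (fun p : {set X} * rat => Q p.1)) /=; last by move=> S p QS /eqP ->.
apply: eq_bigr => p Qp; rewrite (big_pred1 p.1) // => S; rewrite [RHS]eq_sym.
by case: eqP => [<-|_]; rewrite ?Qp ?andbF.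
Qed.

Definition set_of_bits n (b : seq bool) : {set 'I_n} := [set u : 'I_n | nth false b u].

Lemma enc_set_of_bits n (b : seq bool) : size b = n -> enc_set (set_of_bits n b) = encode b.
Proof.
move=> sz; apply: etrans (esym (enc_seq_map _ _ _)) _; rewrite -/(table (fun u => u \in set_of_bits n b)).
congr enc_seq.
apply: (@eq_from_nth _ false); rewrite size_table ?sz // => u un.
by rewrite -[u]/(val (Ordinal un)) nth_table inE.
Qed.

Definition answer_of_raw n (a : option (seq (seq bool * rat))) : answer 'I_n :=
  omap (map (fun o => (set_of_bits n o.1, o.2))) a.

Lemma enc_answer_of_raw n a : (forall l o, a = Some l -> o \in l -> size o.1 = n) ->
  enc_answer (answer_of_raw n a) = encode a.
Proof.
case: a => [l|//] /(_ l _ erefl) h; rewrite /= enc_seq_map; congr DCons.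
elim: l h => //= o l IH h; rewrite IH => [|o' ol]; last by apply: h; rewrite inE ol orbT.
by rewrite enc_set_of_bits //; apply: h; rewrite mem_head.
Qed.

Lemma lottery_correct (K : realFieldType) I :
  correct_answer K (Defs.space I) (knapsack_family I) 14%:R (answer_of_raw (npts I) (raw_lottery (raw I))).
Proof.
set M := Defs.space I; set n := npts I.
have entE (u v : nat) (un : (u < n)%N) (vn : (v < n)%N) :
    ent (table (fun i => table (dist M i))) u v = dist M (Ordinal un) (Ordinal vn).
  exact: (ent_table _ (Ordinal un) (Ordinal vn)).
have h0 : size (table (radius M)) = n by rewrite size_table.
have h1 u : (u < n)%N -> ent (table (fun i => table (dist M i))) u u = 0.
  by move=> un; rewrite entE; apply/dist_eq0.
have h2 u v : (u < n)%N -> (v < n)%N -> ent (table (fun i => table (dist M i))) u v = ent (table (fun i => table (dist M i))) v u.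
  by move=> un vn; rewrite !entE dist_sym.
have h3 u v z : (u < n)%N -> (v < n)%N -> (z < n)%N ->
    ent (table (fun i => table (dist M i))) u z <=
      ent (table (fun i => table (dist M i))) u v + ent (table (fun i => table (dist M i))) v z.
  by move=> un vn zn; rewrite !entE dist_triangle.
have h4 u : (u < n)%N -> 0 < nth 0 (table (radius M)) u.
  by move=> un; rewrite (nth_table (radius M) 0 (Ordinal un)) radius_gt0.
have h5 u : 0 <= nth 0 (table (weight I)) u.
  case: (ltnP u n) => un; first by rewrite (nth_table (weight I) 0 (Ordinal un)) weight_ge0.
  by rewrite nth_default ?size_table.
have h6 : 0 <= budget I by apply/ltW/budget_gt0.
have none := @lottery_none n _ _ (table (prob_demand M)) _ _ h0 h1 h2 h3 h4 h5 h6 K.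
have some := @lottery_some n _ _ (table (prob_demand M)) _ _ h0 h1 h2 h3 h4 h5 h6.
have -> : raw_lottery (raw I) = lottery (table (fun i => table (dist M i))) (table (radius M)) (table (prob_demand M))
    (table (weight I)) (budget I).
  by cbv beta iota delta [raw_lottery raw fst snd].
move: (lottery _ _ _ _ _) none some => [l|] none some.
  have {none some} [l1 l2 l3] := some l erefl.
  split=> [|v]; last first.
    rewrite sum_mass big_map /= -[prob_demand M v](nth_table (prob_demand M) 0 v) /ratr divq_num_den.
    apply: le_trans (l3 v) _; rewrite big_mkcond [leRHS]big_mkcond; rewrite le_eqVlt; apply/orP; left; apply/eqP.
    apply: eq_bigr => o _; rewrite dist_to_le; congr (if _ then _ else _).
    by apply: eq_existsb => s; rewrite inE ent_table nth_table.
  split.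
  - by move=> S; rewrite /mass big_map big_seq_cond; apply: sumr_ge0 => o /andP[/l1[]].
  - move=> S nS; rewrite /mass big_map big1_seq // => o /= /andP[/eqP eS /l1 [_ ho]].
    case/negP: nS; rewrite -eS inE; apply: le_trans ho; rewrite (eq_bigl (fun u : 'I_n => nth false o.1 u)).
      by apply: ler_sum => u _; rewrite nth_table.
    by move=> u; rewrite inE.
  - by rewrite sum_mass big_map.
case=> mu [[m1 m2 m3] m4]; apply: (none mu erefl m1 _ m3).
  move=> S nz; have : S \in knapsack_family I by apply: contraNT nz => /m2 ->.
  rewrite inE; apply: le_trans; apply: ler_sum => u _; by rewrite nth_table.
move=> u; rewrite nth_table; apply: le_trans (m4 u) _.
rewrite le_eqVlt; apply/orP; left; apply/eqP; apply: eq_bigl => S; rewrite dist_to_le.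
by apply: eq_existsb => s; rewrite ent_table nth_table mul1r.
Qed.

Theorem theorem6p4 (R : realType) (q : {poly nat}) :
  polytime_approximation R 14%:R (poly_bounded q).
Proof.
have [P [i [k [cP comp]]]] := pt_lottery q.
(* The entry point must be function 0, so a body that only calls the right function is put in front
   and all other indices move by one. The polynomial is the bound of [computes_call]. *)
exists (ECall i.+1 (EVar 0) :: map (shift_calls 1) P), ('X + 2%:P * ('X + 2%:P) ^+ k) => I /raw_bounded DI.
have link := computes_link [:: ECall i.+1 (EVar 0)] [::] cP comp.
rewrite cats0 in link; set P' := (X in computes X) in link.
have var : runs_within P' [:: encode (raw I)] (EVar 0) (encode (raw I)) (esize (raw I)) by apply: within_var.
have [t ev le] := computes_call link DI var.
exists (answer_of_raw (npts I) (raw_lottery (raw I))), t; split.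
- rewrite enc_answer_of_raw => [|l o El ol]; first by rewrite /runs -raw_encode.
  by rewrite (lottery_bits El ol) size_table.
- rewrite !hornerE /= /input_size -raw_encode; move: le; rewrite /esize; move: (dsize _) => z le.
  rewrite -[X in (_ <= X)%N]/(z + (z + 1 + 1) ^ k + (z + 1 + 1) ^ k + 0)%N.
  by rewrite addn0 -[(z + 1 + 1)%N]addnA -addnA addnn -mul2n.
exact (lottery_correct R I).
Qed.
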